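(* Let $\eta\in(0,\frac14)$, $\rho\in(0,\frac12)$, $w\in(1-\rho)\mathbb B^N$ with $\|w\|_0\le N^{1-2\eta}$, and $T\ge1$. For any $\theta\in[0,T]$, $R\in[\log N,N^{1/4}]$ and $r\in[N^{-4},\frac\rho{10}]$, $$F_N(\theta;\mathsf U_w^N(r,R))=\varphi_{N,R}(\theta,w)+O_{T,\rho}\big(r+R^2N^{-1/2}+N^{-2\eta}\log N\big)$$ for all $N$ sufficiently large depending on $T$ and $\rho$.
   Context: $\mu$ is a Borel probability measure on $\mathbb R$ with mean zero and unit variance, sub-Gaussian (i.e. $\Lambda_\mu(t)\le Ct^2$ for all $t$, some $C<\infty$), where $\Lambda_\mu(t):=\log\int e^{tx}d\mu(x)$. $(X_{ij})_{1\le i\le j\le N}$ are iid with law $\mu$ and $H$ is the real symmetric $N\times N$ matrix with $H_{ij}=\sqrt{2^{1_{i=j}}/N}\,X_{ij}$ for $i\le j$. $\mathbb B^N$ is the closed Euclidean unit ball of $\mathbb R^N$, $\|w\|_0=|\mathrm{supp}(w)|$. $P$ is the uniform probability measure on $\mathbb S^{N-1}$. For measurable $\mathsf U\subseteq\mathbb S^{N-1}$, $F_N(\theta;\mathsf U):=\frac1N\log\mathbb E\int_{\mathsf U}e^{N\theta\langle u,Hu\rangle}dP(u)$. For $u,w\in\mathbb R^N$, $u_w:=(u_i1_{w_i\ne0})_i$, $u_{w^c}:=(u_i1_{w_i=0})_i$, and $$\mathsf U_w^N(r,R):=\big\{u\in\mathbb S^{N-1}:\|u_w-w\|_2\le r,\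 \|u_{w^c}\|_\infty\le R/\sqrt N\big\}.$$ $\gamma$ is the standard Gaussian measure, $H(\nu|\gamma)$ the relative entropy, $\mathcal P_\alpha(I)$ the Borel probability measures on $I$ with second moment $\alpha$, $$\Phi_R(v,\alpha):=\sup_{\nu\in\mathcal P_\alpha([-R,R])}\Big\{\int\sum_{i\ge1}\Lambda_\mu(2v_is)\,d\nu(s)-H(\nu|\gamma)\Big\}.$$ With $\epsilon_{ij}:=\frac12(1+1_{i\ne j})$ and $f_N(\theta,w):=\frac1N\sum_{i\le j}\Lambda_\mu(2^{\epsilon_{ij}}\theta\sqrt N w_iw_j)$, $$\varphi_{N,R}(\theta,w):=f_N(\theta,w)+\theta^2(1-\|w\|_2^2)^2+\Phi_R(\theta w,1-\|w\|_2^2)-\tfrac12\|w\|_2^2.$$ $O_{T,\rho}(a)$ denotes a quantity bounded in absolute value by $Ca$ with $C$ depending only on $T,\rho$ and $\mu$.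
   Formalization: ''N sufficiently large'' may depend on η as well as on T, ρ and μ: with a threshold free of η the claim fails, since for tiny η a vector w may have N−1 nonzero coordinates, making U_w^N(r,R) empty and F_N = −∞. The constant in O_{T,ρ} stays independent of η. *)

(* Defs.v *)
From HB Require Import structures.
From mathcomp Require Import all_boot all_order all_algebra.
From mathcomp Require Import all_classical all_reals all_analysis.

Set Implicit Arguments.
Unset Strict Implicit.
Unset Printing Implicit Defensive.

Import Order.TTheory GRing.Theory Num.Theory.
Import numFieldNormedType.Exports.

Local Open Scope classical_set_scope.
Local Open Scope ring_scope.

(* Quantities that may be infinite a priori (logarithms, relative entropy,
   suprema) are kept in [\bar R]; [lne] is the extended logarithm, with
   [lne 0 = -oo]. *)

Section law.
Context {R : realType}.
Implicit Types (mu nu : probability (measurableTypeR R) R) (t : R).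

Definition log_laplace mu t : \bar R := lne ('M_mu id t).

Definition sub_gaussian mu : Prop :=
  exists C : R, forall t, (log_laplace mu t <= (C * t ^+ 2)%:E)%E.

Definition gaussian : probability (measurableTypeR R) R := normal_prob 0 1.

Definition relative_entropy nu mu : \bar R :=
  if pselect (nu `<< mu) then
    (\int[nu]_s lne (Radon_Nikodym (charge_of_finite_measure nu) mu s))%E
  else +oo%E.

Definition second_moment_on (alpha : R) (I : set R) :
    set (probability (measurableTypeR R) R) :=
  [set nu | nu I = 1%E /\ (\int[nu]_s (s ^+ 2)%:E)%E = alpha%:E].

End law.

Section independence.
Context {d d' : measure_display} {Omega : measurableType d}
  {E : measurableType d'} {R : realType}.
Variable Pr : probability Omega R.

Definition mutually_independent (I : finType) (D : {set I})
    (X : I -> {RV Pr >-> E}) : Prop :=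
  forall (J : {set I}) (A : I -> set E),
    J \subset D -> (forall i, measurable (A i)) ->
    Pr (\bigcap_(i in [set` J]) (X i @^-1` A i)) =
    (\prod_(i in J) Pr (X i @^-1` A i))%E.

Definition iid (mu : probability E R) (I : finType) (D : {set I})
    (X : I -> {RV Pr >-> E}) : Prop :=
  mutually_independent D X /\
  forall i, i \in D ->
    forall A : set E, measurable A -> distribution Pr (X i) A = mu A.

End independence.

Section vectors.
Context {R : realType} {N : nat}.
Implicit Types u w : 'rV[R]_N.

Definition norm2 u : R := Num.sqrt (\sum_i u ord0 i ^+ 2).

Definition norm0 w : nat := #|[pred i | w ord0 i != 0]|.

Definition restrict_supp w u : 'rV[R]_N :=
  \row_i (if w ord0 i != 0 then u ord0 i else 0).

Definition restrict_suppC w u : 'rV[R]_N :=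
  \row_i (if w ord0 i == 0 then u ord0 i else 0).

Definition sphere : set 'rV[R]_N := [set u | norm2 u = 1].

Definition quad_form (H : 'M[R]_N) u : R := (u *m H *m u^T) ord0 ord0.

(* The norm of ['rV[R]_N] provided by the library is the sup norm. *)
Definition U_set w (r K : R) : set 'rV[R]_N :=
  [set u | [/\ sphere u, norm2 (restrict_supp w u - w) <= r
             & `|restrict_suppC w u| <= K / Num.sqrt N%:R]].

End vectors.

Definition borel_rV (R : realType) (N : nat) :=
  g_sigma_algebraType (@open 'rV[R]_N).

(* The uniform measure on the sphere is the unique rotation-invariant Borel
   probability measure carried by it. *)
Definition uniform_on_sphere (R : realType) (N : nat)
    (P : probability (borel_rV R N) R) : Prop :=
  P sphere = 1%E /\
  forall (Q : 'M[R]_N) (A : set (borel_rV R N)),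
    Q *m Q^T = 1%:M -> measurable A ->
    P [set u : 'rV[R]_N | A (u *m Q)] = P A.

Definition upper_triangle (N : nat) : {set 'I_N * 'I_N} :=
  [set p : 'I_N * 'I_N | (p.1 <= p.2)%N]%SET.

(* Only the entries [X (i, j)] with [i <= j] are used. *)
Definition wigner_matrix (R : realType) (N : nat)
    (X : 'I_N * 'I_N -> R) : 'M[R]_N :=
  \matrix_(i, j) (Num.sqrt (2 ^+ (i == j) / N%:R) *
                  X (if (i <= j)%N then (i, j) else (j, i))).

Section free_energies.
Context {R : realType} {N : nat}.
Implicit Types (theta K : R) (v w : 'rV[R]_N).

Definition F_N {d : measure_display} {Omega : measurableType d}
    (Pr : probability Omega R) (X : 'I_N * 'I_N -> {RV Pr >-> measurableTypeR R})
    (P : probability (borel_rV R N) R) theta (U : set 'rV[R]_N) : \bar R :=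
  ((N%:R^-1)%:E *
   lne (\int[Pr]_omega \int[P]_(u in U)
     (expR (N%:R * theta *
        quad_form (wigner_matrix (fun p => X p omega)) u))%:E))%E.

Variable mu : probability (measurableTypeR R) R.

Definition Phi K v (alpha : R) : \bar R :=
  ereal_sup [set (\int[nu]_s (\sum_i log_laplace mu (2 * v ord0 i * s))
                  - relative_entropy nu gaussian)%E
            | nu in second_moment_on alpha `[- K, K]].

Definition f_N theta w : \bar R :=
  ((N%:R^-1)%:E * \sum_(i < N) \sum_(j < N | (i <= j)%N)
     log_laplace mu (2 `^ (2^-1 * (1 + (i != j)%:R)) * theta *
                     Num.sqrt N%:R * w ord0 i * w ord0 j))%E.

Definition varphi K theta w : \bar R :=
  (f_N theta w + (theta ^+ 2 * (1 - norm2 w ^+ 2) ^+ 2)%:E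
   + Phi K (theta *: w) (1 - norm2 w ^+ 2)
   - (2^-1 * norm2 w ^+ 2)%:E)%E.

End free_energies.

(* Main.v *)
(* Averaging over the matrix turns [F_N] into [1/N ln] of the integral over the
   sphere of [e^(N f(u))], where [N f(u)] is a sum of log-Laplace transforms over
   pairs of coordinates.  For [u] close to [w] on the support of [w] and with small
   coordinates elsewhere, [N f(u)] equals [N f(w)], plus a sum of one-coordinate
   functions of the small coordinates, plus a quadratic term, up to the allowed
   error.

   The uniform measure is the law of [x / |x|] for a standard Gaussian [x],
   independently of [|x|], so the spherical integral becomes a Gaussian integral
   over a shell of radius about [sqrt N].  Tilting the small coordinates by
   [e^(L(s) - lam s^2 - Psi)], with [lam] chosen so that the second moment is
   [1 - |w|^2], makes the integrand a product: by Gibbs' inequality [lam al + Psi]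
   is the value of [Phi], which gives the upper bound, and Chernoff bounds show
   that the tilted measure charges the constraint, which gives the lower one. *)

Require Import Defs.
From HB Require Import structures.
From mathcomp Require Import all_boot all_order all_algebra.
From mathcomp Require Import all_classical all_reals all_analysis.
From mathcomp Require Import measurable_realfun ring lra.

Set Implicit Arguments.
Unset Strict Implicit.
Unset Printing Implicit Defensive.

Import Order.TTheory GRing.Theory Num.Theory.
Import numFieldNormedType.Exports.

Local Open Scope classical_set_scope.
Local Open Scope ring_scope.

(** * Borel sets and product measures on row vectors *)

(** The measure on the sphere is known only through its invariance, so its Gaussian description
    rests on a uniqueness theorem, and the product Gaussian must itself be shown to be rotation
    invariant. Two different shells are used because the bound on small coordinates is sharp. For
    [dot x x <= n], a bound [K / sqrt n] on the projected coordinates gives [K] for those of [x],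
    which the upper bound needs; for [dot x x >= n] the implication is reversed, which the lower
    bound needs. The error terms have separate origins. Fluctuations of the squared norm, of order
    at most [K sqrt n], and the cubic Taylor remainder give [K^2 N^(-1/2)]. Pinning each of the
    [norm0 w] coordinates of the support to polynomial precision costs a factor [n^(-8)], whence
    [N^(- 2 eta) ln N]. The term [r] is the Lipschitz cost of moving on the support. These errors
    are linear in the multipliers [lam] and [Psi], which must therefore be bounded uniformly in the
    dimension, in [w] and in [K]. *)

Section borel_rV_measurability.
Context {R : realType}.

Lemma open_measurable_rV n (A : set 'rV[R]_n) :
  open A -> measurable (A : set (borel_rV R n)).
Proof. by move=> oA; apply: sub_sigma_algebra. Qed.

Lemma closed_measurable_rV n (A : set 'rV[R]_n) :
  closed A -> measurable (A : set (borel_rV R n)).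
Proof.
move=> cA; rewrite -(setCK A); apply: measurableC.
by apply: open_measurable_rV; exact: closed_openC.
Qed.

Lemma measurable_coord n (i : 'I_n) :
  measurable_fun [set: borel_rV R n] (fun u : borel_rV R n => u ord0 i).
Proof.
apply: (measurability _ (RGenOInfty.measurableE R)) => _ [_ [x ->] <-].
rewrite setTI; apply: open_measurable_rV.
have /continuousP : continuous (fun u : 'rV[R]_n => u ord0 i).
  by move=> u; exact: coord_continuous.
by apply; exact: interval_open.
Qed.

(** A countable base: it writes open sets as countable unions in [measurable_rV] and enumerates null
    balls in [uniform_dball_gt0]. *)
Lemma rat_ball_rV n (A : set 'rV[R]_n) (x : 'rV[R]_n) : open A -> A x ->
  exists (c : 'rV[rat]_n) (k : nat), ball (map_mx ratr c : 'rV[R]_n) k.+1%:R^-1 x /\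
    ball (map_mx ratr c : 'rV[R]_n) k.+1%:R^-1 `<=` A.
Proof.
move=> oA Ax; have /nbhs_ballP[e /= e0 eA] : nbhs x A by exact: open_nbhs_nbhs.
have [k ke] : exists k : nat, k.+1%:R^-1 < e / 2.
  have := near_infty_natSinv_lt (PosNum (divr_gt0 e0 (ltr0Sn R 1))).
  by case => k _ /(_ k (leqnn k)) /= ?; exists k.
have k0 : 0 < k.+1%:R^-1 :> R by rewrite invr_gt0.
suff [c [xc cA]] : exists c : 'rV[rat]_n, ball (map_mx ratr c : 'rV[R]_n) k.+1%:R^-1 x /\
    ball (map_mx ratr c : 'rV[R]_n) k.+1%:R^-1 `<=` A by exists c, k.
move: (k.+1%:R^-1 : R) k0 ke => z k0 ke.
have H i : {q : rat | ratr q \in `]x ord0 i - z, x ord0 i + z[}.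
  by apply/cid/rat_in_itvoo; lra.
pose c : 'rV[rat]_n := \row_i sval (H i).
have cx : ball (map_mx ratr c : 'rV[R]_n) z x.
  split=> // i j; rewrite (ord1 i) !mxE /ball/=.
  by case: (H j) => q /=; rewrite in_itv/= => /andP[? ?]; rewrite ltr_norml; lra.
exists c; split => // y yb; apply: eA.
apply: (@le_ball _ _ _ (z + z)); first by lra.
by apply: ball_triangle yb; exact/ball_sym.
Qed.

(** Balls of the sup norm are products of intervals, so the preimage of an open set is a countable
    union of finite intersections of coordinate preimages. *)
Lemma measurable_rV d (T : measurableType d) n (f : T -> borel_rV R n) :
  (forall i, measurable_fun [set: T] (fun t => f t ord0 i)) ->
  measurable_fun [set: T] f.
Proof.
move=> mf; apply: (@measurability _ _ T (borel_rV R n) setT f (@open 'rV[R]_n)) => // _ [A oA <-].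
rewrite setTI.
pose B (p : 'rV[rat]_n * nat) : set 'rV[R]_n :=
  ball (map_mx ratr p.1 : 'rV[R]_n) p.2.+1%:R^-1.
have -> : f @^-1` A =
    \bigcup_(p : 'rV[rat]_n * nat) (if `[< B p `<=` A >] then f @^-1` B p else set0).
  apply/seteqP; split=> [t /= Aft|t [p _]].
    have [c [k [xc cA]]] := rat_ball_rV oA Aft.
    by exists (c, k) => //; rewrite asboolT.
  by case: asboolP => // BA /BA.
apply: countable_bigcupT_measurable => // p; case: ifP => // _.
have -> : f @^-1` B p = \bigcap_(i in [set: 'I_n])
    ((fun t => f t ord0 i) @^-1` ball (ratr (p.1 ord0 i) : R) p.2.+1%:R^-1).
  apply/seteqP; split=> [t [_ h] i _ /=|t h /=]; first by have := h ord0 i; rewrite !mxE.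
  by split; rewrite ?invr_gt0// => i j; rewrite !mxE ord1; exact: (h j).
apply: fin_bigcap_measurable => // i _; rewrite -[X in measurable X]setTI.
by apply: mf => //; apply: open_measurable; exact: ball_open.
Qed.

Definition product_box n (A : 'I_n -> set R) : set 'rV[R]_n :=
  [set u | forall i, A i (u ord0 i)].

Lemma measurable_product_box n (A : 'I_n -> set R) :
  (forall i, measurable (A i)) -> measurable (product_box A : set (borel_rV R n)).
Proof.
move=> mA; have -> : product_box A = \bigcap_(i in [set: 'I_n])
    ((fun u : borel_rV R n => u ord0 i) @^-1` A i).
  by apply/seteqP; split=> [u h i _|u h i]; exact: h.
apply: fin_bigcap_measurable => // i _; rewrite -[X in measurable X]setTI.
exact: measurable_coord.
Qed.

Lemma measure_eq_box n (m1 m2 : {measure set (borel_rV R n) -> \bar R}) :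
  (m1 setT < +oo)%E ->
  (forall A : 'I_n -> set R, (forall i, measurable (A i)) ->
    m1 (product_box A) = m2 (product_box A)) ->
  forall E, measurable E -> m1 E = m2 E.
Proof.
move=> m1oo m12 E mE.
pose G : set (set (borel_rV R n)) :=
  [set B | exists2 A : 'I_n -> set R, (forall i, measurable (A i)) & B = product_box A].
have GT : G setT.
  by exists (fun=> setT) => //; apply/seteqP; split.
apply: (@g_sigma_algebra_measure_unique _ R _ G _ (fun=> setT)) => //.
- by move=> _ [A mA ->]; exact: measurable_product_box.
- by apply/seteqP; split => // x _; exists 0%N.
- move=> _ _ [A mA ->] [B mB ->]; exists (fun i => A i `&` B i).
    by move=> i; exact: measurableI.
  by apply/seteqP; split=> [u [h1 h2] i|u h]; [split|split=> i; case: (h i)].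
- by move=> _ [A mA ->]; exact: m12.
(* Boxes generate the Borel sets: the identity on the sigma-algebra that they generate is measurable
   because its coordinates are. *)
- have mid : measurable_fun setT (idfun : g_sigma_algebraType G -> borel_rV R n).
    apply: measurable_rV => i _ A mA; rewrite setTI; apply: sub_sigma_algebra.
    exists (fun j => if j == i then A else setT) => [j|]; first by case: ifP.
    apply/seteqP; split=> [u uA j|u /(_ i)]; last by rewrite eqxx.
    by case: eqP => [->|].
  by rewrite -[E]setTI; exact: mid.
Qed.
End borel_rV_measurability.

(** * Measures given by densities *)

Section density.
Context d (T : measurableType d) (R : realType).
Variables (m : {measure set T -> \bar R}) (g : T -> R).
Hypotheses (mg : measurable_fun [set: T] g) (g0 : forall x, 0 <= g x).
Local Open Scope ereal_scope.

(** The two hypotheses are arguments of the definition, so that the measure structure declared on it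
    can recover their proofs from the term. *)
Definition density of measurable_fun [set: T] g & (forall x, (0 <= g x)%R) :
  set T -> \bar R := fun A => \int[m]_(x in A) (g x)%:E.

Let dens := density mg g0.

Let density0 : dens set0 = 0. Proof. exact: integral_set0. Qed.

Let density_ge0 A : 0 <= dens A.
Proof. by apply: integral_ge0 => x _; rewrite lee_fin. Qed.

Let density_sigma_additive : semi_sigma_additive dens.
Proof.
move=> F mF tF mUF; rewrite /dens/density ge0_integral_bigcup//.
- apply: is_cvg_ereal_nneg_natsum_cond => n _ _.
  by apply: integral_ge0 => x _; rewrite lee_fin.
- by apply/measurable_EFinP; exact: measurable_funTS.
- by move=> x _; rewrite lee_fin.
Qed.

HB.instance Definition _ := isMeasure.Build _ _ _
  dens density0 density_ge0 density_sigma_additive.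

Definition density_measure : {measure set T -> \bar R} := dens.
End density.

Import HBNNSimple.

(** Stated for any [nu] that has the density [g]: it then also serves [normal_prob] and densities
    obtained from Radon-Nikodym. The proof approximates [f] by simple functions and uses monotone
    convergence on both sides. *)
Lemma ge0_integral_density d (T : measurableType d) (R : realType)
    (m nu : {measure set T -> \bar R}) (g : T -> R) (f : T -> \bar R) :
  measurable_fun [set: T] g -> (forall x, 0 <= g x) ->
  (forall A, measurable A -> nu A = (\int[m]_(x in A) (g x)%:E)%E) ->
  measurable_fun [set: T] f -> (forall x, (0 <= f x)%E) ->
  (\int[nu]_x f x = \int[m]_x (f x * (g x)%:E))%E.
Proof.
move=> mg g0 nuE mf f0.
pose h := nnsfun_approx measurableT mf.
have cvh x : f x = limn (fun n => (h n x)%:E).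
  by apply/esym/cvg_lim => //; exact: cvg_nnsfun_approx.
have ndh x : {homo (fun n => (h n x)%:E) : a b / (a <= b)%N >-> (a <= b)%E}.
  by move=> a b ab; rewrite lee_fin; exact/lefP/nd_nnsfun_approx.
have mh n : measurable_fun setT (fun x => (h n x)%:E).
  exact/measurable_EFinP.
have mgE : measurable_fun setT (fun x => (g x)%:E) by exact/measurable_EFinP.
transitivity (limn (fun n => \int[nu]_x (h n x)%:E)%E).
  rewrite -monotone_convergence//.
  - by apply: eq_integral => x _; exact: cvh.
  - by move=> n x _; rewrite lee_fin.
transitivity (limn (fun n => \int[m]_x ((h n x)%:E * (g x)%:E))%E); last first.
  rewrite -monotone_convergence//.
  - apply: eq_integral => x _; rewrite cvh.
    apply/cvg_lim => //; apply: cvgeZr => //.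
    by rewrite -cvh; exact: cvg_nnsfun_approx.
  - by move=> n; exact: emeasurable_funM.
  - by move=> n x _; rewrite mule_ge0 ?lee_fin.
  - by move=> x _ a b ab; rewrite lee_wpmul2r ?lee_fin// -lee_fin; exact: ndh.
congr (limn _); apply/funext => n.
have mhr r : measurable_fun setT (fun x => (r * \1_(h n @^-1` [set r]) x)%:E).
  by apply/measurable_EFinP; exact: measurable_funM.
transitivity (\int[nu]_x (\sum_(r \in range (h n)) (r * \1_(h n @^-1` [set r]) x)%:E))%E.
  by apply: eq_integral => x _; rewrite fimfunE -fsumEFin.
rewrite ge0_integral_fsum//; last by move=> r x _; exact: nnfun_muleindic_ge0.
transitivity (\int[m]_x (\sum_(r \in range (h n))
    (r * \1_(h n @^-1` [set r]) x)%:E * (g x)%:E))%E; last first.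
  apply: eq_integral => x _.
  rewrite -ge0_mule_fsuml => [|r]; last exact: nnfun_muleindic_ge0.
  by rewrite fsumEFin // -fimfunE.
rewrite ge0_integral_fsum//; last 2 first.
- by move=> r; exact: emeasurable_funM.
- by move=> r x _; rewrite mule_ge0 ?lee_fin// -lee_fin nnfun_muleindic_ge0.
apply: eq_fsbigr => r /[!inE] -[x _ <-].
have hx : 0 <= h n x by [].
rewrite integralZl_indic_nnsfun//.
under [RHS]eq_integral do rewrite EFinM -muleA.
rewrite ge0_integralZl//; last 2 first.
- by apply: emeasurable_funM => //; exact/measurable_EFinP.
- by move=> y _; rewrite mule_ge0 ?lee_fin.
congr (_ * _)%E; rewrite integral_indic// setIT nuE//.
rewrite integral_mkcond; apply: eq_integral => y _.
by rewrite epatch_indic muleC.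
Qed.

Section product_probability.
Context {R : realType}.
Variable q : probability (measurableTypeR R) R.

Definition cons_rV n (p : measurableTypeR R * borel_rV R n) : borel_rV R n.+1 :=
  \row_i (if unlift ord0 i is Some j then (p.2 : 'rV[R]_n) ord0 j else p.1).

Lemma cons_rV0 n p : @cons_rV n p ord0 ord0 = p.1.
Proof. by rewrite mxE unlift_none. Qed.

Lemma cons_rVS n p (i : 'I_n) : @cons_rV n p ord0 (lift ord0 i) = p.2 ord0 i.
Proof. by rewrite mxE liftK. Qed.

Lemma measurable_cons_rV n : measurable_fun setT (@cons_rV n).
Proof.
apply: measurable_rV => i; case: (unliftP ord0 i) => [j ->|->].
  rewrite (_ : (fun _ => _) = (fun u : borel_rV R n => u ord0 j) \o snd); last first.
    by apply/funext => p; rewrite cons_rVS.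
  by apply: measurableT_comp => //; exact: measurable_coord.
rewrite (_ : (fun _ => _) = fst); first exact: measurable_fst.
by apply/funext => p; rewrite cons_rV0.
Qed.

HB.instance Definition _ n :=
  isMeasurableFun.Build _ _ _ _ (@cons_rV n) (@measurable_cons_rV n).

(** Binary products are transported to row vectors by [cons_rV], so that the result lives on the
    same Borel space as the measure on the sphere. *)
Fixpoint product_prob n : probability (borel_rV R n) R :=
  match n with
  | 0 => [the probability (borel_rV R 0) R of \d_((0 : 'rV[R]_0) : borel_rV R 0)]
  | n'.+1 => [the probability (borel_rV R n'.+1) R of
      distribution (q \x product_prob n')%E (@cons_rV n')]
  end.

Lemma measurable_prod_coord n (h : 'I_n -> R -> R) (I : {pred 'I_n}) :
  (forall i, measurable_fun setT (h i)) ->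
  measurable_fun [set: borel_rV R n]
    (fun x : borel_rV R n => \prod_(i in I) h i (x ord0 i)).
Proof.
move=> mh; elim: (index_enum _) => [|i s IH]; first by under eq_fun do rewrite big_nil; exact: measurable_cst.
under eq_fun do rewrite big_cons.
case: (i \in I) => //.
by apply: measurable_funM => //; apply: measurableT_comp => //; exact: measurable_coord.
Qed.

Lemma integral_product_prob n (h : 'I_n -> R -> R) :
  (forall i, measurable_fun setT (h i)) -> (forall i x, 0 <= h i x) ->
  (\int[product_prob n]_x (\prod_(i < n) h i (x ord0 i))%:E =
   \prod_(i < n) \int[q]_s (h i s)%:E)%E.
Proof.
elim: n h => [|n IH] h mh h0.
  rewrite big_ord0; under eq_integral do rewrite big_ord0.
  by rewrite integral_cst//= diracT mule1.
have mP : measurable_fun [set: borel_rV R n.+1]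
    (fun x : borel_rV R n.+1 => (\prod_(i < n.+1) h i (x ord0 i))%:E).
  by apply/measurable_EFinP; exact: measurable_prod_coord.
have P0 (x : 'rV[R]_n.+1) : 0 <= \prod_(i < n.+1) h i (x ord0 i) by exact: prodr_ge0.
rewrite /= ge0_integral_distribution//.
rewrite fubini_tonelli1//; first last.
  by move=> x; rewrite lee_fin.
  by apply: (measurableT_comp mP); exact: measurable_cons_rV.
rewrite big_ord_recl.
have P1 : (0 <= \prod_(i < n) \int[q]_s (h (lift ord0 i) s)%:E)%E.
  by apply: prode_ge0 => i _; apply: integral_ge0 => s _; rewrite lee_fin.
transitivity (\int[q]_s ((h ord0 s)%:E *
    \prod_(i < n) \int[q]_s (h (lift ord0 i) s)%:E))%E; last first.
  rewrite ge0_integralZr//.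
  - by apply/measurable_EFinP; exact: mh.
  - by move=> s _; rewrite lee_fin.
apply: eq_integral => s _; rewrite /fubini_F /= -IH//.
rewrite -ge0_integralZl//.
- apply: eq_integral => x _; rewrite big_ord_recl cons_rV0 -EFinM.
  by under eq_bigr do rewrite cons_rVS.
- by apply/measurable_EFinP; exact: (measurable_prod_coord (h := fun i => h (lift ord0 i)) predT).
- by move=> x _; rewrite lee_fin; exact: prodr_ge0.
- by rewrite lee_fin.
Qed.

End product_probability.

(** * The Gaussian measure and its rotation invariance *)

Section dot_product.
Context {R : realType}.

Definition dot n (u v : 'rV[R]_n) : R := \sum_i u ord0 i * v ord0 i.

Lemma dotC n (u v : 'rV[R]_n) : dot u v = dot v u.
Proof. by apply: eq_bigr => i _; rewrite mulrC. Qed.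

Lemma dotDl n (u v w : 'rV[R]_n) : dot (u + v) w = dot u w + dot v w.
Proof. by rewrite -big_split; apply: eq_bigr => i _; rewrite mxE mulrDl. Qed.

Lemma dotZl n a (u w : 'rV[R]_n) : dot (a *: u) w = a * dot u w.
Proof. by rewrite mulr_sumr; apply: eq_bigr => i _; rewrite mxE mulrA. Qed.

Lemma dotNl n (u w : 'rV[R]_n) : dot (- u) w = - dot u w.
Proof. by rewrite -scaleN1r dotZl mulN1r. Qed.

Lemma dotDr n (u v w : 'rV[R]_n) : dot w (u + v) = dot w u + dot w v.
Proof. by rewrite dotC dotDl !(dotC w). Qed.

Lemma dotNr n (u w : 'rV[R]_n) : dot w (- u) = - dot w u.
Proof. by rewrite dotC dotNl dotC. Qed.

Lemma dotZr n a (u w : 'rV[R]_n) : dot w (a *: u) = a * dot w u.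
Proof. by rewrite dotC dotZl dotC. Qed.

Lemma dot_ge0 n (u : 'rV[R]_n) : 0 <= dot u u.
Proof. by apply: sumr_ge0 => i _; rewrite -expr2 sqr_ge0. Qed.

Lemma dotE n (u v : 'rV[R]_n) : dot u v = (u *m v^T) ord0 ord0.
Proof. by rewrite mxE; apply: eq_bigr => i _; rewrite mxE. Qed.

Lemma dot_mulmx n (u v : 'rV[R]_n) (M : 'M[R]_n) : dot (u *m M) v = dot u (v *m M^T).
Proof. by rewrite !dotE trmx_mul trmxK mulmxA. Qed.

Lemma norm2E n (u : 'rV[R]_n) : norm2 u = Num.sqrt (dot u u).
Proof. by congr Num.sqrt; apply: eq_bigr => i _; rewrite expr2. Qed.

Lemma dot_eq0 n (u : 'rV[R]_n) : dot u u = 0 -> u = 0.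
Proof.
move/eqP; rewrite psumr_eq0 => [/allP h|i _]; last by rewrite -expr2 sqr_ge0.
apply/rowP => i; rewrite mxE; apply/eqP.
by have := h i (mem_index_enum i); rewrite /= mulf_eq0 orbb.
Qed.

Lemma measurable_comp_coord d (T : measurableType d) n (f : T -> borel_rV R n) i :
  measurable_fun setT f -> measurable_fun setT (fun t => f t ord0 i).
Proof.
by move=> mf; apply: (measurableT_comp (measurable_coord i)).
Qed.

Lemma measurable_dot d (T : measurableType d) n (f g : T -> borel_rV R n) :
  measurable_fun setT f -> measurable_fun setT g ->
  measurable_fun setT (fun t => dot (f t) (g t)).
Proof.
move=> mf mg; apply: measurable_sum => i.
by apply: measurable_funM; exact: measurable_comp_coord.
Qed.

Lemma measurable_addrV d (T : measurableType d) n (f g : T -> borel_rV R n) :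
  measurable_fun setT f -> measurable_fun setT g ->
  measurable_fun setT (fun t => ((f t : 'rV[R]_n) + g t : borel_rV R n)).
Proof.
move=> mf mg; apply: measurable_rV => i.
under eq_fun do rewrite mxE.
by apply: measurable_funD; exact: measurable_comp_coord.
Qed.

Lemma measurable_mulmxr n (M : 'M[R]_n) :
  measurable_fun setT (fun x : borel_rV R n => (x : 'rV[R]_n) *m M : borel_rV R n).
Proof.
apply: measurable_rV => i; under eq_fun do rewrite mxE.
apply: measurable_sum => j; apply: measurable_funM => //.
exact: measurable_coord.
Qed.

Lemma product_prob_box (q : probability (measurableTypeR R) R) n (A : 'I_n -> set R) :
  (forall i, measurable (A i)) ->
  product_prob q n (product_box A) = (\prod_(i < n) q (A i))%E.
Proof.
move=> mA; have mB := measurable_product_box mA.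
rewrite -[LHS]mul1e -[LHS]integral_cst//= integral_mkcond.
transitivity (\int[product_prob q n]_x (\prod_(i < n) \1_(A i) (x ord0 i) : R)%:E)%E.
  apply: eq_integral => x _; rewrite patchE; case: ifPn => [/[!inE] xA|].
    by rewrite big1// => i _; rewrite indicE mem_set.
  rewrite notin_setE => /existsNP[i xAi]; rewrite (bigD1 i)//= indicE memNset//.
  by rewrite mul0r.
rewrite (integral_product_prob q (h := fun i => \1_(A i)))//.
apply: eq_bigr => i _; rewrite integral_indic ?setIT//.
exact: mA.
Qed.

Lemma lebesgue_measure_shift (y : R) (A : set (measurableTypeR R)) : measurable A ->
  pushforward lebesgue_measure (fun s : measurableTypeR R => s + y : measurableTypeR R) A =
  lebesgue_measure A.
Proof.
move=> mA.
have msh : measurable_fun setT (fun s : measurableTypeR R => s + y : measurableTypeR R).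
  exact: measurable_funD.
pose sh : {mfun measurableTypeR R >-> measurableTypeR R} :=
  HB.pack (fun s : measurableTypeR R => s + y : measurableTypeR R)
    (isMeasurableFun.Build _ _ _ _ _ msh).
apply/esym; apply: (lebesgue_measure_unique (mu := pushforward lebesgue_measure sh)) => //= _ [[a b]] _ <-.
rewrite /pushforward.
rewrite (_ : _ @^-1` _ = `]a - y, b - y]%classic); last first.
  by apply/seteqP; split=> s /=; rewrite !in_itv/= ltrBlDr lerBrDr.
rewrite !lebesgue_measure_itv/= !lte_fin ltrD2r.
by case: ifP => // _; rewrite -!EFinB; congr EFin; ring.
Qed.

Lemma ge0_integral_gaussian (f : R -> \bar R) :
  measurable_fun setT f -> (forall s, (0 <= f s)%E) ->
  (\int[gaussian]_s f s = \int[lebesgue_measure]_s (f s * (normal_pdf 0 1 s)%:E))%E.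
Proof.
move=> mf f0; apply: ge0_integral_density => //.
- exact: measurable_normal_pdf.
- by move=> s; exact: normal_pdf_ge0.
Qed.

Lemma normal_pdf_shift (s y : R) :
  normal_pdf 0 1 (s - y) = expR (s * y - y ^+ 2 / 2) * normal_pdf 0 1 s.
Proof.
rewrite !normal_pdfE// /normal_fun [RHS]mulrCA -expRD; congr (_ * expR _).
by field.
Qed.

(** Translation invariance of Lebesgue measure moves the shift into the density, and the exponential
    is the quotient of the two densities. *)
Lemma gaussian_shift (y : R) (A : set (measurableTypeR R)) : measurable A ->
  gaussian ((fun s => s + y) @^-1` A) =
  (\int[gaussian]_(s in A) (expR (s * y - y ^+ 2 / 2))%:E)%E.
Proof.
move=> mA.
have msh : measurable_fun setT (fun s : measurableTypeR R => s + y : measurableTypeR R).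
  exact: measurable_funD.
have mex : measurable_fun setT (fun s : measurableTypeR R => (expR (s * y - y ^+ 2 / 2))%:E).
  apply/measurable_EFinP; apply: measurableT_comp => //.
  by apply: measurable_funB => //; exact: measurable_funM.
have mpdf : measurable_fun setT (fun s : measurableTypeR R => (normal_pdf 0 1 (s - y))%:E).
  apply/measurable_EFinP; apply: (measurableT_comp (measurable_normal_pdf 0 1)).
  exact: measurable_funB.
rewrite [RHS]integral_mkcond ge0_integral_gaussian; last 2 first.
- by apply/(measurable_restrictT _ mA); exact: measurable_funTS.
- by move=> s; apply: erestrict_ge0 => t _; rewrite lee_fin expR_ge0.
transitivity (\int[pushforward lebesgue_measure
    (fun s : measurableTypeR R => s + y : measurableTypeR R)%R]_(s in A)
    (normal_pdf 0 1 (s - y))%:E)%E.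
  rewrite ge0_integral_pushforward//.
  - by rewrite /gaussian /normal_prob; apply: eq_integral => s _ /=; rewrite addrK.
  - exact: measurable_funTS.
  - by move=> s _; rewrite lee_fin normal_pdf_ge0.
rewrite (eq_measure_integral (@lebesgue_measure R)) => [|B mB _]; last first.
  exact: lebesgue_measure_shift.
rewrite integral_mkcond; apply: eq_integral => s _; rewrite !patchE.
by case: ifP => _; rewrite ?mul0e// -EFinM normal_pdf_shift.
Qed.

Definition gaussian_rV n : probability (borel_rV R n) R := product_prob gaussian n.

(** The shift formula of the standard Gaussian. It determines the measure and mentions only [dot],
    so it is preserved by orthogonal maps, whereas the product structure is tied to a basis. *)
Definition cameron_martin n (m : {measure set (borel_rV R n) -> \bar R}) :=
  forall (F : borel_rV R n -> \bar R) (y : 'rV[R]_n),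
  measurable_fun setT F -> (forall x, (0 <= F x)%E) ->
  (\int[m]_x F ((x : 'rV[R]_n) + y)%R =
   \int[m]_x (F x * (expR (dot x y - dot y y / 2))%:E))%E.

Lemma cameron_martin_gaussian n : cameron_martin (gaussian_rV n).
Proof.
move=> F y mF F0; set m := gaussian_rV n.
pose sh (x : borel_rV R n) : borel_rV R n := (x : 'rV[R]_n) + y.
have msh : measurable_fun setT sh by exact: measurable_addrV.
pose g (x : borel_rV R n) : R := expR (dot x y - dot y y / 2).
pose shm : {mfun borel_rV R n >-> borel_rV R n} :=
  HB.pack sh (isMeasurableFun.Build _ _ _ _ _ msh).
have mg : measurable_fun setT g.
  apply: measurableT_comp => //; apply: measurable_funB => //.
  exact: measurable_dot.
have g0 x : 0 <= g x by exact: expR_ge0.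
(* It suffices to compare two measures on boxes, where both factor over the coordinates into
   instances of [gaussian_shift]. *)
have E A : measurable A -> pushforward m shm A = density_measure m mg g0 A.
  apply: measure_eq_box => [|B mB].
    change (m (sh @^-1` setT) < +oo)%E.
    by rewrite preimage_setT probability_setT ltry.
  transitivity (m (product_box (fun i => (fun s => s + y ord0 i) @^-1` B i))).
    congr (m _); apply/seteqP; split=> x h i; have := h i; by rewrite /= ?mxE.
  rewrite product_prob_box; last first.
    move=> i; rewrite -[X in measurable X]setTI.
    exact: (measurable_funD (@measurable_id _ _ setT) (measurable_cst (y ord0 i))).
  transitivity (\int[m]_(x in product_box B) (g x)%:E)%E => //.
  rewrite integral_mkcond.
  transitivity (\int[m]_x (\prod_(i < n) (\1_(B i) (x ord0 i) *
      expR (x ord0 i * y ord0 i - y ord0 i ^+ 2 / 2)))%:E)%E; last first.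
    apply: eq_integral => x _; rewrite patchE big_split/=.
    case: ifPn => [/[!inE] xB|]; [congr EFin|].
      rewrite big1 ?mul1r => [|i _]; last by rewrite indicE mem_set.
      rewrite -expR_sum; congr expR; rewrite sumrB; congr (_ - _).
      by rewrite -mulr_suml; congr (_ / _); apply: eq_bigr => i _; rewrite expr2.
    rewrite notin_setE => /existsNP[i xBi]; rewrite (bigD1 i)//= indicE memNset//.
    by rewrite !mul0r.
  have mex i : measurable_fun setT (fun s : R =>
      expR (s * y ord0 i - y ord0 i ^+ 2 / 2)).
    apply: measurableT_comp => //; apply: measurable_funB => //.
    exact: measurable_funM.
  rewrite (integral_product_prob gaussian
    (h := fun i s => \1_(B i) s * expR (s * y ord0 i - y ord0 i ^+ 2 / 2))); last 2 first.
  - by move=> i; apply: measurable_funM.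
  - by move=> i s; rewrite mulr_ge0 ?expR_ge0.
  apply: eq_bigr => i _; rewrite (gaussian_shift (y ord0 i) (mB i)) [LHS]integral_mkcond.
  apply: eq_integral => s _; rewrite patchE indicE.
  by case: ifP => _; rewrite ?mul1r ?mul0r.
rewrite -(ge0_integral_density mg g0 (nu := density_measure m mg g0))//.
rewrite [RHS](eq_measure_integral (pushforward m shm)); last by move=> A mA _; rewrite -E.
by rewrite ge0_integral_pushforward.
Qed.
End dot_product.

Section rotation_invariance.
Context {R : realType}.

(* Compute the double integral of [f (x + z) e^(|x|^2 / 2)], where
   [f z = 1_E z e^(- |z|^2 / 2)], against [m1] and [m2] in both orders. *)
Lemma cameron_martin_unique n (m1 m2 : probability (borel_rV R n) R) :
  cameron_martin m1 -> cameron_martin m2 ->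
  forall E, measurable E -> m1 E = m2 E.
Proof.
move=> cm1 cm2 E mE.
pose e (x : 'rV[R]_n) : R := expR (dot x x / 2).
pose f (z : 'rV[R]_n) : R := \1_E z * expR (- (dot z z / 2)).
have f0 z : 0 <= f z by rewrite mulr_ge0// expR_ge0.
have e0 z : 0 <= e z by exact: expR_ge0.
have me : measurable_fun setT (e : borel_rV R n -> R).
  apply: measurableT_comp => //; apply: measurable_funM => //.
  exact: measurable_dot.
have mf : measurable_fun setT (f : borel_rV R n -> R).
  apply: measurable_funM; first exact: measurable_indic.
  apply: measurableT_comp => //; apply: measurableT_comp => //.
  by apply: measurable_funM => //; exact: measurable_dot.
have madd : measurable_fun setT
    (fun p : borel_rV R n * borel_rV R n => (p.1 : 'rV[R]_n) + p.2 : borel_rV R n).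
  exact: measurable_addrV.
have step1 z : (\int[m1]_x (f (x + z)%R * e x)%:E = m1 E)%E.
  pose F (x : borel_rV R n) := (f x * e ((x : 'rV[R]_n) - z))%:E.
  transitivity (\int[m1]_x F ((x : 'rV[R]_n) + z)%R)%E.
    by apply: eq_integral => x _; rewrite /F addrK.
  rewrite cm1.
  - rewrite -(setIT E) -integral_indic//; apply: eq_integral => x _.
    rewrite /F -EFinM -mulrA -expRD; congr EFin.
    rewrite /f -mulrA -expRD.
    rewrite [X in expR X](_ : _ = 0) ?expR0 ?mulr1//.
    by rewrite !dotDl !dotDr !dotNl !dotNr (dotC z x); field.
  - apply/measurable_EFinP; apply: measurable_funM => //.
    by apply: (measurableT_comp me); exact: measurable_addrV.
  - by move=> x; rewrite lee_fin mulr_ge0.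
transitivity (\int[m2]_z \int[m1]_x (f (x + z)%R * e x)%:E)%E.
  under eq_integral do rewrite step1.
  by rewrite integral_cst//= [m2 _]probability_setT mule1.
rewrite (@fubini_tonelli _ _ _ _ _ m2 m1
  (fun p : borel_rV R n * borel_rV R n => (f (p.2 + p.1) * e p.2)%:E)); last 2 first.
- apply/measurable_EFinP; apply: measurable_funM.
    by apply: (measurableT_comp mf); exact: measurable_addrV.
  exact: measurableT_comp me _.
- by move=> p; rewrite lee_fin mulr_ge0.
transitivity (\int[m1]_x \int[m2]_z (f z * expR (dot z x))%:E)%E.
  apply: eq_integral => x _ /=.
  transitivity (\int[m2]_z ((f (z + x)%R * e x)%:E))%E.
    by apply: eq_integral => z _; rewrite addrC.
  rewrite (cm2 (fun z => (f z * e x)%:E)).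
  - apply: eq_integral => z _; rewrite -EFinM -mulrA -expRD.
    by congr (_ * expR _)%:E; ring.
  - by apply/measurable_EFinP; exact: measurable_funM.
  - by move=> z; rewrite lee_fin mulr_ge0.
rewrite (@fubini_tonelli _ _ _ _ _ m1 m2
  (fun p : borel_rV R n * borel_rV R n => (f p.2 * expR (dot p.2 p.1))%:E)); last 2 first.
- apply/measurable_EFinP; apply: measurable_funM.
    exact: measurableT_comp mf _.
  by apply: measurableT_comp => //; exact: measurable_dot.
- by move=> p; rewrite lee_fin mulr_ge0// expR_ge0.
rewrite -(setIT E) -integral_indic//; apply: eq_integral => z _ /=.
(* For a constant function the shift formula of [m1] is its Laplace transform: [expR (dot x z)]
   integrates to [e z], which cancels the Gaussian factor of [f z]. *)
have fe0 : (borel_rV R n -> (0 <= (f z * e z)%:E)%E) by rewrite lee_fin mulr_ge0.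
have := cm1 (fun=> (f z * e z)%:E) z (measurable_cst _) fe0.
rewrite integral_cst//= [m1 _]probability_setT mule1 => H.
transitivity ((f z * e z)%:E); last by rewrite /f /e -mulrA -expRD addNr expR0 mulr1.
rewrite H; apply: eq_integral => x _.
rewrite -EFinM /e /f (dotC z x) -!mulrA -!expRD; congr (_ * expR _)%:E.
by ring.
Qed.

(** The image under an orthogonal map satisfies the same shift formula, since [dot] is invariant,
    and the formula determines the measure. *)
Lemma gaussian_rV_mulmx n (M : 'M[R]_n) (E : set (borel_rV R n)) :
  M *m M^T = 1%:M -> measurable E ->
  gaussian_rV n [set x : 'rV[R]_n | E (x *m M)] = gaussian_rV n E.
Proof.
move=> MMT mE; set m := gaussian_rV n.
pose rot (x : borel_rV R n) : borel_rV R n := (x : 'rV[R]_n) *m M.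
have mrot : measurable_fun setT rot by exact: measurable_mulmxr.
pose rotm : {mfun borel_rV R n >-> borel_rV R n} :=
  HB.pack rot (isMeasurableFun.Build _ _ _ _ _ mrot).
have -> : m [set x : 'rV[R]_n | E (x *m M)] = distribution m rotm E by [].
apply: (@cameron_martin_unique _ (distribution m rotm) m) => //; last first.
  exact: cameron_martin_gaussian.
have MTM : M^T *m M = 1%:M by exact: mulmx1C.
move=> F y mF F0.
rewrite !ge0_integral_distribution//; last 3 first.
- apply: emeasurable_funM => //; apply/measurable_EFinP.
  apply: measurableT_comp => //; apply: measurable_funB => //.
  exact: measurable_dot.
- by move=> x; rewrite mule_ge0// lee_fin expR_ge0.
- by apply: (measurableT_comp mF); exact: measurable_addrV.
transitivity (\int[m]_x F (((x + y *m M^T)%R : 'rV[R]_n) *m M))%E.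
  by apply: eq_integral => x _; rewrite /= mulmxDl -mulmxA MTM mulmx1.
rewrite (cameron_martin_gaussian (F := fun x => F ((x : 'rV[R]_n) *m M))).
- apply: eq_integral => x _; congr (_ * (expR _)%:E)%E; rewrite /= /rot.
  by rewrite !dot_mulmx trmxK -mulmxA MTM mulmx1.
- exact: (measurableT_comp mF).
- by [].
Qed.

Lemma continuous_dot_sub n (v : 'rV[R]_n) :
  continuous (fun u : 'rV[R]_n => dot (u - v) (u - v)).
Proof.
apply: (@continuous_big _ _ +%R _ predT _ _ _ (fun i (x : 'rV[R]_n) => (x - v) ord0 i * (x - v) ord0 i)) => [|i _ u]; first exact: add_continuous.
have hc : (fun x : 'rV[R]_n => x ord0 i) @ u --> u ord0 i by exact: coord_continuous.
have h : (fun x : 'rV[R]_n => x ord0 i - v ord0 i) @ u --> u ord0 i - v ord0 i.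
  by apply: (@cvgB R R^o) hc _; exact: cvg_cst.
have -> : (fun x : 'rV[R]_n => (x - v) ord0 i * (x - v) ord0 i) =
    (fun x : 'rV[R]_n => (x ord0 i - v ord0 i) * (x ord0 i - v ord0 i)).
  by apply/funext => x; rewrite !mxE.
exact: (cvgM h h).
Qed.

(** Euclidean balls, with [d] the squared radius: orthogonal maps send them to one another, unlike
    balls of the sup norm. *)
Definition dball n (v : 'rV[R]_n) (d : R) : set 'rV[R]_n :=
  [set u | dot (u - v) (u - v) < d].

Lemma dballC n (u v : 'rV[R]_n) d : dball u d v -> dball v d u.
Proof. by rewrite /dball /= -opprB dotNl dotNr opprK. Qed.

Lemma open_dball n (v : 'rV[R]_n) d : open (dball v d).
Proof.
have -> : dball v d = (fun u => dot (u - v) (u - v)) @^-1` [set x | x < d] by [].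
apply: open_comp; last exact: open_lt.
by move=> u _; exact: continuous_dot_sub.
Qed.

Lemma dball_center n (v : 'rV[R]_n) d : 0 < d -> dball v d v.
Proof. by move=> d0; rewrite /dball/= subrr /dot big1// => i _; rewrite mxE mul0r. Qed.

Lemma sphereP n (u : 'rV[R]_n) : sphere u <-> dot u u = 1.
Proof.
rewrite /sphere/= norm2E; split=> [h|->]; last exact: sqrtr1.
by rewrite -(sqr_sqrtr (dot_ge0 u)) h expr1n.
Qed.

(** The reflection in the hyperplane orthogonal to [u - v] exchanges the two unit vectors. *)
Lemma householder n (u v : 'rV[R]_n) : sphere u -> sphere v ->
  exists M : 'M[R]_n, M *m M^T = 1%:M /\ u *m M = v.
Proof.
move=> /sphereP u1 /sphereP v1; have [->|uv] := eqVneq u v.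
  by exists 1%:M; rewrite trmx1 !mulmx1.
have [c [Y [c0 YT YY uY]]] : exists (c : R) (Y : 'M[R]_n),
    [/\ c != 0, Y^T = Y, Y *m Y = c *: Y & u *m Y = (c / 2) *: (u - v)].
  pose h := u - v; exists (dot h h), (h^T *m h).
  have hh : h *m h^T = (dot h h)%:M.
    by apply/matrixP => i j; rewrite !ord1 -dotE mxE.
  have uh : u *m h^T = (dot h h / 2)%:M.
    apply/matrixP => i j; rewrite !ord1 -dotE mxE mulr1n /h.
    rewrite !dotDl !dotDr !dotNl !dotNr u1 v1 (dotC v u); by field.
  split.
  - by apply: contra_neq uv => /dot_eq0 /eqP; rewrite subr_eq0 => /eqP.
  - by rewrite trmx_mul trmxK.
  - by rewrite mulmxA -(mulmxA h^T h) hh mul_mx_scalar -scalemxAl.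
  - by rewrite mulmxA uh mul_scalar_mx.
exists (1%:M - (2 / c) *: Y); split.
  have -> : (1%:M - (2 / c) *: Y)^T = 1%:M - (2 / c) *: Y.
    by apply/matrixP => i j; rewrite !mxE -[in LHS]YT mxE eq_sym.
  rewrite mulmxBl mul1mx mulmxBr mulmx1.
  rewrite -scalemxAl -scalemxAr YY !scalerA.
  rewrite (_ : 2 / c * (2 / c) * c = 2 / c + 2 / c); last by field.
  by rewrite scalerDl opprB addrK subrK.
rewrite mulmxBr mulmx1 -scalemxAr uY scalerA.
rewrite (_ : 2 / c * (c / 2) = 1); last by field.
by rewrite scale1r subKr.
Qed.
End rotation_invariance.

(** * Uniform measures on the sphere *)

Section uniform_measure_unique.
Context {R : realType}.

Lemma measurable_dball n (v : 'rV[R]_n) d :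
  measurable (dball v d : set (borel_rV R n)).
Proof. by apply: open_measurable_rV; exact: open_dball. Qed.

Lemma measurable_sphere n : measurable (@sphere R n : set (borel_rV R n)).
Proof.
have -> : @sphere R n = setT `&` (fun u : borel_rV R n => dot u u) @^-1` [set 1].
  by apply/seteqP; split=> u; [move/sphereP => ?; split|case=> _ /= /sphereP].
by apply: measurable_dot.
Qed.

Lemma uniform_dball_eq n (P : probability (borel_rV R n) R) (u v : 'rV[R]_n) d :
  uniform_on_sphere P -> sphere u -> sphere v -> P (dball u d) = P (dball v d).
Proof.
move=> [_ Pinv] Su Sv; have [M [MMT uM]] := householder Su Sv.
rewrite -(Pinv M _ MMT (measurable_dball v d)); congr (P _).
apply/seteqP; split=> x; rewrite /dball/= -uM -mulmxBl dot_mulmx -mulmxA MMT mulmx1;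
  exact.
Qed.

(** If one ball centred on the sphere were null, all of the same radius would be, by invariance;
    countably many null rational balls would then cover the sphere, which has mass 1. *)
Lemma uniform_dball_gt0 n (P : probability (borel_rV R n) R) (v : 'rV[R]_n) d :
  uniform_on_sphere P -> sphere v -> 0 < d -> (0 < P (dball v d))%E.
Proof.
move=> PU Sv d0; rewrite lt0e measure_ge0 andbT; apply/eqP => Pv0.
have [P1 _] := PU.
pose B (p : 'rV[rat]_n * nat) : set (borel_rV R n) :=
  ball (map_mx ratr p.1 : 'rV[R]_n) p.2.+1%:R^-1.
have mB p : measurable (B p).
  by apply: open_measurable_rV; apply: ball_open; rewrite invr_gt0.
pose F (k : nat) : set (borel_rV R n) :=
  if unpickle k is Some p then (if P (B p) == 0%E then B p else set0) else set0.
have mF k : measurable (F k).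
  by rewrite /F; case: unpickle => // p; case: ifP.
have PF k : P (F k) = 0%E.
  by rewrite /F; case: unpickle => [p|]; [case: ifPn => [/eqP|] //|]; rewrite measure0.
have : P.-negligible (\bigcup_k F k).
  apply: negligible_bigcup => k; exists (F k).
    by split => //; exact: PF.
move=> /(negligibleP P (bigcup_measurable (fun k _ => mF k))) PU0.
suff SF : sphere `<=` \bigcup_k F k.
  have : (P sphere <= P (\bigcup_k F k))%E.
    apply: le_measure => //; rewrite inE; first exact: measurable_sphere.
    exact: bigcup_measurable.
  by rewrite P1 PU0 leNgt lte01.
move=> x Sx; have [c [k [xB BA]]] := rat_ball_rV (@open_dball _ _ x d) (dball_center x d0).
exists (pickle (c, k)) => //; rewrite /F pickleK.
suff -> : P (B (c, k)) == 0%E by [].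
rewrite eq_le measure_ge0 andbT -Pv0 -(uniform_dball_eq d PU Sx Sv).
by apply: le_measure => //; rewrite inE//; exact: measurable_dball.
Qed.

Definition fatten n (A : set 'rV[R]_n) d : set 'rV[R]_n := \bigcup_(u in A) dball u d.

Lemma measurable_fatten n (A : set 'rV[R]_n) d :
  measurable (fatten A d : set (borel_rV R n)).
Proof. by apply: open_measurable_rV; apply: bigcup_open => u _; exact: open_dball. Qed.

Lemma bigcap_fatten n (A : set 'rV[R]_n) : closed A ->
  \bigcap_k fatten A k.+1%:R^-1 = A.
Proof.
move=> cA; apply/seteqP; split=> [v h|v Av k _]; last first.
  by exists v => //; apply: dball_center; rewrite invr_gt0.
apply: cA => U /nbhs_ballP[e /= e0 eU].
have [k ke] : exists k : nat, k.+1%:R^-1 < e ^+ 2.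
  have := near_infty_natSinv_lt (PosNum (exprn_gt0 2 e0)).
  by case => k _ /(_ k (leqnn k)) /= ?; exists k.
have [u Au uv] := h k I; exists u; split => //; apply: eU.
split=> // i j; rewrite (ord1 i) /ball/=.
suff : `|v ord0 j - u ord0 j| ^+ 2 < e ^+ 2 by rewrite ltr_pXn2r// ?nnegrE// ltW.
apply: le_lt_trans (lt_trans uv ke).
rewrite real_normK ?num_real// /dot (bigD1 j)//= !mxE expr2 lerDl.
by apply: sumr_ge0 => l _; rewrite -expr2 sqr_ge0.
Qed.

Lemma uniform_setI_sphere n (P : probability (borel_rV R n) R)
    (A : set (borel_rV R n)) :
  uniform_on_sphere P -> measurable A -> P (A `&` sphere) = P A.
Proof.
move=> [P1 _] mA; have mS := @measurable_sphere n.
rewrite [RHS](measureDI P mA mS).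
rewrite [X in (X + _)%E](_ : _ = 0%E) ?add0e//.
apply/eqP; rewrite eq_le measure_ge0 andbT.
have <- : P (~` sphere) = 0%E by rewrite probability_setC// P1 subee.
apply: le_measure; rewrite ?inE.
- exact: measurableD.
- exact: measurableC.
- by move=> x [].
Qed.

(* Integrate over the pairs of nearby points in both orders: all balls centred on
   the sphere have the same mass. *)
Lemma uniform_measure_fatten n (P Q : probability (borel_rV R n) R) v d A :
  uniform_on_sphere P -> uniform_on_sphere Q -> sphere v ->
  measurable (A : set (borel_rV R n)) ->
  (Q (dball v d) * P A <= P (dball v d) * Q (fatten A d))%E.
Proof.
move=> PU QU Sv mA; have [P1 _] := PU; have [Q1 _] := QU.
have mS := @measurable_sphere n.
pose D : set (borel_rV R n * borel_rV R n) :=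
  [set p | dot ((p.2 : 'rV[R]_n) - p.1) ((p.2 : 'rV[R]_n) - p.1) < d].
have msub : measurable_fun setT
    (fun p : borel_rV R n * borel_rV R n => (p.2 : 'rV[R]_n) - p.1 : borel_rV R n).
  apply: measurable_rV => i; under eq_fun do rewrite !mxE.
  by apply: measurable_funB; exact: measurable_comp_coord.
have mD : measurable D.
  rewrite -[D]setTI.
  have -> : D = (fun p => dot ((p.2 : 'rV[R]_n) - p.1) ((p.2 : 'rV[R]_n) - p.1))
     @^-1` [set` `]-oo, d[] by apply/seteqP; split=> p; rewrite /D/= in_itv.
  by apply: measurable_dot.
have mBd u : measurable (dball u d : set (borel_rV R n)) by exact: measurable_dball.
pose f (p : borel_rV R n * borel_rV R n) : R :=
  \1_(A `&` sphere) p.1 * (\1_(sphere : set (borel_rV R n)) p.2 * \1_D p).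
have f0 p : 0 <= f p by rewrite !mulr_ge0.
have mf : measurable_fun setT f.
  have m1 (X : set (borel_rV R n)) : measurable X ->
      measurable_fun setT (\1_X : borel_rV R n -> R) by exact: measurable_indic.
  apply: measurable_funM.
    by apply: (measurableT_comp (m1 (A `&` sphere) _)) => //; exact: measurableI.
  apply: measurable_funM; last exact: measurable_indic.
  by apply: (measurableT_comp (m1 sphere _)).
have E1 : (\int[P]_u \int[Q]_w (f (u, w))%:E = Q (dball v d) * P A)%E.
  rewrite -(uniform_setI_sphere PU mA) -[RHS]integral_cst; last exact: measurableI.
  rewrite [RHS]integral_mkcond; apply: eq_integral => u _; rewrite patchE.
  case: ifPn => [/[!inE] -[Au Su]|uAS]; last first.
    rewrite -[RHS](@integral0 _ _ _ Q setT); apply: eq_integral => w _.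
    by rewrite /f/= indicE (negbTE uAS) mul0r.
  rewrite (uniform_dball_eq d QU Sv Su) -(uniform_setI_sphere QU (mBd u)).
  rewrite -(setIT (dball u d `&` sphere)) -integral_indic//; last exact: measurableI.
  apply: eq_integral => w _; rewrite /f/= [in LHS]indicE mem_set// mul1r.
  by rewrite setIC indicI; congr (_ * _)%:E; rewrite !indicE; congr (nat_of_bool _)%:R;
    apply/idP/idP; rewrite !inE.
rewrite -E1 (@fubini_tonelli _ _ _ _ _ P Q (fun p => (f p)%:E)); last 2 first.
- exact/measurable_EFinP.
- by move=> p; rewrite lee_fin.
rewrite -[leRHS]integral_cst; last exact: measurable_fatten.
rewrite [leRHS]integral_mkcond; apply: ge0_le_integral => //.
- by move=> w _; apply: integral_ge0 => u _; rewrite lee_fin.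
- apply: (@measurable_fun_fubini_tonelli_G _ _ _ _ _ P (fun p => (f p)%:E)).
    exact/measurable_EFinP.
  by move=> p; rewrite lee_fin.
- apply/(measurable_restrictT _ (measurable_fatten A d)); exact: measurable_cst.
move=> w _; have [wA|wA] := pselect (fatten A d w /\ sphere w); last first.
  rewrite (_ : (\int[P]_x (f (x, w))%:E = 0)%E).
    by rewrite patchE; case: ifP.
  rewrite -[RHS](@integral0 _ _ _ P setT); apply: eq_integral => u _.
  rewrite /f/= !indicE.
  have [[Au Su]|h] := pselect ((A `&` sphere) u); last by rewrite memNset// mul0r.
  have [Sw|h] := pselect (sphere w); last by rewrite [w \in _]memNset// mul0r mulr0.
  rewrite [(u, w) \in D]memNset ?mulr0// => Duw; apply: wA; split => //.
  by exists u.
case: wA => wA Sw; rewrite patchE mem_set// (uniform_dball_eq d PU Sv Sw).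
rewrite -(setIT (dball w d)) -integral_indic//.
apply: ge0_le_integral => //.
- by move=> u _; rewrite lee_fin.
- by apply/measurable_EFinP; apply: measurableT_comp mf _.
- by apply/measurable_EFinP; exact: measurable_indic.
move=> u _; rewrite lee_fin /f/= !indicE.
have [Duw|h] := pselect (D (u, w)); last by rewrite [(u, w) \in D]memNset// !mulr0.
rewrite [u \in dball w d]mem_set; last exact: dballC.
by rewrite [(u, w) \in D]mem_set// mulr1 mulr_ile1//; case: (_ \in _).
Qed.

(** Letting [d] tend to 0 in [uniform_measure_fatten] compares [P] and [Q] on closed sets, which are
    stable under intersection and generate the Borel sets. *)
Lemma uniform_measure_unique n (P Q : probability (borel_rV R n) R) :
  uniform_on_sphere P -> uniform_on_sphere Q ->
  forall A, measurable A -> P A = Q A.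
Proof.
move=> PU QU A mA.
(* The sphere is empty for [n = 0], but then it cannot have mass 1. *)
have [v Sv] : exists v : 'rV[R]_n, sphere v.
  apply: contrapT => /forallNP h; case: PU => + _.
  rewrite (_ : sphere = set0) ?measure0; last by apply/seteqP; split => x // /h.
  by move/esym/eqP; rewrite onee_eq0.
(* Take the whole space for [A] in [uniform_measure_fatten], in both directions. *)
have PQ d : 0 < d -> P (dball v d) = Q (dball v d).
  move=> d0; have := uniform_measure_fatten d PU QU Sv measurableT.
  have := uniform_measure_fatten d QU PU Sv measurableT.
  have fT : fatten [set: 'rV[R]_n] d = setT.
    by apply/seteqP; split => // x _; exists x => //; exact: dball_center.
  rewrite fT.
  have -> : P setT = 1%E by exact: probability_setT.
  have -> : Q setT = 1%E by exact: probability_setT.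
  rewrite !mule1 => h1 h2.
  by apply/eqP; rewrite eq_le h1 h2.
have le P' Q' (C : set 'rV[R]_n) : uniform_on_sphere P' -> uniform_on_sphere Q' ->
    (forall d, 0 < d -> P' (dball v d) = Q' (dball v d)) -> closed C ->
    (P' (C : set (borel_rV R n)) <= Q' C)%E.
  move=> PU' QU' PQ' cC; have mC := closed_measurable_rV cC.
  have H k : (P' C <= Q' (fatten C k.+1%:R^-1))%E.
    have k0 : 0 < k.+1%:R^-1 :> R by rewrite invr_gt0.
    have := uniform_measure_fatten k.+1%:R^-1 PU' QU' Sv mC.
    have pos : (0 < Q' (dball v k.+1%:R^-1))%E by exact: uniform_dball_gt0.
    have fin : Q' (dball v k.+1%:R^-1) \is a fin_num.
      by rewrite fin_num_measure//; exact: measurable_dball.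
    by rewrite PQ'// lee_pmul2l.
  rewrite -(bigcap_fatten cC).
  have : Q' (fatten C k.+1%:R^-1) @[k --> \oo] --> Q' (\bigcap_k fatten C k.+1%:R^-1).
    apply: nonincreasing_cvg_mu.
    - by rewrite (le_lt_trans (probability_le1 _ _)) ?ltry//; exact: measurable_fatten.
    - by move=> k; exact: measurable_fatten.
    - by apply: bigcap_measurable => // k _; exact: measurable_fatten.
    - move=> a b ab; apply/subsetPset => x [u Cu ux]; exists u => //.
      by apply: lt_le_trans ux _; rewrite lef_pV2 ?posrE// ler_nat.
  move=> cv; rewrite [X in (X <= _)%E](_ : _ = P' C); last by rewrite bigcap_fatten.
  rewrite -(cvg_lim _ cv)//; apply: lime_ge; first by apply/cvg_ex; eexists; exact: cv.
  by apply: nearW => k; exact: H.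
apply: (@g_sigma_algebra_measure_unique _ R (borel_rV R n) (@closed 'rV[R]_n) _ (fun=> setT)) => //.
- by move=> C cC; exact: closed_measurable_rV.
- by apply/seteqP; split => // x _; exists 0%N.
- by move=> B C; exact: closedI.
- move=> C cC; apply/eqP; rewrite eq_le !le// => d d0; exact/esym/PQ.
- by move=> _; apply: (le_lt_trans (probability_le1 P measurableT)); exact: ltry.
- have : (<<s open >> : set (set (borel_rV R n))) A by [].
  apply: smallest_sub; first exact: smallest_sigma_algebra.
  move=> B oB; rewrite -(setCK B); apply: (sigma_algebraC).
  by apply: sub_sigma_algebra; exact: open_closedC.
Qed.
End uniform_measure_unique.

Section density_probability.
Context d (T : measurableType d) (R : realType).
Variables (m : {measure set T -> \bar R}) (g : T -> R).
Hypotheses (mg : measurable_fun [set: T] g) (g0 : forall x, 0 <= g x).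
Hypothesis g1 : (\int[m]_x (g x)%:E = 1)%E.

Definition density_prob : probability T R :=
  HB.pack (density m mg g0)
    (@Measure_isProbability.Build _ _ _ (density m mg g0) g1).

Lemma density_probE A : density_prob A = (\int[m]_(x in A) (g x)%:E)%E.
Proof. by []. Qed.

Lemma ge0_integral_density_prob (f : T -> \bar R) :
  measurable_fun [set: T] f -> (forall x, (0 <= f x)%E) ->
  (\int[density_prob]_x f x = \int[m]_x (f x * (g x)%:E))%E.
Proof. by move=> mf f0; apply: ge0_integral_density. Qed.
End density_probability.

(** * Polar decomposition of the Gaussian measure *)

Section polar.
Context {R : realType} {n : nat}.
Implicit Types (x u : 'rV[R]_n) (I : set R).

Definition sphere_proj x : 'rV[R]_n := (Num.sqrt (dot x x))^-1 *: x.

Lemma sphere_proj_sphere x : 0 < dot x x -> sphere (sphere_proj x).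
Proof.
move=> x0; apply/sphereP; rewrite dotZl dotZr mulrA -expr2 exprVn sqr_sqrtr ?dot_ge0//.
by rewrite mulVf ?gt_eqF.
Qed.

Lemma sphere_proj_mulmx x (M : 'M[R]_n) : M *m M^T = 1%:M ->
  sphere_proj (x *m M) = sphere_proj x *m M.
Proof.
by move=> MMT; rewrite /sphere_proj dot_mulmx -mulmxA MMT mulmx1 -scalemxAl.
Qed.

Lemma measurable_sphere_proj :
  measurable_fun setT (fun x : borel_rV R n => sphere_proj x : borel_rV R n).
Proof.
apply: measurable_rV => i; under eq_fun do rewrite mxE.
apply: measurable_funM; last exact: measurable_coord.
rewrite (_ : (fun _ => _) = (fun a : R => a `^ (- 2^-1)) \o
    (fun x : borel_rV R n => dot x x)); last first.
  by apply/funext => x /=; rewrite powRN powR12_sqrt// dot_ge0.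
apply: measurableT_comp; last exact: measurable_dot.
exact: measurable_powR.
Qed.

(** Conditioned on a rotation invariant event, the Gaussian measure stays rotation invariant, so its
    projection to the sphere is uniform and hence is [P]. The set [I] is free because the two bounds
    use shells on opposite sides of radius [sqrt n]; its positivity keeps [x] away from 0, where the
    projection degenerates. *)
Lemma gaussian_polar (P : probability (borel_rV R n) R) I (g : borel_rV R n -> R) :
  uniform_on_sphere P -> measurable I -> (forall t, I t -> 0 < t) ->
  measurable_fun setT g -> (forall u, 0 <= g u) ->
  (0 < gaussian_rV n [set x : 'rV[R]_n | I (dot x x)])%E ->
  (\int[P]_u (g u)%:E * gaussian_rV n [set x : 'rV[R]_n | I (dot x x)] =
   \int[gaussian_rV n]_(x in [set x : 'rV[R]_n | I (dot x x)])
     (g (sphere_proj x))%:E)%E.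
Proof.
move=> PU mI I0 mg g0; set m := gaussian_rV n.
set A : set (borel_rV R n) := [set x | _].
have mA : measurable A.
  have mdd : measurable_fun setT (fun x : borel_rV R n => dot x x) by exact: measurable_dot.
  by rewrite -[A]setTI; exact: (mdd measurableT _ mI).
have [c mAc] : exists c, m A = c%:E.
  by exists (fine (m A)); rewrite fineK// fin_num_measure.
rewrite mAc lte_fin => c0.
have mh : measurable_fun setT (fun x : borel_rV R n => \1_A x * c^-1).
  by apply: measurable_funM => //; exact: measurable_indic.
have h0 (x : borel_rV R n) : 0 <= \1_A x * c^-1 by rewrite mulr_ge0// invr_ge0 ltW.
have intA B : measurable B -> (\int[m]_(x in B) (\1_A x * c^-1)%:E =
    m (A `&` B) * (c^-1)%:E)%E.
  move=> mB; under eq_integral do rewrite EFinM.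
  rewrite ge0_integralZr//.
  - by rewrite integral_indic.
  - by apply/measurable_EFinP; apply: measurable_funTS; exact: measurable_indic.
  - by rewrite lee_fin invr_ge0 ltW.
have h1 : (\int[m]_x (\1_A x * c^-1)%:E = 1)%E.
  by rewrite intA// setIT mAc -EFinM mulfV// gt_eqF.
pose nu := density_prob mh h0 h1.
pose prm : {mfun borel_rV R n >-> borel_rV R n} :=
  HB.pack (fun x : borel_rV R n => sphere_proj x : borel_rV R n)
    (isMeasurableFun.Build _ _ _ _ _ measurable_sphere_proj).
pose Q : probability (borel_rV R n) R := distribution nu prm.
have QE B : measurable B ->
    Q B = (m (A `&` [set x : 'rV[R]_n | B (sphere_proj x)]) * (c^-1)%:E)%E.
  move=> mB; rewrite -intA// -[X in measurable X]setTI.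
  exact: (measurable_sphere_proj measurableT mB).
have QU : uniform_on_sphere Q.
  split.
    rewrite QE; last exact: measurable_sphere.
    rewrite (_ : _ `&` _ = A) ?mAc -?EFinM ?mulfV ?gt_eqF//.
    apply/seteqP; split=> [x []//|x Ax]; split => //=.
    exact/sphere_proj_sphere/I0.
  move=> M B MMT mB.
  have mBM : measurable [set u : borel_rV R n | B ((u : 'rV[R]_n) *m M)].
    by rewrite -[X in measurable X]setTI; exact: (measurable_mulmxr M).
  rewrite !QE//; congr (_ * _)%E.
  rewrite -[RHS](gaussian_rV_mulmx MMT); last first.
    apply: measurableI => //; rewrite -[X in measurable X]setTI.
    exact: (measurable_sphere_proj measurableT mB).
  congr (m _); apply/seteqP; split=> x; rewrite /A/= sphere_proj_mulmx//;
    by rewrite dot_mulmx -mulmxA MMT mulmx1.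
have mgE : measurable_fun setT (fun u : borel_rV R n => (g u)%:E).
  exact/measurable_EFinP.
rewrite (eq_measure_integral Q); last by move=> B mB _; exact: uniform_measure_unique.
rewrite ge0_integral_distribution//.
have mgp : measurable_fun setT (fun x : borel_rV R n => (g (sphere_proj x))%:E).
  by apply: (measurableT_comp mgE); exact: measurable_sphere_proj.
rewrite ge0_integral_density_prob; [|exact: mgp|by move=> x; rewrite lee_fin].
rewrite -ge0_integralZr//; last first.
- by rewrite lee_fin ltW.
- by move=> x _; rewrite mule_ge0// lee_fin.
- by apply: emeasurable_funM; [exact: mgp|exact/measurable_EFinP].
rewrite [RHS]integral_mkcond; apply: eq_integral => x _; rewrite patchE indicE.
case: ifPn => xA; last by rewrite mul0r mule0 mul0e.
by rewrite mul1r -!EFinM mulfVK// gt_eqF.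
Qed.
End polar.

(** * The log-Laplace transform *)

Section real_taylor.
Context {R : realType}.
Implicit Types x y z t : R.

(** The mean value theorem between 0 and [z], in a form that can be iterated: three uses of it give
    the Taylor bound on [expR]. *)
Lemma le_norm_of_derive (f f' : R -> R) (b : R -> R) :
  f 0 = 0 -> (forall y, is_derive y 1 f (f' y)) ->
  (forall y z, `|y| <= `|z| -> `|f' y| <= b z) ->
  forall z, `|f z| <= `|z| * b z.
Proof.
move=> f0 df fb z.
have cf a b' : {within `[a, b'], continuous f}.
  apply: derivable_within_continuous => x _; exact: ex_derive.
have [z0|z0] := leP 0 z.
  have [c /[!in_itv]/= /andP[c0 cz]] := MVT_segment z0 (fun x _ => df x) (cf 0 z).
  rewrite f0 !subr0 => ->; rewrite normrM mulrC ler_wpM2l//.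
  by apply: fb; rewrite !ger0_norm.
have [c /[!in_itv]/= /andP[c0 cz]] := MVT_segment (ltW z0) (fun x _ => df x) (cf z 0).
rewrite f0 !sub0r mulrN => /oppr_inj ->; rewrite normrM mulrC ler_wpM2l//.
by apply: fb; rewrite !ler0_norm ?lerN2//; exact: ltW.
Qed.

Lemma norm_expR_sub_taylor2 y :
  `|expR y - 1 - y - y ^+ 2 / 2| <= `|y| ^+ 3 * expR `|y|.
Proof.
have h0 z : `|expR z - 1| <= `|z| * expR `|z|.
  apply: (@le_norm_of_derive (fun z => expR z - 1) expR (fun z => expR `|z|)).
  - by rewrite expR0 subrr.
  - move=> x; have := is_deriveB (is_derive_expR x) (is_derive_cst (1 : R^o) x 1).
    by rewrite subr0.
  - move=> x {}z xz; rewrite ger0_norm ?expR_ge0// ler_expR.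
    by apply: le_trans xz; exact: ler_norm.
have mono (a b : R) (k : nat) : `|a| <= `|b| -> `|a| ^+ k * expR `|a| <= `|b| ^+ k * expR `|b|.
  by move=> ab; rewrite ler_pM ?exprn_ge0 ?expR_ge0 ?ler_expR// lerXn2r ?nnegrE.
have h1 z : `|expR z - 1 - z| <= `|z| * (`|z| * expR `|z|).
  apply: (@le_norm_of_derive (fun z => expR z - 1 - z) (fun z => expR z - 1)
    (fun z => `|z| * expR `|z|)).
  - by rewrite expR0 subrr subr0.
  - move=> x; have := is_deriveB (is_deriveB (is_derive_expR x)
      (is_derive_cst (1 : R^o) x 1)) (is_derive_id x 1).
    by rewrite subr0.
  - by move=> a b ab; apply: le_trans (h0 _) _; have := mono _ _ 1%N ab; rewrite !expr1.
have -> : `|y| ^+ 3 * expR `|y| = `|y| * (`|y| * (`|y| * expR `|y|)) by ring.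
apply: (@le_norm_of_derive (fun z => expR z - 1 - z - z ^+ 2 / 2)
    (fun z => expR z - 1 - z) (fun z => `|z| * (`|z| * expR `|z|))).
- by rewrite expR0 expr0n/= mul0r !subr0 subrr.
- move=> x; have h := is_deriveM (is_derive_id x 1) (is_derive_id x 1).
  have {}h := is_deriveM h (is_derive_cst (2^-1 : R) x 1).
  have := is_deriveB (is_deriveB (is_deriveB (is_derive_expR x)
      (is_derive_cst (1 : R^o) x 1)) (is_derive_id x 1)) h.
  rewrite subr0 scaler0 add0r -scalerDr => {}h.
  apply: is_derive_eq h _.
  by rewrite /GRing.scale/=; field.
- move=> a b ab; apply: le_trans (h1 _) _; have := mono _ _ 2%N ab.
  by rewrite !expr2 !mulrA.
Qed.

(** Since [ln (1 + z) = - ln (1 - z / (1 + z))], the usual upper bound on [ln] gives [z / (1 + z)],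
    which is at least [z - z ^+ 2]. *)
Lemma le_ln1D z : 0 <= z -> z - z ^+ 2 <= ln (1 + z).
Proof.
move=> z0.
have z1 : 0 < 1 + z by rewrite ltr_wpDr.
have h : ln (1 + (- (z / (1 + z)))) <= - (z / (1 + z)).
  by apply: le_ln1Dx; rewrite ltrN2 ltr_pdivrMr// mul1r ltrDr.
have e : 1 + - (z / (1 + z)) = (1 + z)^-1 by field; rewrite gt_eqF.
rewrite e lnV ?posrE// lerN2 in h.
apply: le_trans h.
rewrite ler_pdivlMr//; nra.
Qed.

Lemma cube_le_expR x : 0 <= x -> x ^+ 3 <= 6 * expR x.
Proof.
move=> x0; have := expR_ge1Dxn 2 x0.
have -> : (3`!)%:R = 6 :> R by [].
by move=> h; rewrite -ler_pdivrMl// mulrC; apply: le_trans h; rewrite lerDr.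
Qed.
End real_taylor.

(* Locked, so that unification never unfolds the integrals. *)
HB.lock Definition mgf {R : realType} (mu : probability (measurableTypeR R) R)
  (t : R) : R := (\int[mu]_x expR (t * x))%R.

HB.lock Definition Lam {R : realType} (mu : probability (measurableTypeR R) R)
  (t : R) : R := ln (mgf mu t).

Section log_laplace.
Context {R : realType}.
Variable mu : probability (measurableTypeR R) R.
Hypothesis mu_sub_gaussian : sub_gaussian mu.
Local Notation mgf := (mgf mu).
Local Notation Lam := (Lam mu).

Lemma mgf_def t : mgf t = (\int[mu]_x expR (t * x))%R.
Proof. by rewrite mgf.unlock. Qed.

Lemma Lam_def t : Lam t = ln (mgf t).
Proof. by rewrite Lam.unlock. Qed.

Lemma mmt_gen_funE t : ('M_mu id t = \int[mu]_x (expR (t * x))%:E)%E.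
Proof.
rewrite /mmt_gen_fun unlock; apply: eq_integral => x _ /=.
by rewrite mulrC.
Qed.

Lemma measurable_expM (t : R) : measurable_fun setT (fun x : measurableTypeR R => expR (t * x)).
Proof. by apply: measurableT_comp => //; exact: measurable_funM. Qed.

Lemma integrable_expM (t : R) :
  mu.-integrable setT (fun x => (expR (t * x))%:E).
Proof.
apply/integrableP; split; first by apply/measurable_EFinP; exact: measurable_expM.
under eq_integral do rewrite /= ger0_norm ?expR_ge0//.
rewrite -mmt_gen_funE; have [C /(_ t)] := mu_sub_gaussian; rewrite /log_laplace.
by case: ('M_mu id t)%E => // r; rewrite ltry.
Qed.

Lemma mgfE t : ('M_mu id t = (mgf t)%:E)%E.
Proof.
rewrite mmt_gen_funE mgf_def /Rintegral fineK//.
by apply: integrable_fin_num => //; exact: integrable_expM.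
Qed.

Lemma integrable_of_expR (f : R -> R) (a c : R) : measurable_fun setT f ->
  (forall x, `|f x| <= c * (expR (a * x) + expR (- a * x))) ->
  mu.-integrable setT (EFin \o f).
Proof.
move=> mf fb; apply: (@le_integrable _ _ _ mu setT measurableT _
   (fun x => (c * (expR (a * x) + expR (- a * x)))%:E)).
- exact/measurable_EFinP.
- by move=> x _; rewrite /= lee_fin (le_trans (fb x))// ler_norm.
- under eq_fun do rewrite EFinM EFinD.
  apply: integrableZl => //; apply: integrableD => //; exact: integrable_expM.
Qed.

Lemma expR_norm_le (x : R) : expR `|x| <= expR (1 * x) + expR (- 1 * x).
Proof.
rewrite mul1r mulN1r; have [x0|x0] := ger0P x.
  by rewrite lerDl expR_ge0.
by rewrite lerDr expR_ge0.
Qed.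

Lemma integrable_mu_id : mu.-integrable setT (EFin \o (fun x : R => x)).
Proof.
apply: (@integrable_of_expR _ 1 1); first exact: measurable_id.
move=> x; rewrite mul1r; apply: le_trans (expR_norm_le x).
by apply: le_trans (expR_ge1Dx _); rewrite lerDr.
Qed.

Lemma integrable_mu_sqr : mu.-integrable setT (EFin \o (fun x : R => x ^+ 2)).
Proof.
apply: (@integrable_of_expR _ 1 2).
  exact: (measurable_funX 2 (@measurable_id _ _ setT)).
move=> x; apply: le_trans (ler_wpM2l _ (expR_norm_le x)) => //.
have := expR_ge1Dxn 1 (normr_ge0 x); rewrite normrX (_ : 2`!%:R = 2 :> R)// => h.
lra.
Qed.

Hypotheses (mu_mean : ('E_mu[id] = 0)%E) (mu_var : ('V_mu[id] = 1)%E).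

Lemma Rintegral_mu_id : (\int[mu]_x x = 0)%R.
Proof.
move: mu_mean; rewrite unlock /Rintegral => ->.
by [].
Qed.

Lemma Rintegral_mu_sqr : (\int[mu]_x x ^+ 2 = 1)%R.
Proof.
have <- : fine 'V_mu[id] = 1 by rewrite mu_var.
rewrite /variance unlock mu_mean /= unlock /Rintegral.
by congr fine; apply: eq_integral => x _; rewrite -[RHS]/(((x - 0) * (x - 0))%:E) subr0 expr2.
Qed.

(** Integrate [1 + t * x <= expR (t * x)]; the mean is zero. *)
Lemma mgf_ge1 t : 1 <= mgf t.
Proof.
have itx : mu.-integrable setT (EFin \o (fun x : R => t * x)).
  by have := integrableZl measurableT t integrable_mu_id.
have it1 : mu.-integrable setT (EFin \o (fun x : R => 1 : R)).
  exact: finite_measure_integrable_cst.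
have <- : (\int[mu]_x (1 + t * x) = 1)%R.
  rewrite RintegralD// RintegralZl//; last exact: integrable_mu_id.
  rewrite Rintegral_mu_id mulr0 addr0 Rintegral_cst//= mul1r.
  by rewrite probability_setT.
rewrite mgf_def; apply: le_Rintegral => //.
- by have := integrableD measurableT it1 itx.
- exact: integrable_expM.
- by move=> x _; exact: expR_ge1Dx.
Qed.

Lemma mgf_gt0 t : 0 < mgf t.
Proof. exact: lt_le_trans (mgf_ge1 t). Qed.

Lemma log_laplaceE t : log_laplace mu t = (Lam t)%:E.
Proof. by rewrite /log_laplace mgfE lne_EFin ?mgf_gt0// Lam_def. Qed.

Lemma Lam_ge0 t : 0 <= Lam t.
Proof. by rewrite Lam_def; exact/ln_ge0/mgf_ge1. Qed.

Lemma Lam0 : Lam 0 = 0.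
Proof.
rewrite Lam_def mgf_def; under eq_Rintegral do rewrite mul0r expR0.
by rewrite Rintegral_cst//= mul1r probability_setT ln1.
Qed.

Lemma Lam_le : exists C : R, 0 <= C /\ forall t, Lam t <= C * t ^+ 2.
Proof.
have [C h] := mu_sub_gaussian; exists `|C|; split => // t.
have := h t; rewrite log_laplaceE lee_fin => /le_trans; apply.
by rewrite ler_wpM2r ?sqr_ge0// ler_norm.
Qed.

(* Integrating [expR] at convex combinations of the exponents [t x - Lam t],
   whose exponentials have integral 1, yields convexity. *)
Lemma Lam_convex (a s t : R) : 0 <= a <= 1 ->
  Lam (a * s + (1 - a) * t) <= a * Lam s + (1 - a) * Lam t.
Proof.
move=> /andP[a0 a1].
pose u := a * s + (1 - a) * t.
pose c := a * Lam s + (1 - a) * Lam t.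
have key : mgf u <= expR c.
  have E (z : R) : expR (- Lam z) * mgf z = 1.
    by rewrite Lam_def expRN lnK ?posrE ?mgf_gt0// mulVf// gt_eqF// mgf_gt0.
  pose g (x : R) := expR c * (a * expR (- Lam s) * expR (s * x) +
     (1 - a) * expR (- Lam t) * expR (t * x)).
  have ig1 : mu.-integrable setT (EFin \o (fun x => a * expR (- Lam s) * expR (s * x))).
    by have := integrableZl measurableT (a * expR (- Lam s)) (integrable_expM s).
  have ig2 : mu.-integrable setT (EFin \o (fun x => (1 - a) * expR (- Lam t) * expR (t * x))).
    by have := integrableZl measurableT ((1 - a) * expR (- Lam t)) (integrable_expM t).
  have ig12 : mu.-integrable setT (EFin \o (fun x => a * expR (- Lam s) * expR (s * x) +
     (1 - a) * expR (- Lam t) * expR (t * x))).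
    by have := integrableD measurableT ig1 ig2.
  have ig : mu.-integrable setT (EFin \o g).
    by have := integrableZl measurableT (expR c) ig12.
  have -> : expR c = (\int[mu]_x g x)%R.
    rewrite RintegralZl// RintegralD// !RintegralZl//; try exact: integrable_expM.
    transitivity (expR c * (a * (expR (- Lam s) * mgf s) +
        (1 - a) * (expR (- Lam t) * mgf t))); last by rewrite !mulrA !mgf_def.
    suff H (p q : R) : p = 1 -> q = 1 -> expR c = expR c * (a * p + (1 - a) * q).
      exact: H.
    by move=> -> ->; rewrite !mulr1 [a + _]addrC subrK mulr1.
  rewrite mgf_def; apply: le_Rintegral => //; first exact: integrable_expM.
  move=> x _; rewrite /g.
  pose y1 := s * x - Lam s; pose y2 := t * x - Lam t.
  have -> : u * x = c + (a * y1 + (1 - a) * y2) by rewrite /u /c /y1 /y2; ring.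
  rewrite expRD ler_wpM2l ?expR_ge0//.
  have -> : a * expR (- Lam s) * expR (s * x) + (1 - a) * expR (- Lam t) * expR (t * x) =
     a * expR y1 + (1 - a) * expR y2.
    by rewrite /y1 /y2 !expRD; ring.
  exact: (convex_expR (Itv01 a0 a1) y1 y2).
have := key; rewrite -ler_ln ?posrE ?mgf_gt0 ?expR_gt0// expRK -Lam_def.
exact.
Qed.

(** Convexity and the quadratic bound suffice, without derivatives. Prolong the segment from [s]
    through [t] by [h = |s| + |t|] to a point [z]: the slope on [[s, t]] is at most the one towards
    [z], and [0 <= Lam z <= 4 C h^2] because [|z| <= 2 h]. *)
Lemma Lam_lipschitz : exists C : R, 0 <= C /\
  forall s t, `|Lam s - Lam t| <= C * (`|s| + `|t|) * `|s - t|.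
Proof.
have [C [C0 hC]] := Lam_le; exists (4 * C); split; first by rewrite mulr_ge0.
have half s t : Lam t - Lam s <= 4 * C * (`|s| + `|t|) * `|s - t|.
  pose h : R := `|s| + `|t|; pose d : R := `|s - t|.
  have [->|st] := eqVneq s t; first by rewrite !subrr normr0 mulr0.
  have d0 : 0 < d by rewrite normr_gt0 subr_eq0.
  have dh : d <= h by exact: ler_normB.
  have h0 : 0 < h by exact: lt_le_trans dh.
  pose e := (t - s) / d.
  pose z := t + e * h.
  have e1 : `|e| = 1 by rewrite normrM normfV distrC normr_id mulfV// gt_eqF.
  have zb : `|z| <= 2 * h.
    rewrite (le_trans (ler_normD _ _))// normrM e1 mul1r (ger0_norm (ltW h0)) /h.
    by have := normr_ge0 s; lra.
  pose a : R := h / (h + d).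
  have hd : 0 < h + d by rewrite addr_gt0.
  have a01 : 0 <= a <= 1.
    rewrite /a; apply/andP; split; first by apply: divr_ge0; exact: ltW.
    by rewrite ler_pdivrMr// mul1r lerDl; exact: ltW.
  have tE : t = a * s + (1 - a) * z.
    by rewrite /z /e /a; field; rewrite !gt_eqF.
  have Lz : Lam z <= 4 * C * h ^+ 2.
    apply: le_trans (hC _) _; rewrite -[z ^+ 2]real_normK ?num_real//.
    rewrite [4 * C]mulrC -mulrA ler_wpM2l// (_ : 4 * h ^+ 2 = (2 * h) ^+ 2); last by ring.
    by rewrite lerXn2r ?nnegrE// mulr_ge0// ltW.
  have := Lam_convex s z a01; rewrite -tE => cv.
  have Ls := Lam_ge0 s.
  have a1E : 1 - a = d / (h + d) by rewrite /a; field; rewrite gt_eqF.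
  have : Lam t - Lam s <= (1 - a) * (4 * C * h ^+ 2).
    have := ler_wpM2l (_ : 0 <= 1 - a) Lz.
    case/andP: a01 => a0 a1; rewrite subr_ge0 a1 => /(_ isT) h2.
    have h3 : 0 <= (1 - a) * Lam s by rewrite mulr_ge0// subr_ge0.
    by clear -h2 h3 cv; lra.
  move/le_trans; apply; rewrite a1E -/h -/d.
  have -> : d / (h + d) * (4 * C * h ^+ 2) = 4 * C * h * d * (h / (h + d)) by ring.
  apply: ler_piMr; first by rewrite !mulr_ge0//; exact: ltW.
  by rewrite ler_pdivrMr// mul1r lerDl; exact: ltW.
move=> s t; rewrite ler_norml; apply/andP; split; last first.
  by rewrite (addrC `|s|) distrC; exact: half.
by rewrite lerNl opprB; exact: half.
Qed.

(** Mean 0 and variance 1 make [1 + t ^+ 2 / 2] the integral of the Taylor polynomial. For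
    [|t| <= 1] the remainder is at most [|t|^3 |x|^3 e^|x|], hence at most [6 |t|^3 e^(2|x|)], which
    is integrable. *)
Lemma mgf_taylor : exists K : R, 0 <= K /\
  forall t, `|t| <= 1 -> `|mgf t - 1 - t ^+ 2 / 2| <= K * `|t| ^+ 3.
Proof.
pose K := 6 * (mgf 2 + mgf (- 2)).
exists K; split; first by rewrite mulr_ge0// addr_ge0// ltW// mgf_gt0.
move=> t t1.
pose g (x : R) := expR (t * x) - 1 - t * x - (t * x) ^+ 2 / 2.
have it1 : mu.-integrable setT (EFin \o (fun x : R => 1 : R)).
  exact: finite_measure_integrable_cst.
have itx : mu.-integrable setT (EFin \o (fun x : R => t * x)).
  by have := integrableZl measurableT t integrable_mu_id.
have itx2 : mu.-integrable setT (EFin \o (fun x : R => (t * x) ^+ 2 / 2)).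
  have := integrableZl measurableT (t ^+ 2 / 2) integrable_mu_sqr.
  by apply: eq_integrable => // x _ /=; congr EFin; rewrite exprMn; ring.
have ig1 : mu.-integrable setT (EFin \o (fun x : R => expR (t * x) - 1)).
  by have := integrableB measurableT (integrable_expM t) it1.
have ig2 : mu.-integrable setT (EFin \o (fun x : R => expR (t * x) - 1 - t * x)).
  by have := integrableB measurableT ig1 itx.
have ig : mu.-integrable setT (EFin \o g).
  by have := integrableB measurableT ig2 itx2.
have -> : mgf t - 1 - t ^+ 2 / 2 = (\int[mu]_x g x)%R.
  rewrite mgf_def.
  rewrite RintegralB// RintegralB// RintegralB//; last exact: integrable_expM.
  rewrite RintegralZl ?Rintegral_mu_id ?mulr0 ?subr0; last 2 first.
  - by [].
  - exact: integrable_mu_id.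
  congr (_ - _ - _); first by rewrite Rintegral_cst//= mul1r probability_setT.
  transitivity (\int[mu]_x (t ^+ 2 / 2 * x ^+ 2))%R.
    by rewrite RintegralZl ?Rintegral_mu_sqr ?mulr1//; exact: integrable_mu_sqr.
  by apply: eq_Rintegral => x _; rewrite exprMn; ring.
pose b (x : R) : R := `|t| ^+ 3 * (6 * (expR (2 * x) + expR (- 2 * x))).
have ib0 : mu.-integrable setT (EFin \o (fun x : R => expR (2 * x) + expR (- 2 * x))).
  by have := integrableD measurableT (integrable_expM 2) (integrable_expM (- 2)).
have ib1 : mu.-integrable setT (EFin \o (fun x : R => 6 * (expR (2 * x) + expR (- 2 * x)))).
  by have := integrableZl measurableT 6 ib0.
have ib : mu.-integrable setT (EFin \o b).
  by have := integrableZl measurableT (`|t| ^+ 3) ib1.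
apply: le_trans (le_normr_Rintegral measurableT ig) _.
have -> : K * `|t| ^+ 3 = (\int[mu]_x b x)%R.
  rewrite !RintegralZl// RintegralD//; try exact: integrable_expM.
  by rewrite mulrC -!mgf_def.
apply: le_Rintegral => //; first by have := integrable_norm ig.
move=> x _; apply: le_trans (norm_expR_sub_taylor2 _) _.
rewrite normrM exprMn -mulrA ler_wpM2l ?exprn_ge0//.
have tx : `|t| * `|x| <= `|x| by rewrite ler_piMl.
have h3 := cube_le_expR (normr_ge0 x).
have e1 : expR (`|t| * `|x|) <= expR `|x| by rewrite ler_expR.
apply: (@le_trans _ _ (6 * expR `|x| * expR `|x|)).
  by rewrite ler_pM ?exprn_ge0 ?expR_ge0.
rewrite -mulrA -expRD ler_wpM2l//.
have := expR_norm_le (2 * x); rewrite normrM ger0_norm// mul1r mulN1r -mulNr.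
by rewrite (_ : 2 * `|x| = `|x| + `|x|)//; ring.
Qed.

(** For [|t| <= 1], take logarithms in [mgf_taylor] using [z - z^2 <= ln (1 + z) <= z]. For
    [|t| > 1], both [Lam t] and [t ^+ 2 / 2] are of order [t^2 <= |t|^3]. *)
Lemma Lam_taylor : exists C : R, 0 <= C /\
  forall t, `|Lam t - t ^+ 2 / 2| <= C * `|t| ^+ 3.
Proof.
have [K [K0 hK]] := mgf_taylor; have [C [C0 hC]] := Lam_le.
exists (K + (1 / 2 + K) ^+ 2 + C + 1); split; first by rewrite !addr_ge0 ?sqr_ge0.
move=> t; have sq : t ^+ 2 = `|t| ^+ 2 by rewrite real_normK ?num_real.
have p0 := normr_ge0 t.
have [t1|t1] := leP `|t| 1.
  have := hK t t1; rewrite sq.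
  pose z := mgf t - 1.
  have z0 : 0 <= z by rewrite subr_ge0 mgf_ge1.
  have Lz : Lam t = ln (1 + z) by rewrite Lam_def /z addrC subrK.
  rewrite -/z => zb.
  have l1 : Lam t <= z by rewrite Lz; apply: le_ln1Dx; lra.
  have l2 : z - z ^+ 2 <= Lam t by rewrite Lz; exact: le_ln1D.
  move: zb; rewrite ler_norml => /andP[zb1 zb2].
  move: p0 t1 zb1 zb2; move: (`|t| : R) => p p0 p1 zb1 zb2.
  have p3 : p ^+ 3 <= p ^+ 2 by rewrite exprS ler_piMl ?sqr_ge0.
  have p4 : (p ^+ 2) ^+ 2 <= p ^+ 3 by rewrite -exprM [p ^+ (2 * 2)]exprS ler_piMl ?exprn_ge0.
  have zz : z <= (1 / 2 + K) * p ^+ 2 by nra.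
  have z2 : z ^+ 2 <= (1 / 2 + K) ^+ 2 * p ^+ 3.
    apply: (@le_trans _ _ (((1 / 2 + K) * p ^+ 2) ^+ 2)).
      by rewrite lerXn2r ?nnegrE// mulr_ge0 ?sqr_ge0// addr_ge0.
    by rewrite exprMn ler_wpM2l ?sqr_ge0.
  have p30 : 0 <= p ^+ 3 by rewrite exprn_ge0.
  rewrite ler_norml; apply/andP; split; nra.
have L0 := Lam_ge0 t; have L1 := hC t.
rewrite sq in L1 *; move: p0 t1 L1; move: (`|t| : R) => p p0 p1 L1.
have p3 : p ^+ 2 <= p ^+ 3 by rewrite [p ^+ 3]exprS ler_peMl ?sqr_ge0// ltW.
have p20 : 0 <= p ^+ 2 by exact: sqr_ge0.
have k0 : 0 <= (1 / 2 + K) ^+ 2 by exact: sqr_ge0.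
rewrite ler_norml; apply/andP; split; nra.
Qed.

Lemma continuous_Lam : continuous Lam.
Proof.
have [C [C0 hC]] := Lam_lipschitz.
move=> t; apply/cvgrPdist_le => /= e e0.
pose K : R := C * (2 * `|t| + 1) + 1.
have K0 : 0 < K by rewrite ltr_pwDr// mulr_ge0// addr_ge0// mulr_ge0.
near=> s.
have d1 : `|t - s| <= 1.
  by near: s; apply: (@cvgr_dist_le _ _ _ _ _ id t) => //; exact: cvg_id.
have d2 : `|t - s| <= e / K.
  near: s; apply: (@cvgr_dist_le _ _ _ _ _ id t); last exact: divr_gt0.
  exact: cvg_id.
apply: le_trans (hC _ _) _.
have sb : `|s| <= `|t| + 1.
  rewrite (_ : s = t - (t - s)); last by rewrite subKr.
  by apply: le_trans (ler_normB _ _) _; rewrite lerD2l.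
apply: (@le_trans _ _ (K * (e / K))); last by rewrite mulrCA mulfV ?mulr1// gt_eqF.
apply: ler_pM => //; first by rewrite mulr_ge0// addr_ge0.
rewrite /K; apply: (@le_trans _ _ (C * (2 * `|t| + 1))); last by rewrite lerDl.
by rewrite ler_wpM2l//; lra.
Unshelve. all: by end_near. Qed.

Lemma measurable_Lam : measurable_fun setT Lam.
Proof. by apply: continuous_measurable_fun; exact: continuous_Lam. Qed.
End log_laplace.

(** * Relative entropy and tilted Gaussian measures *)

Section relative_entropy_density.
Context {R : realType}.
Implicit Types (g phi : measurableTypeR R -> R) (B : set (measurableTypeR R))
  (nu m : probability (measurableTypeR R) R).

Lemma measurable_lne_EFin g : measurable_fun setT g ->
  measurable_fun setT (fun s => lne (g s)%:E).
Proof.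
move=> mg.
rewrite (_ : (fun _ => _) = fun s => if 0 < g s then (ln (g s))%:E else -oo%E).
  apply: measurable_fun_ifT => //.
  - by apply: measurable_fun_ltr => //; exact: measurable_cst.
  - by apply/measurable_EFinP; apply: measurableT_comp mg; exact: measurable_ln.
apply/funext => s; case: ifPn => gs; first by rewrite lne_EFin.
by rewrite le0_lneNy// lee_fin leNgt.
Qed.

Lemma dominates_density nu m g : measurable_fun setT g -> (forall s, 0 <= g s) ->
  (forall A, measurable A -> nu A = (\int[m]_(s in A) (g s)%:E)%E) -> nu `<< m.
Proof.
move=> mg g0 nuE; apply/null_content_dominatesP => A mA mA0.
rewrite nuE// null_set_integral//.
exact/measurable_EFinP/measurable_funTS.
Qed.

(** Any version of the density computes the entropy, so the abstract Radon-Nikodym derivative can be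
    replaced by an explicit one. *)
Lemma relative_entropy_density nu m g :
  measurable_fun setT g -> (forall s, 0 <= g s) ->
  (forall A, measurable A -> nu A = (\int[m]_(s in A) (g s)%:E)%E) ->
  relative_entropy nu m = (\int[nu]_s lne (g s)%:E)%E.
Proof.
move=> mg g0 nuE; have num := dominates_density mg g0 nuE.
rewrite /relative_entropy; case: pselect => [num'|/(_ num)//].
set D := Radon_Nikodym _ _.
have Dfin s : D s = (fine (D s))%:E by rewrite fineK// Radon_Nikodym_fin_num.
have iD : m.-integrable setT D by exact: Radon_Nikodym_integrable.
have mD : measurable_fun setT (fine \o D).
  apply/measurable_EFinP; rewrite (_ : EFin \o _ = D); first exact: measurable_int iD.
  by apply/funext => s /=; rewrite -Dfin.
have gD : ae_eq m setT D (EFin \o g).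
  apply: integral_ae_eq => //; first exact/measurable_EFinP.
  by move=> A _ mA; rewrite -nuE// -Radon_Nikodym_integral.
apply: ae_eq_integral => //.
- rewrite (_ : (fun _ => _) = (fun s => lne ((fine \o D) s)%:E)).
    exact: measurable_lne_EFin.
  by apply/funext => s; rewrite Dfin.
- exact: measurable_lne_EFin.
(* The densities agree outside an [m]-null set; domination makes it [nu]-null, and the entropy is an
   integral against [nu]. *)
have [N [mN N0 sN]] := gD.
exists N; split => //; first exact: ((null_content_dominatesP nu m).1 num N mN N0).
by move=> s /= h; apply: sN => /= gs; apply: h => _; rewrite (gs I).
Qed.

Lemma density_of_dominates nu m : nu `<< m ->
  exists g, [/\ measurable_fun setT g, (forall s, 0 <= g s) &
    forall A, measurable A -> nu A = (\int[m]_(s in A) (g s)%:E)%E].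
Proof.
move=> num; pose f := Radon_Nikodym_SigmaFinite.f nu m.
have ffin s : f s \is a fin_num by exact: Radon_Nikodym_SigmaFinite.f_fin_num.
exists (fine \o f); split.
- apply/measurable_EFinP; rewrite (_ : EFin \o _ = f).
    exact: measurable_int (Radon_Nikodym_SigmaFinite.f_integrable num).
  by apply/funext => s /=; rewrite fineK.
- by move=> s; rewrite /= fine_ge0// Radon_Nikodym_SigmaFinite.f_ge0.
- move=> A mA; rewrite (Radon_Nikodym_SigmaFinite.f_integral num mA).
  by apply: eq_integral => s _; rewrite /= fineK.
Qed.

(* With [g] the density of [nu], integrate the inequality
   [ln g >= phi + 1 - exp phi / g]. *)
Lemma gibbs_inequality nu m g B phi :
  measurable_fun setT g -> (forall s, 0 <= g s) ->
  (forall A, measurable A -> nu A = (\int[m]_(s in A) (g s)%:E)%E) ->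
  measurable B -> nu B = 1%E -> nu.-integrable setT (EFin \o phi) ->
  (\int[m]_(s in B) (expR (phi s))%:E <= 1)%E ->
  (\int[nu]_s (phi s)%:E <= \int[nu]_s lne (g s)%:E)%E.
Proof.
move=> mg g0 nuE mB nuB iphi phi1.
have mphi : measurable_fun setT phi by apply/measurable_EFinP; exact: measurable_int iphi.
(* As the inverse of 0 is 0, [k] vanishes with [g], and [k * g] is at most [expR phi] on [B]. *)
pose k (s : measurableTypeR R) : R := \1_B s * (expR (phi s) * (g s)^-1).
have mk : measurable_fun setT k.
  apply: measurable_funM; first exact: measurable_indic.
  apply: measurable_funM; first exact: measurableT_comp.
  rewrite (_ : (fun _ => _) = (fun a : R => a `^ (- 1)) \o g).
    by apply: measurableT_comp mg; exact: measurable_powR.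
  by apply/funext => s /=; rewrite powR_inv1.
have k0 s : 0 <= k s by rewrite !mulr_ge0 ?expR_ge0// invr_ge0.
have k1 : (\int[nu]_s (k s)%:E <= 1)%E.
  rewrite (ge0_integral_density mg g0 nuE); last 2 first.
  - exact/measurable_EFinP.
  - by move=> s; rewrite lee_fin.
  apply: le_trans phi1; rewrite [leRHS]integral_mkcond.
  apply: ge0_le_integral => //.
  - by move=> s _; rewrite mule_ge0 ?lee_fin.
  - by apply: emeasurable_funM; exact/measurable_EFinP.
  - apply/(measurable_restrictT _ mB)/measurable_EFinP/measurable_funTS.
    exact: measurableT_comp.
  move=> s _; rewrite patchE /k indicE; case: ifPn => _; last by rewrite mul0r mul0e.
  rewrite mul1r -EFinM lee_fin -mulrA.
  have [->|gs] := eqVneq (g s) 0; first by rewrite mulr0 mulr0 expR_ge0.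
  by rewrite mulVf// mulr1.
have ik : nu.-integrable setT (EFin \o k).
  apply/integrableP; split; first exact/measurable_EFinP.
  under eq_integral do rewrite /= ger0_norm//.
  by apply: le_lt_trans k1 _; rewrite ltry.
pose psi (s : measurableTypeR R) : R := phi s + 1 - k s.
have i1 : nu.-integrable setT (EFin \o (fun=> 1 : R)).
  exact: finite_measure_integrable_cst.
have ip1 : nu.-integrable setT (EFin \o (fun s => phi s + 1)).
  by have := integrableD measurableT iphi i1.
have ipsi : nu.-integrable setT (EFin \o psi).
  by have := integrableB measurableT ip1 ik.
have phi_psi : (\int[nu]_s (phi s)%:E <= \int[nu]_s (psi s)%:E)%E.
  have -> : (\int[nu]_s (psi s)%:E =
      \int[nu]_s (phi s)%:E + 1 - \int[nu]_s (k s)%:E)%E.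
    under eq_integral do rewrite /psi EFinB EFinD.
    rewrite integralB// integralD// integral_cst//=.
    by rewrite [nu _]probability_setT mule1.
  have /fineK <- := integrable_fin_num measurableT iphi.
  move: k1; have /fineK <- := integrable_fin_num measurableT ik.
  move: (fine _) (fine _) => a b.
  have -> : (a%:E + 1 - b%:E = (a + 1 - b)%:E)%E by [].
  by rewrite !lee_fin; lra.
apply: le_trans phi_psi _.
have mlne := measurable_lne_EFin mg.
pose A := B `&` [set s | 0 < g s].
have mA : measurable A.
  apply: measurableI => //; rewrite -[X in measurable X]setTI.
  have := mg measurableT `]0, +oo[%classic (measurable_itv _).
  congr (measurable _); apply/seteqP; split=> s [_ /= h]; split => //=;
    by move: h; rewrite in_itv/= andbT.
have nuA : nu (~` A) = 0%E.
  have nuA1 : nu A = 1%E.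
    rewrite -nuB !nuE// [LHS]integral_mkcond [RHS]integral_mkcond.
    apply: eq_integral => s _; rewrite !patchE.
    have [sB|sB] := boolP (s \in B); last first.
      by rewrite memNset// => -[] /mem_set; rewrite (negbTE sB).
    have [g1|g1] := boolP (0 < g s).
      by rewrite mem_set//; split => //; exact/set_mem.
    rewrite memNset; last by case=> _ /=; rewrite (negbTE g1).
    by apply/esym/eqP; rewrite eqe eq_le g0 leNgt g1.
  by rewrite probability_setC// nuA1 subee.
have le_ae : {ae nu, forall s, ((psi s)%:E <= lne (g s)%:E)%E}.
  exists (~` A); split => //; first exact: measurableC.
  move=> s; apply: contra_not => -[Bs gs].
  change ((psi s)%:E <= lne (g s)%:E)%E.
  rewrite lne_EFin// lee_fin /psi /k indicE mem_set// mul1r.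
  have : ln (expR (phi s) / g s) <= expR (phi s) / g s - 1.
    have := @le_ln1Dx _ (expR (phi s) / g s - 1).
    rewrite [1 + _]addrC subrK; apply.
    have : 0 < expR (phi s) / g s by rewrite divr_gt0// expR_gt0.
    lra.
  rewrite ln_div ?posrE ?expR_gt0// expRK; lra.
(* [lne (g s)] may fail to be integrable, so positive and negative parts are compared separately. *)
rewrite [leLHS]integralE [leRHS]integralE; apply: leeB.
- apply: ae_ge0_le_integral => //.
  + by apply: measurable_funepos; exact: measurable_int ipsi.
  + exact: measurable_funepos.
  + apply: filterS le_ae => s h _.
    by rewrite !funeposE; apply: le_max2.
- apply: ae_ge0_le_integral => //.
  + exact: measurable_funeneg.
  + by apply: measurable_funeneg; exact: measurable_int ipsi.
  + apply: filterS le_ae => s h _.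
    by rewrite !funenegE; apply: le_max2; rewrite // leeN2.
Qed.

End relative_entropy_density.

Section tilted_gaussian.
Context {R : realType}.
Implicit Types (K al lam rho b : R) (L f : R -> R).

Lemma normal_pdf_lb (s M : R) : `|s| <= M -> expR (- (M ^+ 2 / 2)) / 3 <= normal_pdf 0 1 s.
Proof.
move=> sM; rewrite normal_pdfE// mulrC ler_pM ?expR_ge0//.
  rewrite /normal_peak lef_pV2 ?posrE//; last first.
    by rewrite sqrtr_gt0 mulrn_wgt0// mulr_gt0 ?pi_gt0.
  rewrite -[leRHS]ger0_norm// -sqrtr_sqr ler_sqrt// expr1n mul1r -mulr_natr.
  by have [/andP[_ h] _] := pihalf_02_cos_pihalf R; lra.
rewrite /normal_fun ler_expR subr0 expr1n mulNr lerN2 -mulr_natr mul1r.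
rewrite ler_pM2r// -[s ^+ 2]real_normK ?num_real// lerXn2r ?nnegrE//.
exact: le_trans sM.
Qed.

Lemma gaussian_itv_lb (a b M : R) : a <= b ->
  (forall s, a <= s <= b -> `|s| <= M) ->
  (((b - a) * (expR (- (M ^+ 2 / 2)) / 3))%:E <= gaussian `[a, b]%classic)%E.
Proof.
move=> ab sM; rewrite /gaussian /normal_prob.
have lab : lebesgue_measure (`[a, b]%classic : set (measurableTypeR R)) = (b - a)%:E.
  rewrite lebesgue_measure_itv/= lte_fin; case: ltP => // ba.
  by have -> : a = b; [apply/eqP; rewrite eq_le ab ba|rewrite subrr].
rewrite mulrC EFinM -lab -integral_cst//=.
apply: ge0_le_integral => //.
- by apply/measurable_EFinP; apply: measurable_funTS; exact: measurable_normal_pdf.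
- move=> s; rewrite /= in_itv/= => sab; rewrite lee_fin.
  by apply: normal_pdf_lb; exact: sM.
Qed.

Lemma Rintegral_indic_gaussian (A B : set (measurableTypeR R)) :
  measurable A -> measurable B ->
  (\int[gaussian]_(s in B) \1_A s)%R = fine (gaussian (A `&` B)).
Proof. by move=> mA mB; rewrite /Rintegral integral_indic. Qed.

Lemma integrable_itv K f M : measurable_fun setT f ->
  (forall s, `|s| <= K -> `|f s| <= M) ->
  gaussian.-integrable `[- K, K] (EFin \o f).
Proof.
move=> mf fM; apply: measurable_bounded_integrable => //.
- by rewrite (le_lt_trans (probability_le1 _ _)) ?ltry.
- exact: measurable_funTS.
- exists M; split; first exact: num_real.
  move=> x Mx s /=; rewrite in_itv/= => sK; apply: le_trans (ltW Mx).
  by apply: fM; rewrite ler_norml.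
Qed.

Lemma measurable_sqr : measurable_fun setT (fun s : R => s ^+ 2).
Proof. exact: (measurable_funX 2 (@measurable_id _ _ setT)). Qed.

Lemma measurable_tilt L lam : measurable_fun setT L ->
  measurable_fun setT (fun s => expR (L s - lam * s ^+ 2)).
Proof.
move=> mL; apply: measurableT_comp => //; apply: measurable_funB => //.
by apply: measurable_funM => //; exact: measurable_sqr.
Qed.

Lemma measurable_tilt_sub L lam al : measurable_fun setT L ->
  measurable_fun setT (fun s : R => (s ^+ 2 - al) * expR (L s - lam * s ^+ 2)).
Proof.
move=> mL; apply: measurable_funM; last exact: measurable_tilt.
by apply: measurable_funB => //; exact: measurable_sqr.
Qed.

Section growth.
Variables (C0 : R) (L : R -> R).
Hypotheses (C00 : 0 <= C0) (mL : measurable_fun setT L).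
Hypothesis LC : forall s, 0 <= L s <= C0 * s ^+ 2.

Lemma tilt_sub_bound K M al lam s : `|lam| <= M -> `|s| <= K -> 0 <= al <= 2 ->
  `|(s ^+ 2 - al) * expR (L s - lam * s ^+ 2)| <=
  (K ^+ 2 + 2) * expR ((C0 + M) * K ^+ 2).
Proof.
move=> lamM sK /andP[al0 al2].
have M0 : 0 <= M by exact: le_trans lamM.
have s2 : s ^+ 2 <= K ^+ 2.
  rewrite -[s ^+ 2]real_normK ?num_real// lerXn2r ?nnegrE//.
  exact: le_trans sK.
rewrite normrM ler_pM//.
  apply: le_trans (ler_normB _ _) _.
  by rewrite lerD// ger0_norm// ?sqr_ge0.
rewrite ger0_norm ?expR_ge0// ler_expR.
have /andP[_ Ls] := LC s.
apply: (@le_trans _ _ ((C0 + M) * s ^+ 2)).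
  rewrite mulrDl lerD// -mulNr ler_wpM2r ?sqr_ge0//.
  by apply: le_trans lamM; rewrite -normrN ler_norm.
by rewrite ler_wpM2l// addr_ge0.
Qed.

Lemma integrable_tilt_sub K al lam : 0 <= al <= 2 ->
  gaussian.-integrable `[- K, K]
    (EFin \o (fun s => (s ^+ 2 - al) * expR (L s - lam * s ^+ 2))).
Proof.
move=> al02; apply: (integrable_itv (M := (K ^+ 2 + 2) * expR ((C0 + `|lam|) * K ^+ 2))).
  exact: measurable_tilt_sub.
by move=> s sK; exact: tilt_sub_bound.
Qed.

(** A zero in [lam] of this integral is a tilt of second moment [al]. Dominated convergence gives
    continuity; the next two lemmas give the signs at the ends of an interval independent of [K]. *)
Lemma continuous_tilt_sub K al : 0 <= al <= 2 ->
  continuous (fun lam : R =>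
    (\int[gaussian]_(s in `[- K, K]) ((s ^+ 2 - al) * expR (L s - lam * s ^+ 2)))%R).
Proof.
move=> al02 lam.
pose M : R := `|lam| + 1.
have int : {in `]- (`|lam| + 1), `|lam| + 1[%classic, continuous (fun lam : R =>
    (\int[gaussian]_(s in `[- K, K]) ((s ^+ 2 - al) * expR (L s - lam * s ^+ 2)))%R)}.
  apply: (@continuity_under_integral R _ _ gaussian
    (fun lam (s : measurableTypeR R) => (s ^+ 2 - al) * expR (L s - lam * s ^+ 2))
    `[- K, K]%classic _ _ _ _ _
    (fun=> (K ^+ 2 + 2) * expR ((C0 + M) * K ^+ 2))) => //.
  - by move=> x _; exact: integrable_tilt_sub.
  - apply: aeW => s _ x _.
    apply: (@cvgM R R^o); first exact: cvg_cst.
    apply: (continuous_comp (f := fun l : R => L s - l * s ^+ 2)); last exact: continuous_expR.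
    apply: (@cvgB R R^o); first exact: cvg_cst.
    by apply: (@cvgM R R^o); [exact: cvg_id|exact: cvg_cst].
  - exact: (integrable_itv (M := `|(K ^+ 2 + 2) * expR ((C0 + M) * K ^+ 2)|)).
  - move=> x; rewrite /= in_itv/= -ltr_norml => xM.
    apply: aeW => s; rewrite /= in_itv/= -ler_norml => sK.
    by apply: tilt_sub_bound => //; exact: ltW.
apply: int; rewrite inE/= in_itv/= -ltr_norml.
by rewrite ltrDl.
Qed.

(** The weight grows so fast that [[2, 3]], where [s ^+ 2 - al >= 2], outweighs the region
    [s ^+ 2 < al]. With [a = C0 + 4] the exponents [4 a] and [2 C0 + 2 a] differ by 8, which exceeds
    the [9 / 2 + ln 3] lost in the mass of [[2, 3]]. *)
Lemma tilt_sub_ge0 K al : 0 <= al <= 2 -> 3 <= K ->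
  0 <= (\int[gaussian]_(s in `[- K, K])
    ((s ^+ 2 - al) * expR (L s - - (C0 + 4) * s ^+ 2)))%R.
Proof.
move=> al02 K3; pose a : R := C0 + 4.
have /andP[al0 al2] := al02.
have a0 : 0 <= a by rewrite addr_ge0.
pose low (s : R) : R := 2 * expR (4 * a) * \1_`[2, 3] s - 2 * expR (2 * C0 + 2 * a).
have mlow : measurable_fun setT low.
  by apply: measurable_funB => //; apply: measurable_funM => //; exact: measurable_indic.
have ilow : gaussian.-integrable `[- K, K] (EFin \o low).
  apply: (integrable_itv (M := 2 * expR (4 * a) + 2 * expR (2 * C0 + 2 * a))) => // s _.
  apply: le_trans (ler_normB _ _) _; rewrite !ger0_norm ?mulr_ge0 ?expR_ge0//.
  by rewrite lerD2r ler_piMr ?mulr_ge0 ?expR_ge0// indicE; case: (_ \in _).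
apply: (@le_trans _ _ (\int[gaussian]_(s in `[- K, K]) low s)%R); last first.
  apply: le_Rintegral => //; first exact: integrable_tilt_sub.
  move=> s; rewrite /= in_itv/= -ler_norml => sK; rewrite /low indicE.
  have /andP[Ls0 Ls] := LC s.
  rewrite mulNr opprK -/a.
  have [/set_mem/=|/negP h] := boolP (s \in `[2, 3]%classic).
    rewrite in_itv/= => /andP[s2 s3]; rewrite mulr1.
    have ss : 4 <= s ^+ 2 by nra.
    apply: (@le_trans _ _ (2 * expR (4 * a))); first by rewrite lerBlDr lerDl mulr_ge0 ?expR_ge0.
    apply: ler_pM; rewrite ?expR_ge0//; first by lra.
    by rewrite ler_expR; nra.
  rewrite mulr0 sub0r.
  have [sal|sal] := leP al (s ^+ 2).
    apply: (@le_trans _ _ 0); first by rewrite oppr_le0 mulr_ge0 ?expR_ge0.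
    by rewrite mulr_ge0 ?expR_ge0// subr_ge0.
  rewrite -lerN2 opprK -mulNr opprB.
  apply: ler_pM; rewrite ?expR_ge0 ?subr_ge0//; first exact: ltW.
  - by have := sqr_ge0 s; lra.
  - rewrite ler_expR (_ : 2 * C0 + 2 * a = (C0 + a) * 2); last by ring.
    apply: (@le_trans _ _ ((C0 + a) * s ^+ 2)); first by rewrite [leRHS]mulrDl lerD.
    by rewrite ler_wpM2l ?addr_ge0//; lra.
have mBK : measurable (`[- K, K]%classic : set (measurableTypeR R)) by exact: measurable_itv.
have m23 : measurable (`[2, 3]%classic : set (measurableTypeR R)) by exact: measurable_itv.
have i23 : gaussian.-integrable `[- K, K]
    (EFin \o (fun s : measurableTypeR R => \1_`[2, 3] s : R)).
  apply: (integrable_itv (M := 1)); first exact: measurable_indic.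
  by move=> s _; rewrite indicE ger0_norm//; case: (_ \in _).
have i23' : gaussian.-integrable `[- K, K]
    (EFin \o (fun s : measurableTypeR R => 2 * expR (4 * a) * \1_`[2, 3] s)).
  by have := integrableZl mBK (2 * expR (4 * a)) i23.
rewrite RintegralB//; last first.
  by apply: (integrable_itv (M := `|2 * expR (2 * C0 + 2 * a)|)).
rewrite RintegralZl// Rintegral_indic_gaussian// Rintegral_cst//.
rewrite setIidl; last first.
  move=> s; rewrite /= !in_itv/= => /andP[s1 s2].
  by clear -K3 s1 s2; apply/andP; split; lra.
have g1 : fine (gaussian `[- K, K]%classic) <= 1 :> R.
  by rewrite -lee_fin fineK ?fin_num_measure// probability_le1.
have g2 : expR (- (9 / 2)) / 3 <= fine (gaussian `[2, 3]%classic) :> R.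
  rewrite -lee_fin fineK ?fin_num_measure//.
  have := @gaussian_itv_lb 2 3 3 _ _.
  rewrite (_ : (3 - 2) * (expR (- (3 ^+ 2 / 2)) / 3) = expR (- (9 / 2)) / 3).
    by apply; [lra|move=> s /andP[h1 h2]; rewrite ger0_norm; lra].
  have e1 : 3 - 2 = 1 :> R by lra.
  have e9 : 3 ^+ 2 = 9 :> R by ring.
  by rewrite e1 mul1r e9.
rewrite subr_ge0.
apply: (@le_trans _ _ (2 * expR (2 * C0 + 2 * a))).
  by rewrite ler_piMr// mulr_ge0// expR_ge0.
apply: (@le_trans _ _ (2 * expR (4 * a) * (expR (- (9 / 2)) / 3))); last first.
  by rewrite ler_wpM2l// mulr_ge0// expR_ge0.
rewrite -mulrA ler_wpM2l// mulrA -expRD ler_pdivlMr//.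
have -> : 4 * a + - (9 / 2) = (2 * C0 + 2 * a) + 7 / 2 by rewrite /a; lra.
rewrite [leRHS]expRD ler_wpM2l ?expR_ge0//.
by apply: le_trans (expR_ge1Dx _); lra.
Qed.

(** For large [b] the weight concentrates near 0. Where [|s| <= sqrt rho / 2] the integrand is at
    most [- rho / 2 * expR (- b * rho / 4)]; it is positive only where [s ^+ 2 > al >= rho], and
    there [s ^+ 2 <= expR (s ^+ 2)] bounds it by [expR (- (b - C0 - 1) * rho)]. The long hypothesis
    compares the two contributions. *)
Lemma tilt_sub_le0 (rho b K al : R) : 0 < rho <= 1 -> C0 + 1 <= b ->
  expR (- ((b - C0 - 1) * rho)) <=
    rho / 2 * (expR (- (b * (rho / 4))) * (Num.sqrt rho * (expR (- (1 / 2)) / 3))) ->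
  rho <= al <= 2 -> 3 <= K ->
  (\int[gaussian]_(s in `[- K, K])
    ((s ^+ 2 - al) * expR (L s - b * s ^+ 2)))%R <= 0.
Proof.
move=> /andP[rho0 rho1] bC hb /andP[al1 al2] K3.
pose h : R := Num.sqrt rho / 2.
have sr0 : 0 <= Num.sqrt rho by exact: sqrtr_ge0.
have sr1 : Num.sqrt rho <= 1 by rewrite -sqrtr1 ler_sqrt.
have h0 : 0 <= h by rewrite divr_ge0.
have h1 : h <= 1 by rewrite /h; lra.
have C0p := C00.
have b0 : 0 <= b by lra.
pose E : R := expR (- ((b - C0 - 1) * rho)).
pose F : R := rho / 2 * expR (- (b * (rho / 4))).
have F0 : 0 <= F by rewrite mulr_ge0 ?expR_ge0// divr_ge0// ltW.
pose up (s : R) : R := E - F * \1_`[- h, h] s.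
have mBK : measurable (`[- K, K]%classic : set (measurableTypeR R)) by exact: measurable_itv.
have mh : measurable (`[- h, h]%classic : set (measurableTypeR R)) by exact: measurable_itv.
have ih : gaussian.-integrable `[- K, K]
    (EFin \o (fun s : measurableTypeR R => \1_`[- h, h] s : R)).
  apply: (integrable_itv (M := 1)); first exact: measurable_indic.
  by move=> s _; rewrite indicE ger0_norm//; case: (_ \in _).
have ih' : gaussian.-integrable `[- K, K]
    (EFin \o (fun s : measurableTypeR R => F * \1_`[- h, h] s)).
  by have := integrableZl mBK F ih.
have iE : gaussian.-integrable `[- K, K] (EFin \o (fun s : measurableTypeR R => E)).
  by apply: (integrable_itv (M := `|E|)).
have iup : gaussian.-integrable `[- K, K] (EFin \o up).
  by have := integrableB mBK iE ih'.
apply: (@le_trans _ _ (\int[gaussian]_(s in `[- K, K]) up s)%R).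
  apply: le_Rintegral => //.
    by apply: integrable_tilt_sub; rewrite al2 andbT; lra.
  move=> s; rewrite /= in_itv/= -ler_norml => sK; rewrite /up indicE.
  have /andP[Ls0 Ls] := LC s.
  have E0 : 0 <= E by exact: expR_ge0.
  have [/set_mem/=|/negP hs] := boolP (s \in `[- h, h]%classic).
    rewrite in_itv/= -ler_norml => sh; rewrite mulr1.
    have s2 : s ^+ 2 <= rho / 4.
      rewrite -[s ^+ 2]real_normK ?num_real//.
      apply: (@le_trans _ _ (h ^+ 2)); first by rewrite lerXn2r ?nnegrE.
      by rewrite /h exprMn sqr_sqrtr ?(ltW rho0)// exprVn; lra.
    apply: (@le_trans _ _ (- F)); last by rewrite lerBrDr addNr.
    rewrite -lerN2 opprK -mulNr opprB /F; apply: ler_pM; rewrite ?expR_ge0//.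
    + by rewrite divr_ge0// ltW.
    + by lra.
    + rewrite ler_expR; apply: (@le_trans _ _ (- (b * s ^+ 2))).
        by rewrite lerN2 ler_wpM2l.
      by rewrite lerDr.
  rewrite mulr0 subr0.
  have [sal|sal] := leP (s ^+ 2) al.
    by apply: (@le_trans _ _ 0) => //; rewrite mulr_le0_ge0 ?expR_ge0// subr_le0.
  apply: (@le_trans _ _ (expR (s ^+ 2) * expR (L s - b * s ^+ 2))).
    rewrite ler_wpM2r ?expR_ge0//; apply: le_trans (expR_ge1Dx _); lra.
  rewrite -expRD ler_expR.
  apply: (@le_trans _ _ (- ((b - C0 - 1) * s ^+ 2))); first by lra.
  by rewrite lerN2 ler_wpM2l//; lra.
rewrite RintegralB// RintegralZl// Rintegral_indic_gaussian// Rintegral_cst//.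
rewrite setIidl; last first.
  move=> s; rewrite /= !in_itv/= => /andP[s1 s2].
  by clear -K3 s1 s2 h1; apply/andP; split; lra.
have g1 : fine (gaussian `[- K, K]%classic) <= 1 :> R.
  by rewrite -lee_fin fineK ?fin_num_measure// probability_le1.
have g2 : Num.sqrt rho * (expR (- (1 / 2)) / 3) <= fine (gaussian `[- h, h]%classic) :> R.
  rewrite -lee_fin fineK ?fin_num_measure//.
  have := @gaussian_itv_lb (- h) h 1 _ _.
  rewrite (_ : h - - h = Num.sqrt rho); last by rewrite /h; lra.
  rewrite expr1n; apply; first by lra.
  by move=> s; rewrite -ler_norml => sh; lra.
rewrite subr_le0.
apply: (@le_trans _ _ E); first by rewrite ler_piMr// expR_ge0.
apply: le_trans hb _; rewrite mulrA -/F.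
by rewrite ler_wpM2l.
Qed.
End growth.

(** In [b], the left side decays at rate [rho] and the right one only at rate [rho / 4]; [x] is
    where the exponents balance. *)
Lemma exists_tilt_bound (C0 rho : R) : 0 <= C0 -> 0 < rho -> exists b : R, C0 + 1 <= b /\
  expR (- ((b - C0 - 1) * rho)) <=
    rho / 2 * (expR (- (b * (rho / 4))) * (Num.sqrt rho * (expR (- (1 / 2)) / 3))).
Proof.
move=> C00 rho0.
pose c : R := rho / 2 * (Num.sqrt rho * (expR (- (1 / 2)) / 3)).
have c0 : 0 < c.
  by rewrite !mulr_gt0 ?divr_gt0 ?expR_gt0 ?sqrtr_gt0// invr_gt0.
pose x : R := ((C0 + 1) * rho - ln c) / (3 / 4 * rho).
exists (C0 + 1 + `|x|); split; first by rewrite lerDl.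
rewrite [leRHS](_ : _ = expR (- ((C0 + 1 + `|x|) * (rho / 4))) * c); last by rewrite /c; ring.
rewrite -[c in leRHS]lnK ?posrE// -expRD ler_expR.
have hx : (C0 + 1) * rho - ln c = 3 / 4 * rho * x.
  by rewrite /x mulrCA mulfV ?mulr1// gt_eqF// mulr_gt0.
have h0 : 0 <= (C0 + 1) * rho by rewrite mulr_ge0 ?(ltW rho0)// addr_ge0.
have xl : rho * x <= rho * `|x| by rewrite ler_wpM2l ?ler_norm// ltW.
lra.
Qed.

Lemma integral_indicM K f :
  (\int[gaussian]_s (\1_`[- K, K] s * f s)%:E =
   \int[gaussian]_(s in `[(- K)%R, K]) (f s)%:E)%E.
Proof.
rewrite [RHS]integral_mkcond; apply: eq_integral => s _; rewrite patchE indicE.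
by case: ifP => _; rewrite ?mul1r ?mul0r.
Qed.

(** The intermediate value theorem yields [lam], and [Psi] is the logarithm of the normalizing
    constant. The point is that [A] is chosen before [L], [al] and [K]. *)
Lemma exists_tilt (C0 rho : R) : 0 <= C0 -> 0 < rho <= 1 ->
  exists A : R, 0 <= A /\
  forall L al K, measurable_fun setT L -> (forall s, 0 <= L s <= C0 * s ^+ 2) ->
  rho <= al <= 2 -> 3 <= K ->
  exists lam Psi : R, [/\ `|lam| <= A, `|Psi| <= A,
    (\int[gaussian]_s (\1_`[- K, K] s * expR (L s - lam * s ^+ 2 - Psi))%:E = 1)%E &
    (\int[gaussian]_s (s ^+ 2 * (\1_`[- K, K] s * expR (L s - lam * s ^+ 2 - Psi)))%:E
       = al%:E)%E].
Proof.
move=> C00 rho01; have [rho0 rho1] := andP rho01.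
have [b [bC hb]] := exists_tilt_bound C00 rho0.
pose a : R := C0 + 4 + b.
exists (2 * (C0 + a) + 2); split; first by rewrite /a; lra.
move=> L al K mL LC /andP[al1 al2] K3.
have al02 : 0 <= al <= 2 by rewrite al2 andbT; lra.
have mBK : measurable (`[- K, K]%classic : set (measurableTypeR R)) by exact: measurable_itv.
have K0 : 0 <= K by lra.
pose D (lam : R) : R := (\int[gaussian]_(s in `[- K, K])
  ((s ^+ 2 - al) * expR (L s - lam * s ^+ 2)))%R.
have D1 : 0 <= D (- (C0 + 4)) by exact: tilt_sub_ge0.
have D2 : D b <= 0 by apply: (tilt_sub_le0 C00 mL LC rho01 bC hb); rewrite ?al1.
have ab : - (C0 + 4) <= b by lra.
have [lam /[!in_itv]/= /andP[lam1 lam2] Dlam] : exists2 lam, lam \in `[- (C0 + 4), b] & D lam = 0.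
  apply: IVT => //.
    by apply: continuous_subspaceT; exact: (continuous_tilt_sub C00 mL LC al02).
  by rewrite ge_min D2 orbT le_max D1.
have lama : `|lam| <= a by rewrite ler_norml /a; lra.
pose W (s : R) : R := expR (L s - lam * s ^+ 2).
have mW : measurable_fun setT W by exact: measurable_tilt.
have ms2 : measurable_fun setT (fun s : R => s ^+ 2) by exact: measurable_sqr.
have s2K (s : R) : `|s| <= K -> s ^+ 2 <= K ^+ 2.
  by move=> sK; rewrite -[s ^+ 2]real_normK ?num_real// lerXn2r ?nnegrE.
have WK (s : R) : `|s| <= K -> W s <= expR ((C0 + a) * K ^+ 2).
  move=> sK; rewrite ler_expR; have /andP[_ Ls] := LC s.
  apply: (@le_trans _ _ ((C0 + a) * s ^+ 2)).
    rewrite mulrDl lerD// -mulNr ler_wpM2r ?sqr_ge0//.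
    by apply: le_trans lama; rewrite -normrN ler_norm.
  by rewrite ler_wpM2l ?s2K// /a; lra.
have iW : gaussian.-integrable `[- K, K] (EFin \o W).
  apply: (integrable_itv (M := expR ((C0 + a) * K ^+ 2))) => // s sK.
  by rewrite ger0_norm ?expR_ge0// WK.
have is2W : gaussian.-integrable `[- K, K] (EFin \o (fun s => s ^+ 2 * W s)).
  apply: (integrable_itv (M := K ^+ 2 * expR ((C0 + a) * K ^+ 2))).
    exact: measurable_funM.
  move=> s sK; rewrite normrM !ger0_norm ?expR_ge0 ?sqr_ge0//.
  by rewrite ler_pM ?sqr_ge0 ?expR_ge0 ?s2K ?WK.
pose Z : R := (\int[gaussian]_(s in `[- K, K]) W s)%R.
have S2 : (\int[gaussian]_(s in `[- K, K]) (s ^+ 2 * W s))%R = al * Z.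
  have ialW : gaussian.-integrable `[- K, K] (EFin \o (fun s => al * W s)).
    by have := integrableZl mBK al iW.
  apply/eqP; rewrite -subr_eq0 -RintegralZl// -RintegralB//.
  rewrite -[X in _ == X]Dlam; apply/eqP; apply: eq_Rintegral => s _.
  by rewrite mulrBl.
have m11 : measurable (`[- 1, 1]%classic : set (measurableTypeR R)) by exact: measurable_itv.
(* Only [[- 1, 1]] is kept, so the bound does not see [K]. *)
have Zlb : expR (- (a + 2)) <= Z.
  pose low (s : R) : R := expR (- a) * \1_`[- 1, 1] s.
  have i11 : gaussian.-integrable `[- K, K]
      (EFin \o (fun s : measurableTypeR R => \1_`[- 1, 1] s : R)).
    apply: (integrable_itv (M := 1)); first exact: measurable_indic.
    by move=> s _; rewrite indicE ger0_norm//; case: (_ \in _).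
  have ilow : gaussian.-integrable `[- K, K] (EFin \o low).
    by have := integrableZl mBK (expR (- a)) i11.
  apply: (@le_trans _ _ (\int[gaussian]_(s in `[- K, K]) low s)%R); last first.
    apply: le_Rintegral => // s _; rewrite /low indicE.
    have [/set_mem/=|_] := boolP (s \in `[- 1, 1]%classic); last first.
      by rewrite mulr0 expR_ge0.
    rewrite in_itv/= -ler_norml => s1; rewrite mulr1 ler_expR.
    have /andP[Ls0 _] := LC s.
    have s21 : s ^+ 2 <= 1.
      by rewrite -[s ^+ 2]real_normK ?num_real// exprn_ile1.
    have : lam * s ^+ 2 <= a * 1.
      apply: (@le_trans _ _ (a * s ^+ 2)).
        by rewrite ler_wpM2r ?sqr_ge0//; apply: le_trans lama; exact: ler_norm.
      by rewrite ler_wpM2l// /a; lra.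
    lra.
  rewrite RintegralZl// Rintegral_indic_gaussian// setIidl; last first.
    move=> s; rewrite /= !in_itv/= => /andP[s1 s2].
    by clear -K3 s1 s2; apply/andP; split; lra.
  have g2 : 2 * (expR (- (1 / 2)) / 3) <= fine (gaussian `[- 1, 1]%classic) :> R.
    rewrite -lee_fin fineK ?fin_num_measure//.
    have := @gaussian_itv_lb (- 1) 1 1 _ _.
    rewrite (_ : 1 - - 1 = 2); last by lra.
    rewrite expr1n; apply; first by lra.
    by move=> s; rewrite -ler_norml.
  rewrite opprD expRD ler_wpM2l ?expR_ge0//; apply: le_trans g2.
  rewrite (_ : - 2 = - (1 / 2) - 3 / 2); last by lra.
  rewrite expRD mulrCA ler_wpM2l ?expR_ge0//.
  rewrite expRN invf_ple ?posrE ?expR_gt0//.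
  by apply: le_trans (expR_ge1Dx _); lra.
have Z0 : 0 < Z by apply: lt_le_trans Zlb; exact: expR_gt0.
pose Psi : R := ln Z.
have WPsi s : expR (L s - lam * s ^+ 2 - Psi) = W s * Z^-1.
  by rewrite expRD expRN lnK ?posrE.
have I1 : (\int[gaussian]_(s in `[- K, K]) (W s * Z^-1))%R = 1.
  by rewrite RintegralZr// mulfV// gt_eqF.
have I2 : (\int[gaussian]_(s in `[- K, K]) (s ^+ 2 * W s * Z^-1))%R = al.
  by rewrite RintegralZr// S2 mulfK// gt_eqF.
have iWZ : gaussian.-integrable `[- K, K] (EFin \o (fun s => W s * Z^-1)).
  by have := integrableZr mBK Z^-1 iW.
have is2WZ : gaussian.-integrable `[- K, K] (EFin \o (fun s => s ^+ 2 * W s * Z^-1)).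
  by have := integrableZr mBK Z^-1 is2W.
exists lam, Psi; split.
- by apply: le_trans lama _; rewrite /a; lra.
- have Psilb : - (a + 2) <= Psi by rewrite -[- (a + 2)]expRK ler_ln ?posrE ?expR_gt0.
  (* The tilted measure has log-density [L s - lam * s ^+ 2 - Psi] and nonnegative relative entropy,
     so [Psi] is at most the mean of [L s - lam * s ^+ 2]. Bounding [Z] pointwise would bring in
     [K]. *)
  have Psiub : Psi <= (C0 - lam) * al.
    have ic : gaussian.-integrable `[- K, K]
        (EFin \o (fun s => (1 + Psi) * (W s * Z^-1))).
      by have := integrableZl mBK (1 + Psi) iWZ.
    have ic2 : gaussian.-integrable `[- K, K]
        (EFin \o (fun s => (C0 - lam) * (s ^+ 2 * W s * Z^-1))).
      by have := integrableZl mBK (C0 - lam) is2WZ.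
    have ic3 : gaussian.-integrable `[- K, K] (EFin \o (fun s =>
        (1 + Psi) * (W s * Z^-1) - (C0 - lam) * (s ^+ 2 * W s * Z^-1))).
      by have := integrableB mBK ic ic2.
    have i1 : gaussian.-integrable `[- K, K] (EFin \o (fun=> 1 : R)).
      by apply: (integrable_itv (M := 1)) => // s _; rewrite normr1.
    have le1 : (\int[gaussian]_(s in `[- K, K])
        ((1 + Psi) * (W s * Z^-1) - (C0 - lam) * (s ^+ 2 * W s * Z^-1)) <=
        \int[gaussian]_(s in `[- K, K]) (1 : R))%R.
      apply: le_Rintegral => // s _.
      have /andP[_ Ls] := LC s.
      have := expR_ge1Dx (Psi - (L s - lam * s ^+ 2)).
      pose q : R := W s * Z^-1.
      have q0 : 0 < q by rewrite divr_gt0// expR_gt0.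
      have -> : expR (Psi - (L s - lam * s ^+ 2)) = q^-1.
        by rewrite -opprB expRN WPsi.
      move=> h1; have : q * (1 + (Psi - (L s - lam * s ^+ 2))) <= 1.
        by rewrite -[leRHS](mulfV (lt0r_neq0 q0)) ler_wpM2l ?(ltW q0).
      have : q * L s <= q * (C0 * s ^+ 2) by rewrite ler_wpM2l ?(ltW q0).
      have -> : s ^+ 2 * W s * Z^-1 = s ^+ 2 * q by rewrite /q mulrA.
      by rewrite -/q; move: (q) (L s) => q' l; clear; lra.
    move: le1; rewrite RintegralB// !RintegralZl// I1 I2 Rintegral_cst// mul1r mulr1.
    have : fine (gaussian `[- K, K]%classic) <= 1 :> R.
      by rewrite -lee_fin fineK ?fin_num_measure// probability_le1.
    lra.
  have h1 : - lam * al <= a * al.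
    by rewrite ler_wpM2r ?(le_trans _ al1) ?(ltW rho0)// (le_trans _ lama)// -normrN ler_norm.
  have h2 : (C0 + a) * al <= (C0 + a) * 2 by rewrite ler_wpM2l// /a; lra.
  rewrite ler_norml; apply/andP; split; rewrite /a in Psilb h1 h2 *; lra.
- rewrite integral_indicM -[1%E]/(1%:E) -I1 /Rintegral fineK; last first.
    by apply: integrable_fin_num.
  by apply: eq_integral => s _; rewrite WPsi.
- transitivity (\int[gaussian]_s (\1_`[- K, K] s * (s ^+ 2 * W s * Z^-1))%:E)%E.
    by apply: eq_integral => s _; rewrite WPsi mulrCA (mulrA (s ^+ 2)).
  rewrite integral_indicM -I2 /Rintegral fineK//.
  by apply: integrable_fin_num.
Qed.

End tilted_gaussian.

(* The integral in [second_moment_on] is over the default measurable structure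
   of [R], whose display differs from that of [measurableTypeR R]. *)
Lemma integral_default_display {R : realType}
    (nu : probability (measurableTypeR R) R) (f : R -> \bar R) :
  measurable_fun (setT : set (measurableTypeR R)) f -> (forall s, 0 <= f s)%E ->
  (@integral default_measure_display
    (Real_sort__canonical__measurable_structure_Measurable R) R nu setT f =
   \int[nu]_(s in (setT : set (measurableTypeR R))) f s)%E.
Proof.
move=> mf f0.
pose j := (idfun : measurableTypeR R ->
  Real_sort__canonical__measurable_structure_Measurable R).
have mj : measurable_fun setT j by move=> _ A mA; rewrite setTI; exact: mA.
have mf' : @measurable_fun _ _
    (Real_sort__canonical__measurable_structure_Measurable R) _ setT f.
  by move=> _ A mA; have := mf measurableT A mA.
etransitivity; last first.
  exact: (@ge0_integral_pushforward _ _ (measurableTypeR R)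
    (Real_sort__canonical__measurable_structure_Measurable R) R j mj nu setT f
    measurableT mf' (fun s _ => f0 s)).
by [].
Qed.

(** * The variational problem and its multipliers *)

Section Phi_variational.
Context {R : realType}.
Variable mu : probability (measurableTypeR R) R.
Variables (n : nat) (v : 'rV[R]_n) (L : R -> R) (C0 : R).
Hypothesis LE : forall s,
  (\sum_i log_laplace mu (2 * v ord0 i * s))%E = (L s)%:E.
Hypotheses (mL : measurable_fun setT L) (LC : forall s, 0 <= L s <= C0 * s ^+ 2).

Variables (K al lam Psi : R).
Let h (s : measurableTypeR R) : R := \1_`[- K, K] s * expR (L s - lam * s ^+ 2 - Psi).
Hypothesis h1 : (\int[gaussian]_s (h s)%:E = 1)%E.

Let mB : measurable (`[- K, K]%classic : set (measurableTypeR R)).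
Proof. exact: measurable_itv. Qed.

Let mphi : measurable_fun setT (fun s : measurableTypeR R => L s - lam * s ^+ 2 - Psi).
Proof.
apply: measurable_funB => //; apply: measurable_funB => //.
by apply: measurable_funM => //; exact: measurable_sqr.
Qed.

Lemma integrable_sqr_second_moment (nu : probability (measurableTypeR R) R) :
  (\int[nu]_s (s ^+ 2)%:E = al%:E)%E ->
  nu.-integrable setT (EFin \o (fun s : measurableTypeR R => s ^+ 2)).
Proof.
move=> nu2; apply/integrableP; split; first by apply/measurable_EFinP; exact: measurable_sqr.
under eq_integral do rewrite /= ger0_norm ?sqr_ge0//.
by rewrite nu2 ltry.
Qed.

Lemma integrable_L_second_moment (nu : probability (measurableTypeR R) R) :
  (\int[nu]_s (s ^+ 2)%:E = al%:E)%E -> nu.-integrable setT (EFin \o L).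
Proof.
move=> nu2; apply: (@le_integrable _ _ _ nu setT measurableT _
   (fun s => (C0 * s ^+ 2)%:E)).
- exact/measurable_EFinP.
- move=> s _; rewrite /= lee_fin; have /andP[L0 Lb] := LC s.
  by rewrite ger0_norm// (le_trans Lb)// ler_norm.
- by have := integrableZl measurableT C0 (integrable_sqr_second_moment nu2).
Qed.

Lemma integral_exponent (nu : probability (measurableTypeR R) R) :
  (\int[nu]_s (s ^+ 2)%:E = al%:E)%E ->
  nu.-integrable setT (EFin \o (fun s : measurableTypeR R => L s - lam * s ^+ 2 - Psi)) /\
  (\int[nu]_s (L s - lam * s ^+ 2 - Psi)%:E =
   (fine (\int[nu]_s (L s)%:E) - lam * al - Psi)%:E)%E.
Proof.
move=> nu2; have iL := integrable_L_second_moment nu2.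
have i2 : nu.-integrable setT (EFin \o (fun s : measurableTypeR R => lam * s ^+ 2)).
  by have := integrableZl measurableT lam (integrable_sqr_second_moment nu2).
have iP : nu.-integrable setT (EFin \o (fun s : measurableTypeR R => Psi)).
  exact: finite_measure_integrable_cst.
have iL2 : nu.-integrable setT (EFin \o (fun s : measurableTypeR R => L s - lam * s ^+ 2)).
  by have := integrableB measurableT iL i2.
split; first by have := integrableB measurableT iL2 iP.
under eq_integral do rewrite EFinB EFinB.
rewrite integralB// integralB// integral_cst//=.
under [X in (_ - X - _)%E]eq_integral do rewrite EFinM.
rewrite integralZl//; last exact: integrable_sqr_second_moment.
rewrite nu2 [nu _]probability_setT mule1.
by rewrite -[in LHS](fineK (integrable_fin_num measurableT iL)).
Qed.

(** Gibbs' inequality for the exponent [L s - lam * s ^+ 2 - Psi], whose mean under a competitor is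
    that of [L] minus [lam * al + Psi]. Every [lam], with its normalizing [Psi], gives such a bound;
    the lower bound on the sphere uses it with a tilt of second moment [al + beta]. *)
Lemma Phi_le : (Phi mu K v al <= (lam * al + Psi)%:E)%E.
Proof.
suff key (nu : probability (measurableTypeR R) R) : nu `[- K, K]%classic = 1%E ->
    (\int[nu]_s (s ^+ 2)%:E = al%:E)%E ->
    (\int[nu]_s (L s)%:E -
      relative_entropy nu gaussian <= (lam * al + Psi)%:E)%E.
  apply: ub_ereal_sup => _ [nu [nuB nu2] <-]; move: nu2.
  rewrite integral_default_display; last 2 first.
  - by apply/measurable_EFinP; exact: measurable_sqr.
  - by move=> s; rewrite lee_fin sqr_ge0.
  move=> nu2; under [X in (X - _)%E]eq_integral do rewrite LE.
  exact: key.
move=> nuB nu2.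
have iL := integrable_L_second_moment nu2.
have [iphi intphi] := integral_exponent nu2.
have Lfin := integrable_fin_num measurableT iL.
have [num|num] := pselect (nu `<< gaussian); last first.
  rewrite /relative_entropy; case: (pselect (nu `<< gaussian)) => [/num//|nabs].
  by rewrite /= addeNy leNye.
have [g [mg g0 nuE]] := density_of_dominates num.
rewrite (relative_entropy_density mg g0 nuE).
have phi1 : (\int[gaussian]_(s in `[(- K)%R, K])
    (expR (L s - lam * s ^+ 2 - Psi))%:E <= 1)%E.
  by rewrite -h1 le_eqVlt; apply/orP; left; rewrite eq_sym; apply/eqP; exact: integral_indicM.
have [l lE] : exists l : R, (\int[nu]_s (L s)%:E)%E = l%:E.
  by exists (fine (\int[nu]_s (L s)%:E)%E); rewrite fineK.
have := gibbs_inequality mg g0 nuE mB nuB iphi phi1.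
rewrite intphi lE [fine _]/=.
case: (\int[nu]_s lne (g s)%:E)%E => [r||] //=.
- by rewrite !lee_fin; lra.
- by rewrite addeNy leNye.
Qed.

(** The tilted measure is a competitor, and its entropy is the mean of its own log-density, so it
    attains the bound. *)
Lemma Phi_ge : (\int[gaussian]_s (s ^+ 2 * h s)%:E = al%:E)%E ->
  ((lam * al + Psi)%:E <= Phi mu K v al)%E.
Proof.
move=> h2.
have mh : measurable_fun setT h.
  apply: measurable_funM; first exact: measurable_indic.
  exact: measurableT_comp.
have h0 s : 0 <= h s by rewrite mulr_ge0 ?expR_ge0.
pose nu := density_prob mh h0 h1.
have nu2 : (\int[nu]_s (s ^+ 2)%:E = al%:E)%E.
  rewrite ge0_integral_density_prob//.
  - by apply/measurable_EFinP; exact: measurable_sqr.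
  - by move=> s; rewrite lee_fin sqr_ge0.
have nuB : nu `[- K, K]%classic = 1%E.
  rewrite density_probE -h1 integral_mkcond; apply: eq_integral => s _.
  rewrite patchE; case: ifPn => // sB.
  by rewrite /h indicE (negbTE sB) mul0r.
have [iphi intphi] := integral_exponent nu2.
apply: ereal_sup_ubound; exists nu.
  split => //; rewrite integral_default_display//.
  - by apply/measurable_EFinP; exact: measurable_sqr.
  - by move=> s; rewrite lee_fin sqr_ge0.
under [X in (X - _)%E]eq_integral do rewrite LE.
rewrite (@relative_entropy_density _ nu gaussian h mh h0); last by [].
have -> : (\int[nu]_s lne (h s)%:E = \int[nu]_s (L s - lam * s ^+ 2 - Psi)%:E)%E.
  apply: ae_eq_integral => //.
  - exact: measurable_lne_EFin.
  - exact/measurable_EFinP.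
  exists (~` `[- K, K]%classic); split; first exact: measurableC.
    transitivity (1 - nu `[(- K)%R, K]%classic)%E; first exact: probability_setC.
    by rewrite nuB subee.
  move=> s; apply: contra_not => sB _.
  rewrite /h indicE mem_set// mul1r lne_EFin ?expR_gt0//.
  by rewrite expRK.
have iL := integrable_L_second_moment nu2.
have [l lE] : exists l : R, (\int[nu]_s (L s)%:E)%E = l%:E.
  by exists (fine (\int[nu]_s (L s)%:E)%E); rewrite fineK// integrable_fin_num.
rewrite intphi lE [fine _]/= -EFinB; congr EFin; ring.
Qed.
End Phi_variational.

Lemma integral_gaussian_rV {R : realType} n (h : 'I_n -> R -> R) :
  (forall i, measurable_fun setT (h i)) -> (forall i x, 0 <= h i x) ->
  (\int[gaussian_rV n]_x (\prod_(i < n) h i (x ord0 i))%:E =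
   \prod_(i < n) \int[gaussian]_s (h i s)%:E)%E.
Proof. exact: integral_product_prob. Qed.

(** * The energy near a sparse vector *)

Section euclidean_norm.
Context {R : realType}.

Definition adot n (u v : 'rV[R]_n) : R := \sum_i `|u ord0 i| * `|v ord0 i|.

Lemma norm2_ge0 n (u : 'rV[R]_n) : 0 <= norm2 u.
Proof. exact: sqrtr_ge0. Qed.

Lemma norm2_sqr n (u : 'rV[R]_n) : norm2 u ^+ 2 = dot u u.
Proof. by rewrite norm2E sqr_sqrtr ?dot_ge0. Qed.

Lemma norm2_eq0 n (u : 'rV[R]_n) : norm2 u = 0 -> u = 0.
Proof. by move=> u0; apply: dot_eq0; rewrite -norm2_sqr u0 expr0n. Qed.

Lemma adot_le n (u v : 'rV[R]_n) : adot u v <= norm2 u * norm2 v.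
Proof.
have [u0|u0] := eqVneq (norm2 u) 0.
  rewrite u0 mul0r (norm2_eq0 u0) /adot big1// => i _.
  by rewrite mxE normr0 mul0r.
have [v0|v0] := eqVneq (norm2 v) 0.
  rewrite v0 mulr0 (norm2_eq0 v0) /adot big1// => i _.
  by rewrite mxE normr0 mulr0.
have uv0 : 0 < norm2 u * norm2 v by rewrite mulr_gt0 ?lt_def ?norm2_ge0 ?u0 ?v0.
rewrite -(ler_pM2l uv0).
pose p : R := norm2 u; pose q : R := norm2 v.
have step (i : 'I_n) : p * q * (`|u ord0 i| * `|v ord0 i|) <=
    (q ^+ 2 * (u ord0 i * u ord0 i) + p ^+ 2 * (v ord0 i * v ord0 i)) / 2.
  have h a b (c d : R) : c ^+ 2 = a -> d ^+ 2 = b ->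
      p * q * (c * d) <= (q ^+ 2 * a + p ^+ 2 * b) / 2.
    move=> <- <-; rewrite -subr_ge0.
    by rewrite [leRHS](_ : _ = (q * c - p * d) ^+ 2 / 2) ?divr_ge0 ?sqr_ge0//; field.
  by apply: h; rewrite -normrX ger0_norm ?sqr_ge0// expr2.
rewrite /adot mulr_sumr; apply: (le_trans (ler_sum _ (fun i _ => step i))).
rewrite -mulr_suml big_split/= -!mulr_sumr -/(dot u u) -/(dot v v) -!norm2_sqr -/p -/q.
by rewrite le_eqVlt; apply/orP; left; apply/eqP; field.
Qed.

Lemma dot_le n (u v : 'rV[R]_n) : `|dot u v| <= norm2 u * norm2 v.
Proof.
apply: le_trans (adot_le u v); apply: le_trans (ler_norm_sum _ _ _) _.
by apply: ler_sum => i _; rewrite normrM.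
Qed.

Lemma norm2D n (u v : 'rV[R]_n) : norm2 (u + v) <= norm2 u + norm2 v.
Proof.
rewrite -(@ler_pXn2r _ 2)// ?nnegrE ?addr_ge0 ?norm2_ge0//.
rewrite norm2_sqr dotDl !dotDr (dotC v u) -!norm2_sqr sqrrD.
have := le_trans (ler_norm _) (dot_le u v).
move: (norm2 u) (norm2 v) (dot u v) => p q d; lra.
Qed.

Lemma norm2Z n (a : R) (u : 'rV[R]_n) : norm2 (a *: u) = `|a| * norm2 u.
Proof.
by rewrite !norm2E dotZl dotZr mulrA -expr2 sqrtrM ?sqr_ge0// sqrtr_sqr.
Qed.

Lemma norm2N n (u : 'rV[R]_n) : norm2 (- u) = norm2 u.
Proof. by rewrite -scaleN1r norm2Z normrN normr1 mul1r. Qed.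

Lemma norm2B_ge n (u v : 'rV[R]_n) : `|norm2 u - norm2 v| <= norm2 (u - v).
Proof.
rewrite ler_norml; apply/andP; split.
  have := norm2D (v - u) u; rewrite subrK -opprB norm2N.
  by move: (norm2 u) (norm2 v) (norm2 (u - v)) => p q d; lra.
have := norm2D (u - v) v; rewrite subrK.
by move: (norm2 u) (norm2 v) (norm2 (u - v)) => p q d; lra.
Qed.

Lemma norm2_restrict_supp n (w u : 'rV[R]_n) : norm2 (restrict_supp w u) <= norm2 u.
Proof.
rewrite !norm2E ler_wsqrtr//; apply: ler_sum => i _; rewrite mxE.
by case: ifP => // _; rewrite mul0r -expr2 sqr_ge0.
Qed.

Lemma norm2_restrict_suppC n (w u : 'rV[R]_n) : norm2 (restrict_suppC w u) <= norm2 u.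
Proof.
rewrite !norm2E ler_wsqrtr//; apply: ler_sum => i _; rewrite mxE.
by case: ifP => // _; rewrite mul0r -expr2 sqr_ge0.
Qed.

Lemma restrict_suppD n (w u : 'rV[R]_n) : restrict_supp w u + restrict_suppC w u = u.
Proof. by apply/rowP => i; rewrite !mxE; case: eqP => _; rewrite ?addr0 ?add0r. Qed.

Lemma dot_restrict_suppD n (w u : 'rV[R]_n) :
  dot u u = dot (restrict_supp w u) (restrict_supp w u) +
            dot (restrict_suppC w u) (restrict_suppC w u).
Proof.
rewrite -big_split; apply: eq_bigr => i _; rewrite !mxE.
by case: eqP => _ /=; rewrite ?mul0r ?addr0 ?add0r.
Qed.

End euclidean_norm.

Section quadratic_energy.
Context {R : realType}.
Variables (G : bool -> R -> R) (C : R).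
Hypothesis C0 : 0 <= C.
Hypothesis G0 : forall b, G b 0 = 0.
Hypothesis G_lipschitz : forall b s t, `|G b s - G b t| <= C * (`|s| + `|t|) * `|s - t|.
Hypothesis G_taylor : forall b t, `|G b t - t ^+ 2| <= C * `|t| ^+ 3.

(** Summing over ordered pairs lets the double sum factor in estimates; the boolean distinguishes
    the diagonal, where the variance of the matrix differs. *)
Definition energy n (a : R) (u : 'rV[R]_n) : R :=
  \sum_i \sum_j G (i == j) (a * (u ord0 i * u ord0 j)).

Lemma sum_prod_separate n (p q r s : 'I_n -> R) :
  \sum_i \sum_j (p i * q j) * (r i * s j) = (\sum_i p i * r i) * (\sum_j q j * s j).
Proof.
rewrite mulr_suml; apply: eq_bigr => i _; rewrite mulr_sumr.
by apply: eq_bigr => j _; ring.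
Qed.

(** With [d = u - v], [u_i u_j - v_i v_j = u_i d_j + d_i v_j]. The Lipschitz bound on [G] then gives
    four double sums, each a product of two single sums controlled by Cauchy-Schwarz. *)
Lemma energy_lipschitz n (a M : R) (u v : 'rV[R]_n) : norm2 u <= M -> norm2 v <= M ->
  `|energy a u - energy a v| <= 4 * C * a ^+ 2 * M ^+ 3 * norm2 (u - v).
Proof.
move=> uM vM; set d := u - v.
have uE i : v ord0 i = u ord0 i - d ord0 i by rewrite !mxE subKr.
pose nu i : R := `|u ord0 i|; pose nv i : R := `|v ord0 i|; pose nd i : R := `|d ord0 i|.
have step (i j : 'I_n) :
    `|G (i == j) (a * (u ord0 i * u ord0 j)) - G (i == j) (a * (v ord0 i * v ord0 j))| <=
    C * a ^+ 2 * ((nu i * nu j) * (nu i * nd j) + (nu i * nu j) * (nd i * nv j) +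
                  ((nv i * nv j) * (nu i * nd j) + (nv i * nv j) * (nd i * nv j))).
  apply: le_trans (G_lipschitz _ _ _) _.
  rewrite -mulrBr !normrM -/(nu i) -/(nu j) -/(nv i) -/(nv j).
  have -> : u ord0 i * u ord0 j - v ord0 i * v ord0 j =
     u ord0 i * d ord0 j + d ord0 i * v ord0 j by rewrite !uE; ring.
  have h : `|u ord0 i * d ord0 j + d ord0 i * v ord0 j| <= nu i * nd j + nd i * nv j.
    by apply: le_trans (ler_normD _ _) _; rewrite !normrM.
  have -> : a ^+ 2 = `|a| * `|a| by rewrite -normrM ger0_norm ?expr2 ?sqr_ge0// -expr2 sqr_ge0.
  rewrite [leRHS](_ : _ = C * (`|a| * (nu i * nu j) + `|a| * (nv i * nv j)) *
     (`|a| * (nu i * nd j + nd i * nv j))); last ring.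
  have ni0 (k : 'I_n) : 0 <= nu k by exact: normr_ge0.
  have nvi0 (k : 'I_n) : 0 <= nv k by exact: normr_ge0.
  apply: ler_wpM2l; last exact: ler_wpM2l.
  by rewrite mulr_ge0// addr_ge0// !mulr_ge0.
rewrite /energy -sumrB; apply: le_trans (ler_norm_sum _ _ _) _.
apply: (@le_trans _ _ (\sum_i \sum_j (C * a ^+ 2 * ((nu i * nu j) * (nu i * nd j) +
   (nu i * nu j) * (nd i * nv j) +
   ((nv i * nv j) * (nu i * nd j) + (nv i * nv j) * (nd i * nv j)))))).
  apply: ler_sum => i _; rewrite -sumrB; apply: le_trans (ler_norm_sum _ _ _) _.
  by apply: ler_sum => j _; exact: step.
under eq_bigr do rewrite -mulr_sumr !big_split/=.
rewrite -mulr_sumr !big_split/= !sum_prod_separate.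
have P0 (p q : 'rV[R]_n) : 0 <= adot p q by apply: sumr_ge0 => i _; rewrite mulr_ge0.
have U0 := norm2_ge0 u; have V0 := norm2_ge0 v; have D0 := norm2_ge0 d.
have M0 : 0 <= M by exact: le_trans uM.
have prodle (p1 p2 q1 q2 : 'rV[R]_n) : norm2 p1 <= M -> norm2 p2 <= M -> norm2 q1 <= M ->
    adot p1 p2 * adot q1 q2 <= M ^+ 3 * norm2 q2.
  move=> p1M p2M q1M; apply: (le_trans (ler_pM (P0 _ _) (P0 _ _) (adot_le _ _) (adot_le _ _))).
  rewrite mulrA ler_wpM2r ?norm2_ge0// 2!exprSr expr1 ler_pM ?mulr_ge0 ?norm2_ge0//.
  by rewrite ler_pM ?norm2_ge0.
rewrite [leRHS](_ : _ = C * a ^+ 2 * (M ^+ 3 * norm2 d + M ^+ 3 * norm2 d +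
   (M ^+ 3 * norm2 d + M ^+ 3 * norm2 d))); last by ring.
apply: (ler_wpM2l (mulr_ge0 C0 (sqr_ge0 a))).
have t1 := prodle u u u d uM uM uM.
have t2 := prodle u v u d uM vM uM; rewrite mulrC in t2.
have t3 := prodle v u v d vM uM vM.
have t4 := prodle v v v d vM vM vM; rewrite mulrC in t4.
exact: (lerD (lerD t1 t2) (lerD t3 t4)).
Qed.

(** The supports are disjoint, so each pair is of one type. Pairs within [w] are kept, mixed pairs
    are never diagonal and give [G false], and only pairs within [y], whose arguments are at most
    [B], are replaced by their squares. *)
Lemma energy_split n (a B : R) (w y : 'rV[R]_n) :
  (forall i, w ord0 i = 0 \/ y ord0 i = 0) ->
  (forall i j, `|a * (y ord0 i * y ord0 j)| <= B) ->
  `|energy a (w + y) - energy a w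
    - \sum_j \sum_i 2 * G false (a * (w ord0 i * y ord0 j)) - a ^+ 2 * dot y y ^+ 2|
  <= C * B * (a ^+ 2 * dot y y ^+ 2).
Proof.
move=> wy yB.
have termE (i j : 'I_n) : G (i == j) (a * ((w + y) ord0 i * (w + y) ord0 j)) =
   G (i == j) (a * (w ord0 i * w ord0 j)) + (G false (a * (w ord0 i * y ord0 j)) +
   G false (a * (y ord0 i * w ord0 j))) + G (i == j) (a * (y ord0 i * y ord0 j)).
  rewrite !mxE; have [<-{j}|ij] := eqVneq i j.
    by case: (wy i) => ->; rewrite !(mul0r, mulr0, addr0, add0r, G0).
  by case: (wy i) => ->; case: (wy j) => ->; rewrite !(mul0r, mulr0, addr0, add0r, G0).
have E : energy a (w + y) = energy a w +
   \sum_j \sum_i 2 * G false (a * (w ord0 i * y ord0 j)) + energy a y.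
  rewrite /energy; under eq_bigr do under eq_bigr do rewrite termE.
  under eq_bigr do rewrite !big_split/=.
  rewrite !big_split/=; congr (_ + _ + _).
  rewrite exchange_big/= -big_split; apply: eq_bigr => j _ /=.
  rewrite -big_split; apply: eq_bigr => i _ /=.
  by rewrite (mulrC (y ord0 j)) mulr2n mulrDl mul1r.
have -> : energy a (w + y) - energy a w -
    \sum_j \sum_i 2 * G false (a * (w ord0 i * y ord0 j)) - a ^+ 2 * dot y y ^+ 2 =
    energy a y - a ^+ 2 * dot y y ^+ 2 by rewrite E; ring.
have -> : a ^+ 2 * dot y y ^+ 2 = \sum_i \sum_j (a * (y ord0 i * y ord0 j)) ^+ 2.
  rewrite expr2 [dot y y ^+ 2]expr2 /dot -(sum_prod_separate (fun i => y ord0 i) (fun i => y ord0 i)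
     (fun i => y ord0 i) (fun i => y ord0 i)) mulr_sumr.
  by apply: eq_bigr => i _; rewrite mulr_sumr; apply: eq_bigr => j _; ring.
rewrite /energy -sumrB mulr_sumr; apply: le_trans (ler_norm_sum _ _ _) _.
apply: ler_sum => i _; rewrite -sumrB mulr_sumr; apply: le_trans (ler_norm_sum _ _ _) _.
apply: ler_sum => j _; apply: le_trans (G_taylor _ _) _.
move: (yB i j); move: (a * _) => t tB.
rewrite exprS -[t ^+ 2]ger0_norm ?sqr_ge0// normrX mulrA ler_wpM2r ?exprn_ge0//.
by rewrite ler_wpM2l.
Qed.

(** Here [z] is the norm of a vector, [s] that of its part on the support and [w] the target of [s],
    so [z ^+ 2 - s ^+ 2] should be near [1 - w ^+ 2]. *)
Lemma square_defect_le (s w z e : R) : 0 <= s <= 2 -> 0 <= w <= 1 -> 0 <= z <= 2 ->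
  0 <= e -> `|s - w| <= e -> 0 <= z ^+ 2 - s ^+ 2 ->
  `|(z ^+ 2 - s ^+ 2) ^+ 2 - (1 - w ^+ 2) ^+ 2| <= 15 * (`|z - 1| + e).
Proof.
clear => /andP[s0 s2] /andP[w0 w1] /andP[z0 z2] e0 sw d0.
rewrite subr_sqr normrM [leRHS](_ : _ = 3 * (`|z - 1| + e) * 5); last by ring.
apply: ler_pM => //.
  have -> : z ^+ 2 - s ^+ 2 - (1 - w ^+ 2) = (z - 1) * (z + 1) - (s - w) * (s + w) by ring.
  apply: le_trans (ler_normB _ _) _; rewrite !normrM mulrDr; apply: lerD.
    by rewrite mulrC ler_wpM2r// ger0_norm; lra.
  by rewrite mulrC; apply: ler_pM => //; rewrite ger0_norm; lra.
by rewrite ger0_norm; nra.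
Qed.

Lemma energy_combine (A D E B e1 e2 e3 e4 dy al L : R) :
  0 <= A -> 0 <= D -> 0 <= E -> 0 <= B ->
  `|e1 - e3| <= 4 * C * A * 2 ^+ 3 * D -> `|e3 - e4| <= 4 * C * A * 3 ^+ 3 * E ->
  `|e4 - e2 - L - A * dy| <= C * B * (A * dy) -> dy <= 16 ->
  `|dy - al| <= 15 * (D + E) ->
  `|e1 - e2 - L - A * al| <= (108 * C + 15) * A * (D + E) + 16 * C * B * A.
Proof.
move=> A0 D0 E0 B0 h1 h2 h3 d4 h4; have C0' := C0.
have CB : C * B * (A * dy) <= 16 * C * B * A.
  rewrite [leRHS](_ : _ = C * B * (A * 16)); last by ring.
  by rewrite ler_wpM2l ?mulr_ge0// ler_wpM2l.
have h4' : `|A * dy - A * al| <= 15 * (A * D) + 15 * (A * E).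
  rewrite -mulrBr normrM (ger0_norm A0) [leRHS](_ : _ = A * (15 * (D + E))); last by ring.
  by rewrite ler_wpM2l.
have -> : (108 * C + 15) * A * (D + E) = 108 * (C * A * D) + 108 * (C * A * E) + 15 * (A * D) + 15 * (A * E) by ring.
have e1' : 4 * C * A * 2 ^+ 3 * D = 32 * (C * A * D) by ring.
have e2' : 4 * C * A * 3 ^+ 3 * E = 108 * (C * A * E) by ring.
rewrite e1' in h1; rewrite e2' in h2.
have p1 : 0 <= C * A * D by rewrite !mulr_ge0.
move: p1 CB h1 h2 h3 h4'; move: (C * A * D) (C * A * E) (A * D) (A * E) (A * dy) (A * al) (16 * C * B * A).
move=> x1 x2 x3 x4 x5 x6 x7; move: (C * B * x5) => x8; clear.
rewrite !ler_norml => p1 CB /andP[h1 h1'] /andP[h2 h2'] /andP[h3 h3'] /andP[h4 h4'].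
apply/andP; split; lra.
Qed.

(* Compare the normalized [z] first with [z], then with [w + restrict_suppC w z],
   whose energy splits exactly; the coordinates outside the support of [w] are
   small, so their mutual energy is quadratic by [G_taylor]. *)
Lemma energy_normalize n (a B : R) (w z : 'rV[R]_n) :
  norm2 w <= 1 -> 0 < norm2 z -> norm2 z <= 2 ->
  0 <= B ->
  (forall i j, w ord0 i = 0 -> w ord0 j = 0 -> `|a * (z ord0 i * z ord0 j)| <= B) ->
  `|energy a ((norm2 z)^-1 *: z) - energy a w
    - \sum_(j | w ord0 j == 0) \sum_i 2 * G false (a * (w ord0 i * z ord0 j))
    - a ^+ 2 * (1 - norm2 w ^+ 2) ^+ 2|
  <= (108 * C + 15) * a ^+ 2 *
     (`|norm2 z - 1| + norm2 (restrict_supp w z - w)) + 16 * C * B * a ^+ 2.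
Proof.
move=> w1 z0 z2 B0 zB.
set u := _ *: z; set y := restrict_suppC w z.
set eps := norm2 (restrict_supp w z - w).
pose del : R := `|norm2 z - 1|.
have eps0 : 0 <= eps by exact: norm2_ge0.
have del0 : 0 <= del by exact: normr_ge0.
have uz : norm2 (u - z) = del.
  rewrite /u -[X in _ - X]scale1r -scalerBl norm2Z -{2}(gtr0_norm z0) -normrM mulrBl mulVf ?gt_eqF//.
  by rewrite mul1r distrC.
have u2 : norm2 u <= 2 by rewrite norm2Z gtr0_norm ?invr_gt0// mulVf ?gt_eqF// ler1n.
have h1 := energy_lipschitz a u2 z2; rewrite uz in h1.
have zv : z - (w + y) = restrict_supp w z - w.
  by rewrite -{1}(restrict_suppD w z) -/y [w + y]addrC opprD addrA addrK.
have y2 : norm2 y <= 2 by apply: le_trans (norm2_restrict_suppC _ _) z2.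
have v3 : norm2 (w + y) <= 3.
  by apply: le_trans (norm2D _ _) _; apply: le_trans (lerD w1 y2) _; rewrite (_ : 1 + 2 = 3)//; ring.
have z3 : norm2 z <= 3 by apply: le_trans z2 _; rewrite ler_nat.
have h2 := energy_lipschitz a z3 v3; rewrite zv -/eps in h2.
have wy i : w ord0 i = 0 \/ y ord0 i = 0.
  by rewrite !mxE; case: eqP; [left|right].
have yB i j : `|a * (y ord0 i * y ord0 j)| <= B.
  rewrite !mxE; case: eqP => wi; last by rewrite mul0r mulr0 normr0.
  by case: eqP => wj; [exact: zB|rewrite !mulr0 normr0].
have := energy_split wy yB.
have -> : \sum_j \sum_i 2 * G false (a * (w ord0 i * y ord0 j)) =
    \sum_(j | w ord0 j == 0) \sum_i 2 * G false (a * (w ord0 i * z ord0 j)).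
  rewrite [RHS]big_mkcond/=; apply: eq_bigr => j _; rewrite mxE.
  by case: ifP => // _; rewrite big1// => i _; rewrite !mulr0 G0 mulr0.
set L := \sum_(j | _) _ => h3.
have dE : dot y y = norm2 z ^+ 2 - norm2 (restrict_supp w z) ^+ 2.
  by rewrite !norm2_sqr (dot_restrict_suppD w z) addrC addKr.
have s2 : norm2 (restrict_supp w z) <= 2 := le_trans (norm2_restrict_supp w z) z2.
have hs : `|norm2 (restrict_supp w z) - norm2 w| <= eps := norm2B_ge _ _.
have w0 := norm2_ge0 w; have s0 := norm2_ge0 (restrict_supp w z).
have d0 := dot_ge0 y.
have hal : `|dot y y ^+ 2 - (1 - norm2 w ^+ 2) ^+ 2| <= 15 * (del + eps).
  by rewrite dE; apply: square_defect_le => //; rewrite -?dE ?s0 ?w0 ?(ltW z0) ?s2 ?w1 ?z2.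
have d4 : dot y y ^+ 2 <= 16.
  have : dot y y <= 4 by rewrite dE; clear -z2 z0 s0; nra.
  by clear -d0; nra.
by apply: (energy_combine _ _ _ _ h1 h2 h3 d4 hal) => //; exact: sqr_ge0.
Qed.

End quadratic_energy.

(** * Concentration of squared norms *)

Section product_chernoff.
Context {R : realType}.

Lemma le_prode n (F G : 'I_n -> \bar R) : (forall i, 0 <= F i <= G i)%E ->
  (\prod_(i < n) F i <= \prod_(i < n) G i)%E.
Proof.
move=> FG; suff : (0 <= \prod_(i < n) F i <= \prod_(i < n) G i)%E by move=> /andP[].
elim/big_rec2: _ => [|i y x _ /andP[y0 yx]]; first by rewrite lee01 lexx.
have /andP[F0 FGi] := FG i.
by rewrite mule_ge0//= lee_pmul.
Qed.

Lemma measurable_prod_coordT n (h : 'I_n -> R -> R) : (forall i, measurable_fun setT (h i)) ->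
  measurable_fun [set: borel_rV R n] (fun x : borel_rV R n => \prod_(i < n) h i (x ord0 i)).
Proof. exact: (@measurable_prod_coord _ _ _ predT). Qed.

Lemma measurable_sum_coord n (J : {pred 'I_n}) (h : 'I_n -> R -> R) :
  (forall i, measurable_fun setT (h i)) ->
  measurable_fun [set: borel_rV R n] (fun x : borel_rV R n => \sum_(i in J) h i (x ord0 i)).
Proof.
move=> mh; under eq_fun do rewrite big_mkcond.
apply: measurable_sum => i; case: (boolP (i \in J)) => _; last exact: measurable_cst.
exact: (measurableT_comp (mh i) (measurable_coord i)).
Qed.

Lemma expR_sum_prod n (J : {pred 'I_n}) (f : 'I_n -> R) (c : R) :
  \prod_(i < n) (if i \in J then expR (c * f i) else 1) = expR (c * \sum_(i in J) f i).
Proof. by rewrite -big_mkcond/= mulr_sumr expR_sum. Qed.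

Lemma measurable_coord_sqr_expR (a c : R) :
  measurable_fun setT (fun s : R => expR (c * (s ^+ 2 - a))).
Proof.
apply: measurableT_comp => //; apply: measurable_funM => //.
by apply: measurable_funB => //; exact: measurable_sqr.
Qed.

Definition energy_window n (J : {pred 'I_n}) (a D : R) : set (borel_rV R n) :=
  [set x | `|\sum_(i in J) ((x ord0 i) ^+ 2 - a)| <= D].

Lemma measurable_energy_window n (J : {pred 'I_n}) a D : measurable (energy_window J a D).
Proof.
have mS : measurable_fun [set: borel_rV R n]
    (fun x : borel_rV R n => `|\sum_(i in J) ((x ord0 i) ^+ 2 - a)|).
  apply: measurableT_comp => //.
  apply: (@measurable_sum_coord _ _ (fun _ s => s ^+ 2 - a)) => i.
  by apply: measurable_funB => //; exact: measurable_sqr.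
rewrite -[energy_window _ _ _]setTI.
have -> : energy_window J a D =
    (fun x : borel_rV R n => `|\sum_(i in J) ((x ord0 i) ^+ 2 - a)|) @^-1` `]-oo, D].
  by apply/seteqP; split=> x /=; rewrite in_itv.
exact: mS.
Qed.

(** Outside the window, [1 <= expR (- t D) * (expR (t S) + expR (- t S))] for the sum [S]. Under the
    product density the exponential moments multiply, and each tail has mass at most [1 / 4]. *)
Lemma chernoff n (J : {pred 'I_n}) (h : 'I_n -> R -> R) (a t v D : R) :
  (forall i, measurable_fun setT (h i)) -> (forall i s, 0 <= h i s) ->
  (forall i, \int[gaussian]_s (h i s)%:E = 1)%E ->
  0 <= t -> 0 <= v ->
  (forall i, i \in J -> \int[gaussian]_s (expR (t * (s ^+ 2 - a)) * h i s)%:E <= (expR v)%:E)%E ->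
  (forall i, i \in J -> \int[gaussian]_s (expR (- t * (s ^+ 2 - a)) * h i s)%:E <= (expR v)%:E)%E ->
  expR (n%:R * v - t * D) <= 1 / 4 ->
  ((1 / 2)%:E <= \int[gaussian_rV n]_x
     (\1_(energy_window J a D) x * \prod_(i < n) h i (x ord0 i))%:E)%E.
Proof.
move=> mh h0 h1 t0 v0 hp hm hD.
pose E := energy_window J a D.
pose H (x : borel_rV R n) : R := \prod_(i < n) h i (x ord0 i).
pose q c (i : 'I_n) (s : R) : R := (if i \in J then expR (c * (s ^+ 2 - a)) else 1) * h i s.
pose Q c (x : borel_rV R n) : R := \prod_(i < n) q c i (x ord0 i).
have mE : measurable E := measurable_energy_window J a D.
have mH : measurable_fun setT H by exact: measurable_prod_coordT.
have mq c i : measurable_fun setT (q c i).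
  rewrite /q; case: (boolP (i \in J)) => _; apply: measurable_funM => //; exact: measurable_coord_sqr_expR.
have q0 c i s : 0 <= q c i s by rewrite mulr_ge0//; case: ifP => // _; exact: expR_ge0.
have mQ c : measurable_fun setT (Q c) by exact: measurable_prod_coordT.
have H0 x : 0 <= H x by exact: prodr_ge0.
have Q0 c x : 0 <= Q c x by apply: prodr_ge0 => i _; exact: q0.
have QE c x : Q c x = expR (c * \sum_(i in J) ((x ord0 i) ^+ 2 - a)) * H x.
  by rewrite /Q /q big_split/= expR_sum_prod.
have intQ c : (forall i, i \in J -> \int[gaussian]_s (expR (c * (s ^+ 2 - a)) * h i s)%:E <=
    (expR v)%:E)%E -> (\int[gaussian_rV n]_x (Q c x)%:E <= (expR (n%:R * v))%:E)%E.
  move=> hc; rewrite integral_gaussian_rV//.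
  apply: (@le_trans _ _ (\prod_(i < n) (expR v)%:E)%E).
    apply: le_prode => i; apply/andP; split.
      by apply: integral_ge0 => s _; rewrite lee_fin.
    rewrite /q; case: (boolP (i \in J)) => iJ; first exact: hc.
    under eq_integral do rewrite mul1r.
    by rewrite h1 lee_fin -expR0 ler_expR.
  by rewrite prodEFin lee_fin prodr_const card_ord expRM_natl.
have pw x : H x <= \1_E x * H x + expR (- (t * D)) * (Q t x + Q (- t) x).
  rewrite indicE; have [xE|xE] := boolP (x \in E).
    by rewrite mul1r lerDl mulr_ge0 ?expR_ge0 ?addr_ge0.
  rewrite mul0r add0r !QE; set S := \sum_(i in J) _.
  have SD : D < `|S|.
    by rewrite ltNge; apply: contra xE => SD; rewrite inE.
  have e0 := expR_ge0.
  suff : 1 <= expR (- (t * D)) * (expR (t * S) + expR (- t * S)).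
    by move=> h2; rewrite -mulrDl mulrA ler_peMl.
  rewrite mulrDr -!expRD.
  have [S0|S0] := leP 0 S.
    rewrite ger0_norm// in SD; apply: (@le_trans _ _ (expR (- (t * D) + t * S))).
      rewrite -[leLHS]expR0 ler_expR addrC -mulrBr mulr_ge0// subr_ge0; exact: ltW.
    by rewrite lerDl.
  rewrite ltr0_norm// in SD; apply: (@le_trans _ _ (expR (- (t * D) + - t * S))).
    rewrite -[leLHS]expR0 ler_expR addrC mulNr -mulrN -mulrBr mulr_ge0// subr_ge0; exact: ltW.
  by rewrite lerDr.
have mEH : measurable_fun setT (fun x => \1_E x * H x) by apply: measurable_funM => //; exact: measurable_indic.
have intH : (\int[gaussian_rV n]_x (H x)%:E = 1)%E.
  by rewrite integral_gaussian_rV// big1.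
have : (1%:E <= \int[gaussian_rV n]_x (\1_E x * H x)%:E +
    (expR (- (t * D)))%:E * ((expR (n%:R * v))%:E + (expR (n%:R * v))%:E))%E.
  rewrite -[X in (X <= _)%E]intH.
  apply: (@le_trans _ _ (\int[gaussian_rV n]_x ((\1_E x * H x)%:E +
      (expR (- (t * D)))%:E * ((Q t x)%:E + (Q (- t) x)%:E)))%E).
    apply: ge0_le_integral => //.
    - by move=> x _; rewrite lee_fin.
    - exact/measurable_EFinP.
    - apply: emeasurable_funD; first exact/measurable_EFinP.
      by apply: emeasurable_funM => //; apply: emeasurable_funD; exact/measurable_EFinP.
    - by move=> x _; have := pw x; rewrite -lee_fin EFinD (EFinM (expR _)) EFinD.
  rewrite ge0_integralD//; last 4 first.
  - by move=> x _; rewrite lee_fin mulr_ge0.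
  - exact/measurable_EFinP.
  - by move=> x _; rewrite mule_ge0// ?adde_ge0// ?lee_fin// expR_ge0.
  - by apply: emeasurable_funM => //; apply: emeasurable_funD; exact/measurable_EFinP.
  rewrite ge0_integralZl//; last 2 first.
  - by apply: emeasurable_funD; exact/measurable_EFinP.
  - by move=> x _; rewrite adde_ge0// lee_fin.
  rewrite ge0_integralD//; last 4 first.
  - by move=> x _; rewrite lee_fin.
  - exact/measurable_EFinP.
  - by move=> x _; rewrite lee_fin.
  - exact/measurable_EFinP.
  apply: leeD2l; apply: lee_wpmul2l; first by rewrite lee_fin expR_ge0.
  by apply: leeD; exact: intQ.
rewrite -EFinD -EFinM mulrDr -!expRD -/E -/(H _).
rewrite (addrC (- _)); move: hD; set b := expR _ => hD.
rewrite -/(H _); case: (\int[_]_x _)%E => [r| |].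
- by rewrite -EFinD !lee_fin; lra.
- by move=> _; rewrite leey.
- by rewrite addNye leeNy_eq.
Qed.

(** Multiply by [expR (- z) >= 1 - z]: the product is at least [1 + z^2 (1 - 2 z) >= 1]. *)
Lemma le_expR_quadratic (z : R) : `|z| <= 1 / 2 -> expR z <= 1 + z + 2 * z ^+ 2.
Proof.
rewrite ler_norml => /andP[z1 z2].
have h : 1 - z <= expR (- z) by exact: expR_ge1Dx.
have z0 : 0 < 1 - z by lra.
rewrite -(ler_pM2r (expR_gt0 (- z))) -expRD subrr expR0.
have q0 : 0 <= 1 + z + 2 * z ^+ 2 by nra.
apply: le_trans (ler_wpM2l q0 h).
have -> : (1 + z + 2 * z ^+ 2) * (1 - z) = 1 + z ^+ 2 * (1 - 2 * z) by ring.
by rewrite lerDl mulr_ge0 ?sqr_ge0//; lra.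
Qed.

(** The choice of [al] as second moment cancels the linear term. On the support
    [(s^2 - al)^2 <= K^2 (s^2 + al)], so the quadratic term has mean at most
    [4 t^2 K^2 al <= 8 t^2 K^2]; the fourth moment, of order [K^4] in general, is avoided. *)
Lemma tilt_mgf_le (K al t : R) (h : R -> R) : measurable_fun setT h -> (forall s, 0 <= h s) ->
  (forall s, ~~ (- K <= s <= K) -> h s = 0) ->
  (\int[gaussian]_s (h s)%:E = 1)%E ->
  (\int[gaussian]_s (s ^+ 2 * h s)%:E = al%:E)%E ->
  0 <= al <= 2 -> 2 <= K -> `|t| * K ^+ 2 <= 1 / 2 ->
  (\int[gaussian]_s (expR (t * (s ^+ 2 - al)) * h s)%:E <= (expR (8 * t ^+ 2 * K ^+ 2))%:E)%E.
Proof.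
move=> mh h0 hK h1 h2 /andP[al0 al2] K2 tK.
pose c0 : R := 1 - t * al + 2 * (t ^+ 2 * K ^+ 2 * al).
pose c1 : R := t + 2 * (t ^+ 2 * K ^+ 2).
have ih : gaussian.-integrable setT (EFin \o (h : measurableTypeR R -> R)).
  apply/integrableP; split; first exact/measurable_EFinP.
  under eq_integral do rewrite /= ger0_norm//.
  by rewrite h1 ltry.
have ih2 : gaussian.-integrable setT (EFin \o ((fun s => s ^+ 2 * h s) : measurableTypeR R -> R)).
  apply/integrableP; split.
    by apply/measurable_EFinP; apply: measurable_funM => //; exact: measurable_sqr.
  rewrite (eq_integral (fun s : measurableTypeR R => (s ^+ 2 * h s)%:E)) ?h2 ?ltry// => s _.
  by rewrite /= ger0_norm// mulr_ge0 ?sqr_ge0.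
apply: (@le_trans _ _ (\int[gaussian]_(s in [set: measurableTypeR R])
    (c0%:E * (h s)%:E + c1%:E * (s ^+ 2 * h s)%:E))%E).
  apply: ge0_le_integral => //.
  - by move=> s _; rewrite lee_fin mulr_ge0 ?expR_ge0.
  - apply/measurable_EFinP; apply: measurable_funM => //.
    exact: measurable_coord_sqr_expR.
  - apply: emeasurable_funD; apply: emeasurable_funM => //; apply/measurable_EFinP => //.
    by apply: measurable_funM => //; exact: measurable_sqr.
  - move=> s _; rewrite -!EFinM -EFinD lee_fin mulrA -mulrDl.
    have [sK|/hK ->] := boolP (- K <= s <= K); last by rewrite !mulr0.
    rewrite ler_wpM2r//.
    have s2 : s ^+ 2 <= K ^+ 2 by clear -sK K2; nra.
    have s20 : 0 <= s ^+ 2 by exact: sqr_ge0.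
    have dK : `|s ^+ 2 - al| <= K ^+ 2.
      by rewrite ler_norml; apply/andP; split; clear -s2 s20 al0 al2 K2; nra.
    apply: le_trans (le_expR_quadratic _) _.
      by rewrite normrM; apply: le_trans tK; rewrite ler_wpM2l.
    rewrite /c0 /c1 exprMn.
    have h3 : (s ^+ 2 - al) ^+ 2 <= K ^+ 2 * (s ^+ 2 + al).
      rewrite -[leLHS]ger0_norm ?sqr_ge0// normrX expr2 ler_pM//.
      by rewrite ler_norml; apply/andP; split; lra.
    have := ler_wpM2l (sqr_ge0 t) h3.
    by clear; move: (s ^+ 2) (t ^+ 2) (K ^+ 2) => x y z; lra.
rewrite integralD//; try by [exact: integrableZl].
rewrite !integralZl// h1 h2 mule1 -EFinM -EFinD lee_fin.
apply: le_trans (expR_ge1Dx _).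
rewrite /c0 /c1.
have := mulr_ge0 (sqr_ge0 t) (sqr_ge0 K).
by clear -al0 al2; move: (t ^+ 2) (K ^+ 2) => x y; nra.
Qed.

End product_chernoff.

Section gaussian_square_mgf.
Context {R : realType}.

(* Multiplying the standard density by [e^(t s^2)] gives, up to a constant, the
   density of variance [(1 - 2 t)^-1]. *)
Lemma integral_gaussian_expR_sqr (t : R) : t < 1 / 2 ->
  (\int[gaussian]_s (expR (t * s ^+ 2))%:E = ((Num.sqrt (1 - 2 * t))^-1)%:E)%E.
Proof.
move=> t2; pose r : R := Num.sqrt (1 - 2 * t).
have r0 : 0 < r by rewrite sqrtr_gt0; lra.
have r2 : r ^+ 2 = 1 - 2 * t by rewrite sqr_sqrtr//; lra.
have rV : r^-1 != 0 by rewrite invr_eq0 gt_eqF.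
have mexp : measurable_fun setT (fun s : R => expR (t * s ^+ 2)).
  by apply: measurableT_comp => //; apply: measurable_funM => //; exact: measurable_sqr.
rewrite ge0_integral_gaussian; last 2 first.
- exact/measurable_EFinP.
- by move=> s; rewrite lee_fin expR_ge0.
transitivity (\int[lebesgue_measure]_s ((r^-1)%:E * (normal_pdf 0 r^-1 s)%:E))%E.
  apply: eq_integral => s _; rewrite -!EFinM; congr EFin.
  rewrite !normal_pdfE// /normal_fun /normal_peak !subr0 expr1n mul1r exprVn r2.
  rewrite -mulrnAr -r2 -[(r ^+ 2)^-1 * _](_ : r^-1 ^+ 2 * (pi *+ 2) = _); last by rewrite exprVn.
  rewrite sqrtrM ?sqr_ge0// sqrtr_sqr ger0_norm ?invr_ge0 ?(ltW r0)// invfM invrK.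
  rewrite mulrCA -expRD -[r / _ * _]mulrA [RHS]mulrA mulVf ?gt_eqF// mul1r; congr (_ * expR _).
  rewrite -(mulr_natr (r ^- 2)) invfM invrK r2; by field.
rewrite ge0_integralZl//.
- by rewrite integral_normal_pdf mule1.
- by apply/measurable_EFinP; exact: measurable_normal_pdf.
- by move=> s _; rewrite lee_fin normal_pdf_ge0.
- by rewrite lee_fin invr_ge0 ltW.
Qed.

Lemma le_expR_neg_quadratic (t : R) : `|t| <= 1 / 4 -> expR (- (2 * t + 8 * t ^+ 2)) <= 1 - 2 * t.
Proof.
rewrite ler_norml => /andP[t1 t2].
have h : 1 + (2 * t + 8 * t ^+ 2) <= expR (2 * t + 8 * t ^+ 2) by exact: expR_ge1Dx.
have z0 : 0 <= 1 - 2 * t by lra.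
rewrite -(ler_pM2l (expR_gt0 (2 * t + 8 * t ^+ 2))) -expRD subrr expR0.
apply: le_trans (ler_wpM2r z0 h).
have -> : (1 + (2 * t + 8 * t ^+ 2)) * (1 - 2 * t) = 1 + 4 * t ^+ 2 * (1 - 4 * t) by ring.
by rewrite lerDl; apply: mulr_ge0; [rewrite mulr_ge0 ?sqr_ge0|lra].
Qed.

Lemma gaussian_square_mgf_le (t : R) : `|t| <= 1 / 4 ->
  (\int[gaussian]_s (expR (t * s ^+ 2))%:E <= (expR (t + 4 * t ^+ 2))%:E)%E.
Proof.
move=> t4; have := t4; rewrite ler_norml => /andP[t1 t2].
have t0 : 0 < 1 - 2 * t by lra.
rewrite integral_gaussian_expR_sqr; last by lra.
rewrite lee_fin -[leRHS]invrK lef_pV2 ?posrE ?sqrtr_gt0 ?invr_gt0 ?expR_gt0//.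
rewrite -expRN -(@ler_pXn2r _ 2)// ?nnegrE ?expR_ge0 ?sqrtr_ge0//.
rewrite sqr_sqrtr ?(ltW t0)// -expRM_natl.
apply: le_trans (le_expR_neg_quadratic t4).
by rewrite ler_expR le_eqVlt; apply/orP; left; apply/eqP; ring.
Qed.

End gaussian_square_mgf.

Section gaussian_shell.
Context {R : realType}.

(** A factor [e^(- O(sqrt n))] is harmless for the free energy, so a change of variance and Chernoff
    bounds replace a central limit argument. *)
Lemma gaussian_shell n : (256 <= n)%N ->
  ((expR (- (8 * Num.sqrt n%:R)) / 2)%:E <=
   gaussian_rV n [set x : 'rV[R]_n | (n%:R - 16 * Num.sqrt n%:R <= dot x x <= n%:R)%R])%E.
Proof.
move=> n256; pose q : R := Num.sqrt n%:R.
have q16 : 16 <= q.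
  by rewrite -[16](@ger0_norm R)// -sqrtr_sqr -natrX ler_wsqrtr// ler_nat.
have q2 : q ^+ 2 = n%:R by rewrite sqr_sqrtr.
have q0 : 0 < q by lra.
pose del : R := 8 / q.
have del0 : 0 < del by rewrite divr_gt0.
have del2 : del <= 1 / 2 by rewrite ler_pdivrMr//; lra.
have qdel : q * del = 8 by rewrite mulrC divfK// gt_eqF.
pose s2 : R := 1 - del.
have s20 : 0 < s2 by rewrite /s2; lra.
pose r : R := Num.sqrt s2.
have r0 : 0 < r by rewrite sqrtr_gt0.
have r2 : r ^+ 2 = s2 by rewrite sqr_sqrtr// ltW.
(* [h] will be the density of variance [s2] relative to the standard Gaussian; the squared norm is
   then centred at [n * s2 = n - 8 q], the middle of the shell. *)
pose c : R := (s2^-1 - 1) / 2.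
have c0 : 0 <= c by rewrite divr_ge0// subr_ge0 invf_ge1//; rewrite /s2; lra.
pose h (i : 'I_n) (s : R) : R := r^-1 * expR (- c * s ^+ 2).
have mh i : measurable_fun setT (h i).
  apply: measurable_funM => //; apply: measurableT_comp => //.
  by apply: measurable_funM => //; exact: measurable_sqr.
have h0 i s : 0 <= h i s by rewrite mulr_ge0 ?expR_ge0// invr_ge0 ltW.
have hint (t : R) (i : 'I_n) : t * s2 < 1 / 2 ->
   (\int[gaussian]_s (expR (t * (s ^+ 2 - s2)) * h i s)%:E =
    (expR (- (t * s2)))%:E * \int[gaussian]_s (expR (t * s2 * s ^+ 2))%:E)%E.
  move=> ts; rewrite integral_gaussian_expR_sqr//.
  transitivity (\int[gaussian]_s ((expR (- (t * s2)) * r^-1)%:E * (expR ((t - c) * s ^+ 2))%:E))%E.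
    apply: eq_integral => s _; rewrite -EFinM; congr EFin.
    rewrite /h [LHS]mulrCA -expRD [RHS]mulrAC mulrC -expRD; congr (expR _ * _); ring.
  have tc : t - c < 1 / 2.
    rewrite /c -(ltr_pM2r s20) mulrBl mulrAC mulrBl mulVf ?gt_eqF// mul1r; lra.
  rewrite ge0_integralZl//; last 2 first.
  - apply/measurable_EFinP; apply: measurableT_comp => //.
    by apply: measurable_funM => //; exact: measurable_sqr.
  - by rewrite lee_fin mulr_ge0 ?expR_ge0// invr_ge0 ltW.
  rewrite integral_gaussian_expR_sqr// -!EFinM; congr EFin; rewrite -mulrA; congr (_ * _).
  rewrite -invfM; congr (_^-1).
  rewrite -sqrtrM ?ltW//; congr Num.sqrt; rewrite /c.
  by field; rewrite gt_eqF.
have h1 i : (\int[gaussian]_s (h i s)%:E = 1)%E.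
  transitivity (\int[gaussian]_s (expR (0 * (s ^+ 2 - s2)) * h i s)%:E)%E.
    by apply: eq_integral => s _; rewrite mul0r expR0 mul1r.
  have h00 : 0 * s2 < 1 / 2 :> R by rewrite mul0r; lra.
  rewrite (hint 0 i h00) integral_gaussian_expR_sqr// mul0r oppr0 expR0 mul1e.
  by rewrite mulr0 subr0 sqrtr1 invr1.
(* With this [t], [n * 4 t^2 - t * 8 q = 4 - 8], and [expR (- 4) <= 1 / 4]. *)
pose t : R := del / 8.
have t0 : 0 <= t by rewrite divr_ge0// ltW.
have tt (e : R) (i : 'I_n) : `|e| = 1 ->
    (\int[gaussian]_s (expR (e * t * (s ^+ 2 - s2)) * h i s)%:E <= (expR (4 * t ^+ 2))%:E)%E.
  move=> e1.
  have ts : `|e * t * s2| <= t.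
    rewrite (normrM (e * t)) (normrM e t) e1 mul1r (ger0_norm t0) (ger0_norm (ltW s20)) ler_piMr//.
    by rewrite /s2; lra.
  have ts4 : `|e * t * s2| <= 1 / 4 by apply: le_trans ts _; rewrite /t; lra.
  rewrite hint; last by apply: le_lt_trans (ler_norm _) _; apply: le_lt_trans ts4 _; lra.
  have := gaussian_square_mgf_le ts4.
  move/(lee_wpmul2l (x := (expR (- (e * t * s2)))%:E)) => hh.
  apply: (le_trans (hh _)); first by rewrite lee_fin expR_ge0.
  rewrite -EFinM lee_fin -expRD ler_expR addKr ler_wpM2l//.
  by rewrite -(@ger0_norm _ (_ ^+ 2)) ?sqr_ge0// normrX ler_pXn2r ?nnegrE//.
have := @chernoff R n predT h s2 t (4 * t ^+ 2) (8 * q) mh h0 h1.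
move=> /(_ t0) /(_ (mulr_ge0 (ler0n _ 4) (sqr_ge0 _))).
move=> ch; have {ch} : ((1 / 2)%:E <= \int[gaussian_rV n]_x
     (\1_(energy_window predT s2 (8 * q)) x * \prod_(i < n) h i (x ord0 i))%:E)%E.
  apply: ch.
  - by move=> i _; have := tt 1 i (normr1 _); rewrite mul1r.
  - by move=> i _; have := tt (-1) i (normrN1 _); rewrite mulN1r.
  - have -> : n%:R * (4 * t ^+ 2) - t * (8 * q) = - 4.
      rewrite -q2 /t [LHS](_ : _ = (q * del) ^+ 2 / 16 - q * del); last by field.
      by rewrite qdel; lra.
    rewrite expRN mul1r lef_pV2 ?posrE ?expR_gt0//.
    by apply: le_trans (expR_ge1Dx _); lra.
set E := energy_window _ _ _ => hE.
have mE : measurable E := measurable_energy_window predT s2 (8 * q).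
have : ((1 / 2)%:E <= (r^-1 ^+ n)%:E * gaussian_rV n E)%E.
  apply: le_trans hE _.
  have -> : (gaussian_rV n E = \int[gaussian_rV n]_x (\1_E x)%:E)%E by rewrite integral_indic// setIT.
  rewrite -ge0_integralZl//; last 2 first.
  - by apply/measurable_EFinP; exact: measurable_indic.
  - by rewrite lee_fin exprn_ge0// invr_ge0 ltW.
  apply: ge0_le_integral => //.
  - by move=> x _; rewrite lee_fin mulr_ge0// prodr_ge0.
  - apply/measurable_EFinP; apply: measurable_funM; first exact: measurable_indic.
    exact: measurable_prod_coordT.
  - by apply: emeasurable_funM => //; apply/measurable_EFinP; exact: measurable_indic.
  move=> x _; rewrite -EFinM lee_fin mulrC ler_wpM2r//.
  rewrite -[in leRHS](card_ord n) -prodr_const; apply: ler_prod => i _.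
  rewrite h0/= ler_piMr ?invr_ge0 ?(ltW r0)//.
  by rewrite -expR0 ler_expR mulNr oppr_le0 mulr_ge0 ?sqr_ge0.
move=> {}hE.
(* Returning to the standard Gaussian costs at most [r^-1] per coordinate, and
   [r ^+ 2 = 1 - del >= expR (- 2 del)] with [n * del = 8 q]. *)
have rn : expR (- (8 * q)) <= r ^+ n.
  have -> : - (8 * q) = n%:R * - del by rewrite -q2 mulrN -(mulrC del) expr2 mulrA (mulrC del) qdel.
  rewrite expRM_natl ler_pXn2r ?nnegrE ?expR_ge0 ?(ltW r0)//.
  rewrite -(@ler_pXn2r _ 2)// ?nnegrE ?expR_ge0 ?(ltW r0)// r2 -expRM_natl.
  have d4 : `|del / 2| <= 1 / 4 by rewrite ger0_norm ?divr_ge0 ?(ltW del0)//; lra.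
  have -> : s2 = 1 - 2 * (del / 2) by rewrite /s2; field.
  apply: le_trans (le_expR_neg_quadratic d4); rewrite ler_expR.
    by clear -del0 del2; nra.
  by rewrite (leq_trans _ n256).
have EE (x : 'rV[R]_n) : \sum_(i in predT) (x ord0 i ^+ 2 - s2) = dot x x - n%:R + 8 * q.
  rewrite big_mkcond/= sumrB sumr_const card_ord -(mulr_natl s2 n) /s2 /dot.
  under eq_bigr do rewrite expr2.
  have nd : n%:R * del = 8 * q by rewrite -q2 expr2 -mulrA qdel mulrC.
  rewrite [n%:R * _](_ : _ = n%:R - 8 * q); last by rewrite mulrBr nd mulr1.
  by ring.
apply: (@le_trans _ _ (gaussian_rV n E)); last first.
  apply: le_measure; rewrite ?inE//.
    rewrite -[X in measurable X]setTI.
    have -> : [set x : 'rV[R]_n | n%:R - 16 * Num.sqrt n%:R <= dot x x <= n%:R] =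
       (fun x : borel_rV R n => dot x x) @^-1` `[n%:R - 16 * Num.sqrt n%:R, n%:R].
      by apply/seteqP; split=> x /=; rewrite in_itv.
    by apply: measurable_dot => //; exact: measurable_itv.
  move=> x; rewrite /E /energy_window/= EE ler_norml -/q.
  by move: (dot x x) => d /andP[h1' h2']; apply/andP; split; lra.
have gE0 : (0 <= gaussian_rV n E)%E by exact: measure_ge0.
move: gE0 hE; case: (gaussian_rV n E) => [y| |].
- rewrite -EFinM !lee_fin => y0 hE.
  have rn0 : 0 < r ^+ n by rewrite exprn_gt0.
  have : r ^+ n * (1 / 2) <= y.
    by move: hE; rewrite exprVn -(ler_pM2l rn0) mulVKf// gt_eqF.
  by clear -rn; lra.
- by move=> _ _; rewrite leey.
- by move=> neg; exfalso; move: neg; rewrite leeNy_eq => /eqP.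
Qed.

End gaussian_shell.

(** * Separating the coordinates on and off the support *)

Section coordinate_factorization.
Context {R : realType} {n : nat}.
Variable w : 'rV[R]_n.

Lemma measurable_restrict_suppC :
  measurable_fun [set: borel_rV R n] (restrict_suppC w : borel_rV R n -> borel_rV R n).
Proof.
apply: measurable_rV => i; under eq_fun do rewrite mxE.
by case: (w ord0 i == 0); [exact: measurable_coord|exact: measurable_cst].
Qed.

Variables (p : 'I_n -> R -> R) (c : 'I_n -> R).
Hypotheses (mp : forall i, measurable_fun setT (p i)) (p0 : forall i s, 0 <= p i s).
Hypothesis pc : forall i, (\int[gaussian]_s (p i s)%:E = (c i)%:E)%E.

Lemma integral_factor (E : set (borel_rV R n)) : measurable E ->
  (\int[gaussian_rV n]_x (\1_E (restrict_suppC w x) * \prod_(i < n) p i (x ord0 i))%:E =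
   (\prod_(i | w ord0 i != 0) c i)%:E *
   \int[gaussian_rV n]_x (\1_E (restrict_suppC w x) *
      \prod_(i < n) (if w ord0 i == 0 then p i (x ord0 i) else 1))%:E)%E.
Proof.
move=> mE.
pose H (x : borel_rV R n) : R := \prod_(i < n) p i (x ord0 i).
pose p' i s : R := if w ord0 i == 0 then p i s else 1.
pose H' (x : borel_rV R n) : R := \prod_(i < n) p' i (x ord0 i).
pose C : R := \prod_(i | w ord0 i != 0) c i.
have mp' i : measurable_fun setT (p' i).
  by rewrite /p'; case: (w ord0 i == 0).
have p'0 i s : 0 <= p' i s by rewrite /p'; case: ifP.
have mH : measurable_fun setT H by exact: measurable_prod_coordT.
have mH' : measurable_fun setT H' by exact: measurable_prod_coordT.
have H0 x : 0 <= H x by exact: prodr_ge0.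
have H'0 x : 0 <= H' x by apply: prodr_ge0 => i _; exact: p'0.
have c0 i : 0 <= c i by rewrite -lee_fin -pc integral_ge0// => s _; rewrite lee_fin.
have C0 : 0 <= C by exact: prodr_ge0.
pose rho : borel_rV R n -> borel_rV R n := restrict_suppC w.
pose m1' : {measure set (borel_rV R n) -> \bar R} :=
  pushforward (density_measure (gaussian_rV n) mH H0) rho.
pose m2' : {measure set (borel_rV R n) -> \bar R} :=
  mscale (NngNum C0) (pushforward (density_measure (gaussian_rV n) mH' H'0) rho).
pose m1 := m1' measurable_restrict_suppC; pose m2 := m2' measurable_restrict_suppC.
have memrho (A : set (borel_rV R n)) x : (x \in rho @^-1` A) = (restrict_suppC w x \in A).
  by apply/idP/idP; rewrite !inE.
have m1E (A : set (borel_rV R n)) : measurable A -> m1 A = (\int[gaussian_rV n]_x (\1_A (restrict_suppC w x) * H x)%:E)%E.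
  move=> mA; rewrite [LHS]integral_mkcond; apply: eq_integral => x _.
  by rewrite patchE indicE memrho; case: ifP; rewrite ?mul1r ?mul0r.
have m2E (A : set (borel_rV R n)) : measurable A -> m2 A = (C%:E * \int[gaussian_rV n]_x (\1_A (restrict_suppC w x) * H' x)%:E)%E.
  move=> mA; congr (_ * _)%E; rewrite [LHS]integral_mkcond; apply: eq_integral => x _.
  by rewrite patchE indicE memrho; case: ifP; rewrite ?mul1r ?mul0r.
rewrite -[LHS]m1E// -[RHS]m2E//; apply: measure_eq_box => //.
  rewrite m1E//; apply: (@le_lt_trans _ _ (\int[gaussian_rV n]_x (H x)%:E)%E).
    rewrite le_eqVlt; apply/orP; left; apply/eqP; apply: eq_integral => x _.
    by rewrite indicT mul1r.
  rewrite integral_gaussian_rV//; under eq_bigr do rewrite pc.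
  by rewrite prodEFin ltry.
move=> A mA; rewrite m1E ?m2E; try exact: measurable_product_box.
(* [restrict_suppC] puts 0 in the coordinates of the support, so there the box condition is a
   constant. *)
pose B i (s : R) : R := if w ord0 i == 0 then \1_(A i) s else \1_(A i) 0.
have mB i : measurable_fun setT (B i).
  by rewrite /B; case: (w ord0 i == 0) => //; exact: measurable_indic.
have B0 i s : 0 <= B i s by rewrite /B; case: ifP.
have BE (x : borel_rV R n) : \1_(product_box A) (restrict_suppC w x) = \prod_(i < n) B i (x ord0 i).
  have BA i : B i (x ord0 i) = \1_(A i) (restrict_suppC w x ord0 i).
    by rewrite /B mxE; case: ifP.
  rewrite indicE; have [|] := boolP (restrict_suppC w x \in product_box A).
    rewrite inE => xA; rewrite big1// => i _; rewrite BA indicE mem_set//; exact: xA.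
  rewrite notin_setE => /existsNP[i xAi]; rewrite (bigD1 i)//= BA indicE memNset//.
  by rewrite mul0r.
transitivity (\int[gaussian_rV n]_x (\prod_(i < n) (B i (x ord0 i) * p i (x ord0 i)))%:E)%E.
  by apply: eq_integral => x _; rewrite big_split/= BE.
rewrite (integral_gaussian_rV (h := fun i s => B i s * p i s)); last 2 first.
- by move=> i; exact: measurable_funM.
- by move=> i s; rewrite mulr_ge0.
rewrite [X in (_ * X)%E](_ : _ =
   \int[gaussian_rV n]_x (\prod_(i < n) (B i (x ord0 i) * p' i (x ord0 i)))%:E)%E; last first.
  by apply: eq_integral => x _; rewrite big_split/= BE.
rewrite (integral_gaussian_rV (h := fun i s => B i s * p' i s)); last 2 first.
- by move=> i; exact: measurable_funM.
- by move=> i s; rewrite mulr_ge0.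
rewrite (_ : C%:E = \prod_(i < n) (if w ord0 i == 0 then 1 else c i)%:E)%E; last first.
  by rewrite prodEFin /C big_mkcond; congr EFin; apply: eq_bigr => i _; rewrite if_neg.
rewrite -big_split; apply: eq_bigr => i _ /=; rewrite /B /p'; case: ifP => _.
  by rewrite mul1e.
under [X in (_ * X)%E]eq_integral do rewrite mulr1.
under [LHS]eq_integral do rewrite EFinM.
rewrite ge0_integralZl// ?lee_fin//; first last.
- by move=> s _; rewrite lee_fin.
- by apply/measurable_EFinP; exact: mp.
rewrite [X in (_ = _ * X)%E](_ : _ = (\1_(A i) 0)%:E).
  by rewrite pc muleC.
by rewrite integral_cst// [X in (_ * X)%E]probability_setT mule1.
Qed.
End coordinate_factorization.

(** * Upper bound *)

Ltac ge0 := repeat first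
  [done | apply: sqr_ge0 | apply: exprn_ge0 | apply: expR_ge0 | apply: ltW; done
  | apply: mulr_ge0 | apply: addr_ge0 | rewrite invr_ge0].

Section energy_of_laplace.
Context {R : realType}.

Lemma sum_upper n (F : 'I_n -> 'I_n -> R) : (forall i j, F i j = F j i) ->
  \sum_(i < n) \sum_(j < n | (i <= j)%N) (if i == j then F i j else 2 * F i j) =
  \sum_(i < n) \sum_(j < n) F i j.
Proof.
move=> Fsym.
have split1 (i : 'I_n) (G : 'I_n -> R) : \sum_(j < n) G j =
    \sum_(j < n | (i <= j)%N) G j + \sum_(j < n | (j < i)%N) G j.
  rewrite (bigID (fun j : 'I_n => (i <= j)%N)); congr (_ + _).
  by apply: eq_bigl => j; rewrite -ltnNge.
have split2 (i : 'I_n) (G : 'I_n -> R) : \sum_(j < n | (i <= j)%N) G j =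
    G i + \sum_(j < n | (i < j)%N) G j.
  rewrite (bigD1 i)//=; congr (_ + _); apply: eq_bigl => j.
  by rewrite ltn_neqAle eq_sym andbC.
rewrite [RHS](eq_bigr _ (fun i _ => split1 i (F i))) big_split/=.
rewrite [X in _ = _ + X](exchange_big_dep predT)//=.
rewrite [LHS](eq_bigr _ (fun i _ => split2 i _)).
rewrite [X in _ = X + _](eq_bigr _ (fun i _ => split2 i _)).
under [LHS]eq_bigr do rewrite eqxx.
rewrite -big_split/=; apply: eq_bigr => i _; rewrite -addrA; congr (_ + _).
rewrite -big_split/=; apply: eq_bigr => j ij.
by rewrite ifN ?(Fsym j i) ?mulr2n ?mulrDl ?mul1r// neq_ltn ij.
Qed.

Variable mu : probability (measurableTypeR R) R.
Hypothesis mu_sub_gaussian : sub_gaussian mu.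
Hypotheses (mu_mean : ('E_mu[id] = 0)%E) (mu_var : ('V_mu[id] = 1)%E).

(* Diagonal and off-diagonal pairs of coordinates contribute [Lam (sqrt 2 t)]
   and, counted twice, [Lam (2 t) / 2]: both are [t^2 + O(t^3)]. *)
Definition pair_energy (b : bool) (t : R) : R :=
  if b then Lam mu (Num.sqrt 2 * t) else Lam mu (2 * t) / 2.

Lemma sqrt2_bounds : 0 < (Num.sqrt 2 : R) <= 2.
Proof.
rewrite sqrtr_gt0 ltr0n/= -(@ler_pXn2r _ 2)// ?nnegrE ?sqrtr_ge0//.
by rewrite sqr_sqrtr// expr2 ler_peMr// ler1n.
Qed.

Lemma pair_energy_bounds : exists C : R, [/\ 0 <= C,
  forall b, pair_energy b 0 = 0,
  forall b s t, `|pair_energy b s - pair_energy b t| <= C * (`|s| + `|t|) * `|s - t| &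
  forall b t, `|pair_energy b t - t ^+ 2| <= C * `|t| ^+ 3].
Proof.
have [C1 [C10 h1]] := Lam_lipschitz mu_sub_gaussian mu_mean.
have [C2 [C20 h2]] := Lam_taylor mu_sub_gaussian mu_mean mu_var.
have Lam00 : Lam mu 0 = 0 := Lam0 mu.
have /andP[q0 q2] := sqrt2_bounds.
have qq : Num.sqrt 2 ^+ 2 = 2 :> R by rewrite sqr_sqrtr.
exists (4 * C1 + 8 * C2); split.
- by rewrite addr_ge0 ?mulr_ge0.
- by case; rewrite /pair_energy mulr0 Lam00 ?mul0r.
- move=> b s t; apply: (@le_trans _ _ (4 * C1 * (`|s| + `|t|) * `|s - t|)); last first.
    by rewrite ler_wpM2r// ler_wpM2r ?addr_ge0// lerDl mulr_ge0.
  have X0 : 0 <= C1 * ((`|s| + `|t|) * `|s - t|) by rewrite !mulr_ge0 ?addr_ge0.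
  case: b; rewrite /pair_energy.
    apply: le_trans (h1 _ _) _; rewrite -mulrBr !normrM (gtr0_norm q0) -mulrDr.
    rewrite [leLHS](_ : _ = Num.sqrt 2 ^+ 2 * (C1 * ((`|s| + `|t|) * `|s - t|))); last by ring.
    by rewrite qq; move: X0; clear; lra.
  rewrite -mulrBl normrM (@ger0_norm _ 2^-1)//.
  apply: (@le_trans _ _ (C1 * (`|2 * s| + `|2 * t|) * `|2 * s - 2 * t| / 2)).
    by rewrite ler_wpM2r.
  rewrite -mulrBr !normrM (@ger0_norm _ 2)//.
  by move: X0; clear; lra.
- move=> b t; have T0 : 0 <= C2 * `|t| ^+ 3 by rewrite mulr_ge0 ?exprn_ge0.
  have T1 : 0 <= C1 * `|t| ^+ 3 by rewrite mulr_ge0 ?exprn_ge0.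
  case: b; rewrite /pair_energy.
    have := h2 (Num.sqrt 2 * t); rewrite exprMn qq mulrAC mulfV// mul1r => /le_trans; apply.
    rewrite normrM exprMn (gtr0_norm q0).
    have q3 : Num.sqrt 2 ^+ 3 <= 4 :> R by rewrite exprS qq; lra.
    rewrite mulrCA (le_trans (ler_wpM2r T0 q3))//.
    by move: T0 T1; clear; lra.
  have := h2 (2 * t); rewrite !exprMn => h.
  have -> : Lam mu (2 * t) / 2 - t ^+ 2 = (Lam mu (2 * t) - 2 ^+ 2 * t ^+ 2 / 2) / 2 by field.
  rewrite normrM (@ger0_norm _ 2^-1)//.
  rewrite ler_pdivrMr//; apply: le_trans h _; rewrite normrM exprMn (@ger0_norm _ 2)//.
  by move: T0 T1; clear; lra.
Qed.

Lemma powR_half_indicator (b : bool) :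
  2 `^ (2^-1 * (1 + (~~ b)%:R)) = if b then Num.sqrt 2 else 2 :> R.
Proof.
case: b => /=; first by rewrite addr0 mulr1 powR12_sqrt.
by rewrite (_ : 1 + 1 = 2)// mulVf// powRr1.
Qed.

Lemma pair_sum_energy n (theta a : R) (u : 'rV[R]_n) :
  \sum_(i < n) \sum_(j < n | (i <= j)%N)
    Lam mu (2 `^ (2^-1 * (1 + (i != j)%:R)) * theta * a * u ord0 i * u ord0 j) =
  energy pair_energy (theta * a) u.
Proof.
rewrite /energy -sum_upper; last by move=> i j; rewrite eq_sym (mulrC (u _ i)).
apply: eq_bigr => i _; apply: eq_bigr => j _; rewrite powR_half_indicator /pair_energy.
case: eqP => _.
  by congr (Lam mu _); ring.
by rewrite mulrCA mulfV// mulr1; congr (Lam mu _); ring.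
Qed.

Lemma f_N_energy n (theta : R) (w : 'rV[R]_n) :
  f_N mu theta w = (n%:R^-1 * energy pair_energy (theta * Num.sqrt n%:R) w)%:E.
Proof.
rewrite /f_N -pair_sum_energy EFinM; congr (_ * _)%E.
rewrite -sumEFin; apply: eq_bigr => i _; rewrite -sumEFin; apply: eq_bigr => j _.
exact: log_laplaceE.
Qed.

Definition column_energy n (v : 'rV[R]_n) (s : R) : R := \sum_i Lam mu (2 * v ord0 i * s).

Lemma column_energyE n (v : 'rV[R]_n) s :
  (\sum_i log_laplace mu (2 * v ord0 i * s))%E = (column_energy v s)%:E.
Proof. by rewrite -sumEFin; apply: eq_bigr => i _; exact: log_laplaceE. Qed.

Lemma measurable_column_energy n (v : 'rV[R]_n) : measurable_fun setT (column_energy v).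
Proof.
apply: measurable_sum => i; apply: (measurableT_comp (measurable_Lam mu_sub_gaussian mu_mean)).
exact: measurable_funM.
Qed.

(** The quadratic bounds add up to [norm2 w ^+ 2 <= 1], so the constant does not depend on the
    dimension or on the sparsity. *)
Lemma column_energy_bounds (T : R) : exists C : R, 0 <= C /\
  forall n (w : 'rV[R]_n) theta s, norm2 w <= 1 -> 0 <= theta <= T ->
  0 <= column_energy (theta *: w) s <= C * s ^+ 2.
Proof.
have [C [C0 h]] := Lam_le mu_sub_gaussian mu_mean.
exists (4 * C * T ^+ 2); split; first by apply: mulr_ge0; [exact: mulr_ge0|exact: sqr_ge0].
move=> n w theta s w1 /andP[t0 tT]; rewrite sumr_ge0/= => [|i _]; last exact: Lam_ge0.
apply: (@le_trans _ _ (\sum_i 4 * C * theta ^+ 2 * s ^+ 2 * (w ord0 i * w ord0 i))).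
  apply: ler_sum => i _; apply: le_trans (h _) _; rewrite mxE.
  by rewrite le_eqVlt; apply/orP; left; apply/eqP; ring.
rewrite -mulr_sumr -/(dot w w) -norm2_sqr.
have w2 : norm2 w ^+ 2 <= 1 by rewrite expr_le1// norm2_ge0.
have C4 : 0 <= 4 * C * theta ^+ 2 * s ^+ 2 by ge0.
apply: (le_trans (ler_wpM2l C4 w2)); rewrite mulr1 ler_wpM2r ?sqr_ge0//.
by rewrite ler_wpM2l ?mulr_ge0// ler_pXn2r// nnegrE// (le_trans t0).
Qed.

(** [energy_normalize] at [z = x / sqrt n]. For small coordinates the argument of the pair energy is
    [theta x_i x_j / sqrt n], at most [4 T K^2 / sqrt n], which is the value used for [B]. *)
Lemma energy_sphere_proj (T : R) : 1 <= T -> exists C : R, 0 <= C /\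
  forall n (w x : 'rV[R]_n) theta K, (0 < n)%N -> norm2 w <= 1 -> 0 <= theta <= T ->
  0 < dot x x -> norm2 x <= 2 * Num.sqrt n%:R -> 0 <= K ->
  (forall j, w ord0 j = 0 -> `|x ord0 j| <= 2 * K) ->
  `|energy pair_energy (theta * Num.sqrt n%:R) (sphere_proj x) - energy pair_energy (theta * Num.sqrt n%:R) w
    - \sum_(j | w ord0 j == 0) column_energy (theta *: w) (x ord0 j)
    - n%:R * (theta ^+ 2 * (1 - norm2 w ^+ 2) ^+ 2)|
  <= C * n%:R * (`|norm2 ((Num.sqrt n%:R)^-1 *: x) - 1| + norm2 (restrict_supp w ((Num.sqrt n%:R)^-1 *: x) - w) + K ^+ 2 / Num.sqrt n%:R).
Proof.
move=> T1; have [C [C0 hC1 hC2 hC3]] := pair_energy_bounds.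
exists ((108 * C + 15) * T ^+ 2 + 64 * C * T ^+ 3); split.
  by rewrite addr_ge0// !mulr_ge0// ?addr_ge0 ?mulr_ge0 ?exprn_ge0 ?(le_trans _ T1).
move=> n w x theta K n0 w1 /andP[t0 tT] x0 x2 K0 xK.
set a := theta * _; set z := _^-1 *: x.
pose q : R := Num.sqrt n%:R.
have q0 : 0 < q by rewrite sqrtr_gt0 ltr0n.
have q2 : q ^+ 2 = n%:R by rewrite sqr_sqrtr.
have nz : norm2 z = q^-1 * norm2 x by rewrite norm2Z gtr0_norm// invr_gt0.
have nx0 : 0 < norm2 x by rewrite norm2E sqrtr_gt0.
have z0 : 0 < norm2 z by rewrite nz mulr_gt0 ?invr_gt0.
have z2 : norm2 z <= 2 by rewrite nz mulrC ler_pdivrMr.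
have B0 : 0 <= 4 * T * (K ^+ 2 / q).
  by rewrite !mulr_ge0 ?sqr_ge0 ?invr_ge0 ?(ltW q0) ?(le_trans _ T1).
have zB i j : w ord0 i = 0 -> w ord0 j = 0 -> `|a * (z ord0 i * z ord0 j)| <= 4 * T * (K ^+ 2 / q).
  move=> wi wj; rewrite !mxE -/q.
  have -> : a * (q^-1 * x ord0 i * (q^-1 * x ord0 j)) = theta / q * (x ord0 i * x ord0 j).
    by rewrite /a -/q; field; rewrite gt_eqF.
  rewrite !normrM (ger0_norm t0) (ger0_norm (_ : 0 <= q^-1)) ?invr_ge0 ?(ltW q0)//.
  rewrite [leRHS](_ : _ = T / q * (2 * K * (2 * K))); last by ring.
  apply: ler_pM => //; rewrite ?mulr_ge0 ?invr_ge0 ?(ltW q0)//.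
    by rewrite ler_wpM2r// invr_ge0 ltW.
  by apply: ler_pM => //; exact: xK.
have := energy_normalize C0 hC1 hC2 hC3 w1 z0 z2 B0 zB.
have -> : (norm2 z)^-1 *: z = sphere_proj x.
  rewrite /sphere_proj -norm2E /z -/q scalerA nz; congr (_ *: _).
  by field; rewrite gt_eqF ?gt_eqF.
have -> : \sum_(j | w ord0 j == 0) \sum_i 2 * pair_energy false (a * (w ord0 i * z ord0 j)) =
   \sum_(j | w ord0 j == 0) column_energy (theta *: w) (x ord0 j).
  apply: eq_bigr => j _; apply: eq_bigr => i _; rewrite /pair_energy mulrCA mulfV// mulr1.
  congr (Lam mu _); rewrite !mxE /a -/q; field; by rewrite gt_eqF.
have -> : a ^+ 2 = n%:R * theta ^+ 2 by rewrite /a exprMn -/q q2 mulrC.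
have -> : n%:R * theta ^+ 2 * (1 - norm2 w ^+ 2) ^+ 2 =
  n%:R * (theta ^+ 2 * (1 - norm2 w ^+ 2) ^+ 2) by rewrite mulrA.
move=> /le_trans; apply.
set e := _ + norm2 _; set f := K ^+ 2 / q.
have e0 : 0 <= e by rewrite addr_ge0 ?norm2_ge0.
have f0 : 0 <= f by rewrite divr_ge0 ?sqr_ge0 ?ltW.
have N0 : 0 <= n%:R :> R by [].
have th2 : theta ^+ 2 <= T ^+ 2 by rewrite ler_pXn2r// nnegrE// (le_trans t0).
have T0 : 0 <= T by exact: le_trans t0 tT.
pose p : R := 108 * C + 15; have p0 : 0 <= p by rewrite addr_ge0 ?mulr_ge0.
rewrite -/p [leLHS](_ : _ = (p * n%:R * e + 64 * C * T * n%:R * f) * theta ^+ 2); last by ring.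
apply: (@le_trans _ _ ((p * n%:R * e + 64 * C * T * n%:R * f) * T ^+ 2)).
  by rewrite ler_wpM2l//; ge0.
rewrite -subr_ge0 [leRHS](_ : _ = p * T ^+ 2 * n%:R * f + 64 * C * T ^+ 3 * n%:R * e); last by ring.
by ge0.
Qed.

End energy_of_laplace.

(** * Points of a shell projecting into the constraint set *)

Section shell_geometry.
Context {R : realType}.

Lemma norm_rV_le n (u : 'rV[R]_n) (c : R) : 0 <= c ->
  (`|u| <= c <-> forall i, `|u ord0 i| <= c).
Proof.
move=> c0; rewrite /Num.Def.normr/= mx_normrE; split=> [h i|h].
  by apply: le_trans h; exact: (le_bigmax _ (fun p => `|u p.1 p.2|) (ord0, i)).
by apply: bigmax_le => // -[i j] _ /=; rewrite (ord1 i); exact: h.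
Qed.

Lemma measurable_U_set n (w : 'rV[R]_n) (r K : R) : 0 <= K ->
  measurable (U_set w r K : set (borel_rV R n)).
Proof.
move=> K0; have c0 : 0 <= K / Num.sqrt n%:R by ge0; rewrite sqrtr_ge0.
have -> : U_set w r K = @sphere R n `&`
    ((fun u : borel_rV R n => norm2 (restrict_supp w u - w)) @^-1` `]-oo, r] `&`
     \bigcap_(i in [set: 'I_n])
       ((fun u : borel_rV R n => `|restrict_suppC w u ord0 i|) @^-1` `]-oo, K / Num.sqrt n%:R])).
  apply/seteqP; split=> u /=.
    move=> [u1 u2 u3]; split=> //; split; first by rewrite /= in_itv.
    by move=> i _; rewrite /= in_itv/=; move: i; exact/norm_rV_le.
  rewrite in_itv/= => -[u1 [u2 u3]]; split=> //.
  by apply/norm_rV_le => // i; have := u3 i I; rewrite /= in_itv.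
apply: measurableI; first exact: measurable_sphere.
apply: measurableI.
  rewrite -[X in measurable X]setTI.
  have mf : measurable_fun [set: borel_rV R n]
      (fun u : borel_rV R n => norm2 (restrict_supp w u - w)).
    under eq_fun do rewrite norm2E.
    apply: (measurableT_comp (continuous_measurable_fun (@sqrt_continuous R))).
    have mv : measurable_fun [set: borel_rV R n]
        (fun u : borel_rV R n => restrict_supp w u - w : borel_rV R n).
      apply: measurable_rV => i; under eq_fun do rewrite !mxE.
      case: (w ord0 i != 0); last exact: measurable_cst.
      by apply: measurable_funB => //; exact: measurable_coord.
    exact: measurable_dot.
  by apply: mf => //; exact: measurable_itv.
apply: fin_bigcap_measurable => // i _; rewrite -[X in measurable X]setTI.
have mf : measurable_fun [set: borel_rV R n]
    (fun u : borel_rV R n => `|restrict_suppC w u ord0 i|).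
  apply: measurableT_comp => //; under eq_fun do rewrite mxE.
  by case: (w ord0 i == 0); [exact: measurable_coord|exact: measurable_cst].
by apply: mf => //; exact: measurable_itv.
Qed.

Lemma restrict_suppZ n (w u : 'rV[R]_n) (c : R) :
  restrict_supp w (c *: u) = c *: restrict_supp w u.
Proof. by apply/rowP => i; rewrite !mxE; case: ifP => // _; rewrite mulr0. Qed.

Lemma dot_restrict_supp n (w u : 'rV[R]_n) : dot w (restrict_supp w u) = dot w u.
Proof.
by apply: eq_bigr => i _; rewrite mxE; case: eqP => //= ->; rewrite !mul0r.
Qed.

Lemma dot_restrict_suppC n (w x : 'rV[R]_n) :
  dot (restrict_suppC w x) (restrict_suppC w x) = \sum_(j | w ord0 j == 0) x ord0 j ^+ 2.
Proof.
rewrite /dot [RHS]big_mkcond; apply: eq_bigr => i _; rewrite !mxE.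
by case: ifP => _; rewrite ?mulr0// expr2.
Qed.

(** With [y = norm2 x / q] and [u] the projection, [x = q * y * u] and [1 - 16 / q <= y ^+ 2 <= 1],
    so [x / q] is [u] up to [16 / q]. Having [y <= 1] carries the bound [K] over to [x] without
    loss, and [32 <= q] keeps the shell away from 0. *)
Lemma shell_geometry n (w x : 'rV[R]_n) (r K : R) : (1024 <= n)%N -> norm2 w <= 1 -> 0 <= r -> 0 <= K ->
  n%:R - 16 * Num.sqrt n%:R <= dot x x <= n%:R -> U_set w r K (sphere_proj x) ->
  let q := Num.sqrt n%:R in
  [/\ 0 < dot x x, `|norm2 (q^-1 *: x) - 1| <= 16 / q,
      norm2 (restrict_supp w (q^-1 *: x) - w) <= r + 16 / q,
      forall j, w ord0 j = 0 -> `|x ord0 j| <= K &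
      n%:R * norm2 w ^+ 2 - n%:R * (r + 16 / q) <= q * dot w x /\
      `|\sum_(j | w ord0 j == 0) x ord0 j ^+ 2 - n%:R * (1 - norm2 w ^+ 2)| <=
        n%:R * (2 * r + 48 / q)].
Proof.
move=> n1024 w1 r0 K0 /andP[x1 x2] [us ur uK] q.
have q32 : 32 <= q.
  by rewrite -[32](@ger0_norm R)// -sqrtr_sqr -natrX ler_wsqrtr// ler_nat.
have q2 : q ^+ 2 = n%:R by rewrite sqr_sqrtr.
have q0 : 0 < q by lra.
have x0 : 0 < dot x x by apply: lt_le_trans x1; rewrite -/q -q2 expr2; nra.
have nx0 : 0 < norm2 x by rewrite norm2E sqrtr_gt0.
have nx2 : norm2 x ^+ 2 = dot x x by exact: norm2_sqr.
pose y : R := norm2 x / q.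
have y0 : 0 < y by rewrite divr_gt0.
have y2 : n%:R * y ^+ 2 = dot x x by rewrite /y exprMn nx2 exprVn q2; field; rewrite -q2 expf_neq0// gt_eqF.
have yq : y ^+ 2 <= 1.
  by rewrite -(ler_pM2l (_ : 0 < q ^+ 2)) ?exprn_gt0// {1}q2 y2 mulr1 q2.
have yl : 1 - 16 / q <= y ^+ 2.
  rewrite -(ler_pM2l (_ : 0 < q ^+ 2)) ?exprn_gt0// {2}q2 y2.
  have -> : q ^+ 2 * (1 - 16 / q) = q ^+ 2 - 16 * q by field; rewrite gt_eqF.
  by rewrite q2.
have y1 : y <= 1 by clear -yq y0; nra.
have nz : norm2 (q^-1 *: x) = y by rewrite norm2Z gtr0_norm ?invr_gt0// mulrC.
have hy : `|y - 1| <= 16 / q.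
  rewrite ler_norml; apply/andP; split; last first.
    by apply: (@le_trans _ _ 0); [lra|rewrite divr_ge0// ltW].
  by clear -yl y1 y0; nra.
pose u := sphere_proj x.
have xu : q^-1 *: x = y *: u.
  by rewrite /u /sphere_proj -norm2E scalerA; congr (_ *: _); rewrite /y; field; rewrite !gt_eqF.
have hS : norm2 (restrict_supp w (q^-1 *: x) - w) <= r + 16 / q.
  rewrite xu restrict_suppZ.
  have -> : y *: restrict_supp w u - w = y *: (restrict_supp w u - w) + (y - 1) *: w.
    by rewrite scalerBr scalerBl scale1r addrA subrK.
  apply: le_trans (norm2D _ _) _; rewrite !norm2Z (gtr0_norm y0); apply: lerD.
    by apply: le_trans ur; rewrite ler_piMl// norm2_ge0.
  by apply: le_trans hy; rewrite ler_piMr.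
have e0 : 0 <= r + 16 / q by exact: le_trans (norm2_ge0 _) hS.
have w0 := norm2_ge0 w.
split=> //.
- by rewrite nz.
- move=> j wj.
  have := (norm_rV_le (restrict_suppC w u) (_ : 0 <= K / q)).1; rewrite divr_ge0 ?(ltW q0)//.
  move=> /(_ isT uK j); rewrite mxE wj eqxx => uj.
  have -> : x ord0 j = q * y * u ord0 j.
    have yu : y * u ord0 j = q^-1 * x ord0 j by have := congr1 (fun v : 'rV[R]_n => v ord0 j) xu; rewrite !mxE.
    by rewrite -mulrA yu mulVKf// gt_eqF.
  rewrite normrM (normrM q y) (gtr0_norm q0) (gtr0_norm y0).
  rewrite [leRHS](_ : _ = q * 1 * (K / q)); last by field; rewrite gt_eqF.
  have qy0 : 0 <= q * y by exact: mulr_ge0 (ltW q0) (ltW y0).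
  by apply: ler_pM => //; apply: ler_wpM2l => //; exact: ltW.
split.
  have -> : q * dot w x = n%:R * dot w (restrict_supp w (q^-1 *: x)).
    by rewrite dot_restrict_supp dotZr -q2; field; rewrite gt_eqF.
  rewrite -mulrBr ler_wpM2l//.
  have -> : dot w (restrict_supp w (q^-1 *: x)) =
      norm2 w ^+ 2 + dot w (restrict_supp w (q^-1 *: x) - w).
    by rewrite dotDr dotNr norm2_sqr addrC subrK.
  have : `|dot w (restrict_supp w (q^-1 *: x) - w)| <= r + 16 / q.
    apply: le_trans (dot_le _ _) _; apply: le_trans (ler_wpM2l w0 hS) _.
    by rewrite ler_piMl.
  by rewrite ler_norml => /andP[h _]; rewrite lerD2l.
set zS := restrict_supp w (q^-1 *: x) in hS *.
have zS1 : norm2 zS <= 1 by apply: le_trans (norm2_restrict_supp _ _) _; rewrite nz.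
have -> : \sum_(j | w ord0 j == 0) x ord0 j ^+ 2 = n%:R * (y ^+ 2 - norm2 zS ^+ 2).
  rewrite mulrBr y2 (dot_restrict_suppD w x) -dot_restrict_suppC /zS restrict_suppZ norm2_sqr.
  by rewrite dotZl dotZr -q2 mulrA mulrA; field; rewrite gt_eqF.
rewrite -mulrBr normrM (ger0_norm (ler0n _ n)) ler_wpM2l//.
have := norm2B_ge zS w; move: (norm2_ge0 zS) zS1 w0 w1 hS yl yq.
have -> : 48 / q = 3 * (16 / q) by field; rewrite gt_eqF.
move: (norm2 zS) (norm2 w) (norm2 (zS - w)) (16 / q) (y ^+ 2) => s v e d z.
clear => s0 s1 v0 v1 he zl zu hd.
have -> : z - s ^+ 2 - (1 - v ^+ 2) = (z - 1) - (s - v) * (s + v) by ring.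
apply: le_trans (ler_normB _ _) _; rewrite normrM.
have h1 : `|z - 1| <= d by rewrite ler_norml; apply/andP; split; lra.
have h2 : `|s - v| * `|s + v| <= (r + d) * 2.
  by apply: ler_pM => //; [exact: le_trans he|rewrite ger0_norm; lra].
lra.
Qed.

End shell_geometry.

Section sphere_integral_upper.
Context {R : realType}.

Lemma integral_gaussian_expR (y : R) :
  (\int[gaussian]_s (expR (y * s))%:E = (expR (y ^+ 2 / 2))%:E)%E.
Proof.
have mexp : measurable_fun setT (fun s : measurableTypeR R => (expR (s * y - y ^+ 2 / 2))%:E).
  apply/measurable_EFinP; apply: measurableT_comp => //.
  by apply: measurable_funB => //; exact: measurable_funM.
transitivity (\int[gaussian]_(s in [set: measurableTypeR R])
    ((expR (y ^+ 2 / 2))%:E * (expR (s * y - y ^+ 2 / 2))%:E))%E.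
  by apply: eq_integral => s _; rewrite -EFinM -expRD; congr (expR _)%:E; ring.
rewrite ge0_integralZl//.
have := gaussian_shift y (@measurableT _ (measurableTypeR R)).
rewrite preimage_setT => h; rewrite -{}h [X in (_ * X)%E](_ : _ = 1%E) ?mule1//.
exact: probability_setT.
Qed.

Lemma sum_if_supp n (w : 'rV[R]_n) (F G : 'I_n -> R) :
  \sum_i (if w ord0 i == 0 then F i else G i) =
  \sum_(i | w ord0 i == 0) F i + \sum_(i | w ord0 i != 0) G i.
Proof.
rewrite (bigID (fun i => w ord0 i == 0))/=; congr (_ + _); apply: eq_bigr => i.
  by move=> ->.
by move=> /negbTE ->.
Qed.

Lemma sum_supp_cst n (w : 'rV[R]_n) (c : R) : \sum_(i | w ord0 i != 0) c = c * (norm0 w)%:R.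
Proof. by rewrite sumr_const mulr_natr. Qed.

Variable mu : probability (measurableTypeR R) R.
Hypothesis mu_sub_gaussian : sub_gaussian mu.
Hypotheses (mu_mean : ('E_mu[id] = 0)%E) (mu_var : ('V_mu[id] = 1)%E).

Lemma exists_column_tilt (T rho : R) : 0 < rho <= 1 -> exists A : R, 0 <= A /\
  forall n (w : 'rV[R]_n) theta al K, norm2 w <= 1 -> 0 <= theta <= T ->
  rho <= al <= 2 -> 3 <= K ->
  exists lam Psi : R, let h s := \1_`[- K, K] s *
      expR (column_energy mu (theta *: w) s - lam * s ^+ 2 - Psi) in
  [/\ `|lam| <= A, `|Psi| <= A, (\int[gaussian]_s (h s)%:E = 1)%E &
      (\int[gaussian]_s (s ^+ 2 * h s)%:E = al%:E)%E].
Proof.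
move=> rho01; have [C [C0 hC]] := column_energy_bounds mu_sub_gaussian mu_mean T.
have [A [A0 hA]] := exists_tilt C0 rho01; exists A; split=> // n w theta al K w1 th al01 K3.
apply: hA => //; first exact: measurable_column_energy.
by move=> s; exact: hC.
Qed.

Lemma energy_measurable n (a : R) :
  measurable_fun [set: borel_rV R n] (fun u : borel_rV R n => energy (pair_energy mu) a u).
Proof.
have mL := measurable_Lam mu_sub_gaussian mu_mean.
apply: measurable_sum => i; apply: measurable_sum => j.
have mp : measurable_fun setT (pair_energy mu (i == j)).
  rewrite /pair_energy; case: (i == j).
    by apply: (measurableT_comp mL); exact: measurable_funM.
  by apply: measurable_funM => //; apply: (measurableT_comp mL); exact: measurable_funM.
apply: (measurableT_comp mp); apply: measurable_funM => //.
by apply: measurable_funM; exact: measurable_coord.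
Qed.

End sphere_integral_upper.

(** An exponential Markov bound: on the shell the integrand is at most a product of one-coordinate
    functions with explicit Gaussian integrals. The term [norm0 w] pays for completing the factors
    [expR Psi] to all [n] coordinates. *)
Lemma sphere_integral_upper {R : realType} (mu : probability (measurableTypeR R) R)
  (mu_sub_gaussian : sub_gaussian mu)
  (mu_mean : ('E_mu[id] = 0)%E) (mu_var : ('V_mu[id] = 1)%E) (T rho : R) : 1 <= T -> 0 < rho < 2^-1 -> exists C : R, 0 <= C /\
  forall n (P : probability (borel_rV R n) R) (w : 'rV[R]_n) theta K r,
  (1024 <= n)%N -> uniform_on_sphere P -> norm2 w <= 1 - rho -> 0 <= theta <= T ->
  3 <= K -> 0 <= r ->
  exists phi : R, Phi mu K (theta *: w) (1 - norm2 w ^+ 2) = phi%:E /\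
  (\int[P]_(u in U_set w r K) (expR (energy (pair_energy mu) (theta * Num.sqrt n%:R) u))%:E <=
   (expR (energy (pair_energy mu) (theta * Num.sqrt n%:R) w +
      n%:R * (theta ^+ 2 * (1 - norm2 w ^+ 2) ^+ 2) + n%:R * phi - n%:R * (2^-1 * norm2 w ^+ 2) +
      C * (n%:R * r + K ^+ 2 * Num.sqrt n%:R + (norm0 w)%:R)))%:E)%E.
Proof.
move=> T1 /andP[rho0 rho2].
have [C1 [C10 hC1]] := energy_sphere_proj mu_sub_gaussian mu_mean mu_var T1.
have rho01 : 0 < rho <= 1 by rewrite rho0/=; move: rho2; clear; lra.
have [A [A0 hA]] := exists_column_tilt mu_sub_gaussian mu_mean T rho01.
have [C0 [C00 hC0]] := column_energy_bounds mu_sub_gaussian mu_mean T.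
exists (33 * C1 + 50 * A + 30); split; first by ge0.
move=> n P w theta K r n1024 unifP wr th K3 r0.
have w0 := norm2_ge0 w.
have w1 : norm2 w <= 1 by move: wr rho0; clear; lra.
have K0 : 0 <= K by move: K3; clear; lra.
pose al : R := 1 - norm2 w ^+ 2.
have al12 : rho <= al <= 2.
  by rewrite /al; move: (norm2 w) w0 wr rho0 rho2; clear => v *; apply/andP; split; nra.
have [lam [Psi /= [lamA PsiA h1 h2]]] := hA n w theta al K w1 th al12 K3.
exists (lam * al + Psi); split.
  apply/eqP; rewrite eq_le; apply/andP; split.
    apply: (Phi_le (column_energyE mu_sub_gaussian mu_mean (theta *: w))) h1.
      exact: measurable_column_energy.
    by move=> s; exact: (hC0 n w theta s w1 th).
  apply: (Phi_ge (column_energyE mu_sub_gaussian mu_mean (theta *: w)) _ _ h1 h2).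
    exact: measurable_column_energy.
  by move=> s; exact: (hC0 n w theta s w1 th).
pose q : R := Num.sqrt n%:R.
have q32 : 32 <= q.
  by rewrite -[32](@ger0_norm R)// -sqrtr_sqr -natrX ler_wsqrtr// ler_nat.
have q2 : q ^+ 2 = n%:R by rewrite sqr_sqrtr.
have q0 : 0 < q by lra.
set En := energy (pair_energy mu) (theta * Num.sqrt n%:R).
set U := U_set w r K.
have mU : measurable (U : set (borel_rV R n)) by exact: measurable_U_set.
pose g (u : borel_rV R n) : R := \1_U u * expR (En u).
have mEn : measurable_fun [set: borel_rV R n] En by exact: energy_measurable.
have mg : measurable_fun [set: borel_rV R n] g.
  by apply: measurable_funM; [exact: measurable_indic|exact: measurableT_comp].
have g0 u : 0 <= g u by rewrite mulr_ge0 ?expR_ge0.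
pose I : set R := `[n%:R - 16 * q, n%:R]%classic.
pose S : set (borel_rV R n) := [set x | I (dot x x)].
have SE : S = [set x : 'rV[R]_n | (n%:R - 16 * q <= dot x x <= n%:R)%R].
  by apply/seteqP; split=> x; rewrite /S/= /I/= in_itv.
have mSset : measurable S.
  rewrite -[S]setTI; have md : measurable_fun [set: borel_rV R n] (fun x : borel_rV R n => dot x x).
    exact: measurable_dot.
  by apply: md => //; exact: measurable_itv.
have mS : ((expR (- (8 * q)) / 2)%:E <= gaussian_rV n S)%E.
  by rewrite SE; exact: gaussian_shell (leq_trans (isT : 256 <= 1024)%N n1024).
have I0 t : I t -> 0 < t.
  rewrite /I/= in_itv/= => /andP[t1 _]; apply: lt_le_trans t1; rewrite -q2; move: q32; clear.
  by move: q => q; nra.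
have S0 : (0 < gaussian_rV n S)%E.
  by apply: lt_le_trans mS; rewrite lte_fin divr_gt0 ?expR_gt0.
have polar := gaussian_polar unifP (measurable_itv _) I0 mg g0 S0.
have -> : (\int[P]_(u in U) (expR (En u))%:E = \int[P]_u (g u)%:E)%E.
  rewrite integral_mkcond; apply: eq_integral => u _; rewrite patchE /g indicE.
  by case: ifP => _; rewrite ?mul1r ?mul0r.
pose k : R := (norm0 w)%:R.
pose e1 : R := r + 16 / q.
pose err : R := C1 * n%:R * (16 / q + e1 + K ^+ 2 / q) + n%:R * e1 + A * (n%:R * (2 * r + 48 / q)).
(* The terms [- n * norm2 w ^+ 2] and [lam * (n * al)] compensate for the tilts in [hh], at the
   values that [q * dot w x] and the squared norm off the support take up to the error. *)
pose E0 : R := En w + n%:R * (theta ^+ 2 * al ^+ 2) - n%:R * norm2 w ^+ 2 +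
   lam * (n%:R * al) + err.
pose L s : R := column_energy mu (theta *: w) s.
(* On the support the tilt [expR (q * w_i * s)] integrates to [expR (n * w_i^2 / 2)]; together with
   the compensation [- n * norm2 w ^+ 2] this leaves the term [- norm2 w ^+ 2 / 2] of [varphi]. *)
pose hh (i : 'I_n) (s : R) : R :=
  if w ord0 i == 0 then \1_`[- K, K] s * expR (L s - lam * s ^+ 2) else expR (q * w ord0 i * s).
have mL : measurable_fun setT L by exact: measurable_column_energy.
have mhh i : measurable_fun setT (hh i).
  rewrite /hh; case: (w ord0 i == 0); last first.
    by apply: measurableT_comp => //; exact: measurable_funM.
  apply: measurable_funM; first exact: measurable_indic.
  apply: measurableT_comp => //; apply: measurable_funB => //.
  by apply: measurable_funM => //; exact: measurable_sqr.
have hh0 i s : 0 <= hh i s.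
  by rewrite /hh; case: ifP => _; rewrite ?mulr_ge0 ?expR_ge0.
have pointwise (x : borel_rV R n) : S x ->
    g (sphere_proj x) <= expR E0 * \prod_(i < n) hh i (x ord0 i).
  rewrite SE => Sx; rewrite /g indicE; have [xU|_] := boolP (_ \in U); last first.
    by rewrite mul0r mulr_ge0 ?expR_ge0// prodr_ge0.
  rewrite inE in xU; have [x0 d1 d2 xK [d3 d4]] := shell_geometry n1024 w1 r0 K0 Sx xU.
  have -> : \prod_(i < n) hh i (x ord0 i) =
     expR (\sum_(j | w ord0 j == 0) (L (x ord0 j) - lam * x ord0 j ^+ 2) + q * dot w x).
    have -> : q * dot w x = \sum_(i | w ord0 i != 0) q * w ord0 i * x ord0 i.
      rewrite mulr_sumr [RHS]big_mkcond; apply: eq_bigr => i _.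
      by case: eqP => [->|_]; rewrite ?mul0r ?mulr0//= mulrA.
    rewrite -sum_if_supp expR_sum; apply: eq_bigr => i _; rewrite /hh; case: eqP => [wi|//].
    by rewrite indicE mem_set ?mul1r//= in_itv/= -ler_norml; exact: xK.
  rewrite -expRD mul1r ler_expR.
  have nx : norm2 x <= 2 * q.
    rewrite norm2E; apply: (@le_trans _ _ q); last by move: q0; clear; lra.
    by rewrite ler_wsqrtr//; move: Sx => /= /andP[].
  have xK2 j : w ord0 j = 0 -> `|x ord0 j| <= 2 * K.
    by move=> wj; apply: le_trans (xK j wj) _; move: K0; clear; lra.
  have n0 : (0 < n)%N by exact: leq_trans n1024.
  have := hC1 n w x theta K n0 w1 th x0 nx K0 xK2.
  rewrite -/q -/al -/(En _) -/(En _) => h.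
  have hn : `|norm2 (q^-1 *: x) - 1| + norm2 (restrict_supp w (q^-1 *: x) - w) + K ^+ 2 / q <=
     16 / q + e1 + K ^+ 2 / q by rewrite lerD2r lerD.
  have Cn0 : 0 <= C1 * n%:R by exact: mulr_ge0.
  have {h hn} := le_trans h (ler_wpM2l Cn0 hn).
  rewrite sumrB -mulr_sumr; move: d3 d4; rewrite -/e1 -/al.
  have -> : \sum_(j | w ord0 j == 0) column_energy mu (theta *: w) (x ord0 j) =
    \sum_(j | w ord0 j == 0) L (x ord0 j) by [].
  set SL := \sum_(j | _) L _; set SX := \sum_(j | _) _ ^+ 2 => d3 d4.
  have h5 : - (A * (n%:R * (2 * r + 48 / q))) <= lam * (n%:R * al) - lam * SX.
    rewrite -mulrBr lerNl -mulrN opprB; apply: le_trans (ler_norm _) _; rewrite normrM.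
    by apply: ler_pM.
  rewrite ler_norml => /andP[_ h6].
  rewrite /E0 /err; move: d3 h5 h6; clear.
  move: (C1 * n%:R * _) (A * _) (n%:R * e1) (lam * SX) (lam * (n%:R * al))
    (n%:R * (theta ^+ 2 * _)) (n%:R * norm2 w ^+ 2) (q * dot w x) (En w) (En _) SL.
  clear; move=> *; lra.
have inthh i : (\int[gaussian]_s (hh i s)%:E =
    (expR (if w ord0 i == 0 then Psi else q ^+ 2 * w ord0 i ^+ 2 / 2))%:E)%E.
  rewrite /hh; case: (w ord0 i == 0); last by rewrite integral_gaussian_expR exprMn.
  transitivity (\int[gaussian]_s ((expR Psi)%:E *
      (\1_`[- K, K] s * expR (column_energy mu (theta *: w) s - lam * s ^+ 2 - Psi))%:E))%E.
    apply: eq_integral => s _; rewrite -EFinM; congr EFin; rewrite [RHS]mulrCA -expRD.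
    by congr (_ * expR _); rewrite [RHS]addrC subrK.
  rewrite ge0_integralZl//.
  - by rewrite h1 mule1.
  - apply/measurable_EFinP; apply: measurable_funM; first exact: measurable_indic.
    apply: measurableT_comp => //; apply: measurable_funB => //; apply: measurable_funB => //.
    by apply: measurable_funM => //; exact: measurable_sqr.
have bound : (\int[P]_u (g u)%:E * gaussian_rV n S <= (expR (E0 + (n%:R * Psi + k * A +
    n%:R * (norm2 w ^+ 2 / 2))))%:E)%E.
  rewrite polar; apply: (@le_trans _ _ (\int[gaussian_rV n]_x
      ((expR E0)%:E * (\prod_(i < n) hh i (x ord0 i))%:E))%E).
    have mG : measurable_fun [set: borel_rV R n]
        (fun x : borel_rV R n => ((expR E0)%:E * (\prod_(i < n) hh i (x ord0 i))%:E)%E).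
      by apply: emeasurable_funM => //; apply/measurable_EFinP; exact: measurable_prod_coordT.
    have G0 (x : borel_rV R n) : (0 <= (expR E0)%:E * (\prod_(i < n) hh i (x ord0 i))%:E)%E.
      by rewrite -EFinM lee_fin mulr_ge0 ?expR_ge0// prodr_ge0.
    apply: (@le_trans _ _ (\int[gaussian_rV n]_(x in S)
        ((expR E0)%:E * (\prod_(i < n) hh i (x ord0 i))%:E))%E).
      apply: ge0_le_integral => //.
      - by move=> x _; rewrite lee_fin.
      - apply: measurable_funTS; apply/measurable_EFinP.
        exact: (measurableT_comp mg (@measurable_sphere_proj R n)).
      - exact: measurable_funTS.
    by apply: ge0_subset_integral => //.
  rewrite ge0_integralZl//; last 2 first.
  - by apply/measurable_EFinP; exact: measurable_prod_coordT.
  - by move=> x _; rewrite lee_fin prodr_ge0.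
  rewrite integral_gaussian_rV//; under eq_bigr do rewrite inthh.
  rewrite prodEFin -expR_sum -EFinM -expRD lee_fin ler_expR lerD2l sum_if_supp.
  have PA : `|Psi| <= A by [].
  (* On the support [Psi + A >= 0], so adding it there completes the sum of [Psi] to all
     coordinates. *)
  apply: (@le_trans _ _ (\sum_(i < n) Psi + \sum_(i | w ord0 i != 0) A +
      \sum_(i < n) q ^+ 2 / 2 * (w ord0 i * w ord0 i))).
    rewrite -sum_if_supp [\sum_(i | _) A]big_mkcond -!big_split/=; apply: ler_sum => i _.
    have := PA; rewrite ler_norml => /andP[PA1 PA2].
    have q20 : 0 <= q ^+ 2 / 2 * (w ord0 i * w ord0 i) by rewrite -expr2; ge0.
    case: eqP => _ /=; first by move: q20; clear; lra.
    have -> : q ^+ 2 * w ord0 i ^+ 2 / 2 = q ^+ 2 / 2 * (w ord0 i * w ord0 i) by ring.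
    by move: PA1; clear; lra.
  rewrite sumr_const card_ord sum_supp_cst -mulr_sumr -/(dot w w) -norm2_sqr q2.
  by rewrite le_eqVlt; apply/orP; left; apply/eqP; rewrite -mulr_natl /k; ring.
have IP0 : (0 <= \int[P]_u (g u)%:E)%E by apply: integral_ge0 => u _; rewrite lee_fin.
move: (\int[P]_u (g u)%:E)%E IP0 bound => Z Z0 bound.
set X := E0 + _ in bound.
(* The mass of the shell, at least [expR (- 8 q) / 2], is divided out; the 1 absorbs the factor
   2. *)
have ZX : (Z <= (expR (X + 8 * q + 1))%:E)%E.
  have e8 : 0 < expR (- (8 * q)) / 2 by rewrite divr_gt0 ?expR_gt0.
  have {}bound : (Z * (expR (- (8 * q)) / 2)%:E <= (expR X)%:E)%E.
    by apply: le_trans bound; exact: lee_wpmul2l.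
  move: Z0 bound; case: Z => [z| |].
  - rewrite -EFinM !lee_fin => z0 hz.
    have : z <= 2 * expR (X + 8 * q).
      rewrite -(ler_pM2r e8); apply: le_trans hz _.
      rewrite [leRHS](_ : _ = expR (X + 8 * q) * expR (- (8 * q))); last by field.
      by rewrite -expRD addrK.
    move=> /le_trans; apply; rewrite (expRD _ 1) [leRHS]mulrC ler_wpM2r ?expR_ge0//.
    by apply: le_trans (expR_ge1Dx _); clear; lra.
  - by move=> _; rewrite gt0_mulye ?lte_fin// leye_eq.
  - by move=> neg; exfalso; move: neg; rewrite leeNy_eq => /eqP.
apply: le_trans ZX _; rewrite lee_fin ler_expR.
rewrite -/q -/k /X /E0 /err /e1 -/al.
have nq : n%:R / q = q by rewrite -q2 expr2 mulfK// gt_eqF.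
have k0 : 0 <= k by rewrite /k.
have K1 : q <= K ^+ 2 * q by rewrite ler_peMl ?(ltW q0)// expr_ge1//; move: K3; clear; lra.
have nr0 : 0 <= n%:R * r by exact: mulr_ge0.
have -> : C1 * n%:R * (16 / q + (r + 16 / q) + K ^+ 2 / q) =
   C1 * (32 * (n%:R / q) + n%:R * r + K ^+ 2 * (n%:R / q)) by ring.
have -> : A * (n%:R * (2 * r + 48 / q)) = A * (2 * (n%:R * r) + 48 * (n%:R / q)) by ring.
have -> : n%:R * (r + 16 / q) = n%:R * r + 16 * (n%:R / q) by ring.
rewrite nq.
have CC : C1 * (32 * q + n%:R * r + K ^+ 2 * q) <= C1 * (33 * (n%:R * r + K ^+ 2 * q + k)).
  by rewrite ler_wpM2l//; move: nr0 K1 k0 q0; clear; lra.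
have AA : A * (2 * (n%:R * r) + 48 * q) + k * A <= A * (50 * (n%:R * r + K ^+ 2 * q + k)).
  by rewrite (mulrC k) -mulrDr ler_wpM2l//; move: nr0 K1 k0 q0; clear; lra.
move: CC AA nr0 K1 k0 q0 q32.
have -> : (33 * C1 + 50 * A + 30) * (n%:R * r + K ^+ 2 * q + k) =
  C1 * (33 * (n%:R * r + K ^+ 2 * q + k)) + A * (50 * (n%:R * r + K ^+ 2 * q + k)) +
  30 * (n%:R * r + K ^+ 2 * q + k) by ring.
have -> : n%:R * (lam * al + Psi) = lam * (n%:R * al) + n%:R * Psi by ring.
have -> : n%:R * (norm2 w ^+ 2 / 2) = n%:R * norm2 w ^+ 2 / 2 by ring.
have -> : n%:R * (2^-1 * norm2 w ^+ 2) = n%:R * norm2 w ^+ 2 / 2 by ring.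
move: (En w) => e; move: (C1 * (33 * _)) (A * (50 * _)) => c1 c2; move: (C1 * _) (k * A) => c3 c4.
move: (A * _) (n%:R * norm2 w ^+ 2) (lam * (n%:R * al)) (n%:R * Psi) (n%:R * (theta ^+ 2 * _)) => c5 c6 c7 c8 c9.
move: (n%:R * r) (K ^+ 2 * q) => c10 c11; move: (k) (q).
clear; move=> *; lra.
Qed.

(** * Lower bound *)

(** The bound by [D] controls the factor [expR (lam * dot y y)] left by the tilt; the interval of
    width [tau] fixes the norm to the precision that a small [r] demands. *)
Definition sqnorm_window {R : realType} n (c D t tau : R) : set (borel_rV R n) :=
  [set y : 'rV[R]_n | `|dot y y - c| <= D /\ t <= dot y y <= t + tau].

Lemma measurable_sqnorm_window {R : realType} n (c D t tau : R) :
  measurable (@sqnorm_window R n c D t tau).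
Proof.
have md : measurable_fun [set: borel_rV R n] (fun x : borel_rV R n => dot x x).
  exact: measurable_dot.
have -> : @sqnorm_window R n c D t tau =
   ((fun x : borel_rV R n => `|dot x x - c|) @^-1` `]-oo, D]) `&`
   ((fun x : borel_rV R n => dot x x) @^-1` `[t, t + tau]).
  by apply/seteqP; split=> x; rewrite /sqnorm_window/= !in_itv.
apply: measurableI; rewrite -[X in measurable X]setTI.
  have mf : measurable_fun [set: borel_rV R n] (fun x : borel_rV R n => `|dot x x - c|).
    by apply: measurableT_comp => //; exact: measurable_funB.
  by apply: mf => //; exact: measurable_itv.
by apply: md => //; exact: measurable_itv.
Qed.

(** The [M] windows cover the range of length [2 D]; if each had mass at most [1 / (4 M)], the total
    would be at most [1 / 4]. The windows look only at [restrict_suppC w x], as [integral_factor]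
    requires. *)
Lemma pigeonhole_window {R : realType} n (w : 'rV[R]_n) (h : 'I_n -> R -> R) (a D tau : R) (M : nat) :
  (forall i, measurable_fun setT (h i)) -> (forall i s, 0 <= h i s) ->
  0 < tau -> (0 < M)%N -> 2 * D < M%:R * tau ->
  let c := a * #|[pred j | w ord0 j == 0]|%:R in
  ((1 / 2)%:E <= \int[gaussian_rV n]_x
     (\1_(energy_window [pred j | w ord0 j == 0] a D) x * \prod_(i < n) h i (x ord0 i))%:E)%E ->
  exists m : nat, ((1 / (4 * M%:R))%:E <= \int[gaussian_rV n]_x
     (\1_(sqnorm_window c D (c - D + m%:R * tau) tau) (restrict_suppC w x) *
      \prod_(i < n) h i (x ord0 i))%:E)%E.
Proof.
move=> mh h0 tau0 M0 DM c half; apply: contrapT => none.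
pose H (x : borel_rV R n) : R := \prod_(i < n) h i (x ord0 i).
have H0 x : 0 <= H x by exact: prodr_ge0.
have mH : measurable_fun setT H by exact: measurable_prod_coordT.
pose W m := sqnorm_window c D (c - D + m%:R * tau) tau : set (borel_rV R n).
have mW m : measurable_fun setT (fun x : borel_rV R n => \1_(W m) (restrict_suppC w x) * H x).
  apply: measurable_funM => //.
  apply: (measurableT_comp _ (measurable_restrict_suppC w)).
  by apply: measurable_indic; exact: measurable_sqnorm_window.
have small m : (\int[gaussian_rV n]_x (\1_(W m) (restrict_suppC w x) * H x)%:E <=
    (1 / (4 * M%:R))%:E)%E.
  by rewrite leNgt; apply/negP => /ltW lem; apply: none; exists m.
have cover x : \1_(energy_window [pred j | w ord0 j == 0] a D) x * H x <=
    \sum_(m < M) \1_(W m) (restrict_suppC w x) * H x.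
  rewrite indicE; have [|_] := boolP (_ \in _); last first.
    by rewrite mul0r sumr_ge0// => m _; rewrite mulr_ge0.
  rewrite inE /energy_window/= mul1r => xw.
  pose T := dot (restrict_suppC w x) (restrict_suppC w x).
  have TE : \sum_(i in [pred j | w ord0 j == 0]) (x ord0 i ^+ 2 - a) = T - c.
    by rewrite sumrB /T dot_restrict_suppC sumr_const /c mulr_natr.
  rewrite TE in xw; have := xw; rewrite ler_norml => /andP[T1 T2].
  pose m := Num.truncn ((T - (c - D)) / tau).
  have T0 : 0 <= (T - (c - D)) / tau by rewrite divr_ge0 ?(ltW tau0)//; lra.
  have /andP[m1 m2] := truncn_itv T0; rewrite -/m in m1 m2.
  have mM : (m < M)%N.
    rewrite -(ltr_nat R); apply: le_lt_trans m1 _.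
    by rewrite ltr_pdivrMr//; apply: le_lt_trans DM; lra.
  rewrite (bigD1 (Ordinal mM))//= indicE mem_set; last first.
    split; first exact: xw.
    move: m1 m2; rewrite ler_pdivlMr// ltr_pdivrMr// -/T -natr1 mulrDl mul1r => m1 m2.
    by apply/andP; split; lra.
  by rewrite mul1r lerDl sumr_ge0// => i _; rewrite mulr_ge0.
have : ((1 / 2 : R)%:E <= \sum_(m < M) (1 / (4 * M%:R) : R)%:E)%E.
  apply: le_trans half _.
  apply: (@le_trans _ _ (\int[gaussian_rV n]_x
      (\sum_(m < M) (\1_(W m) (restrict_suppC w x) * H x)%:E))%E).
    apply: ge0_le_integral => //.
    - by move=> x _; rewrite lee_fin mulr_ge0// (H0 x).
    - apply/measurable_EFinP; apply: measurable_funM => //.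
      by apply: measurable_indic; exact: measurable_energy_window.
    - by apply: emeasurable_sum => m; exact/measurable_EFinP.
    - by move=> x _; rewrite sumEFin lee_fin; exact: cover.
  rewrite ge0_integral_sum//; last 2 first.
  - by move=> m; exact/measurable_EFinP.
  - by move=> m x _; rewrite lee_fin mulr_ge0.
  by apply: lee_sum => m _; exact: small.
rewrite sumEFin lee_fin sumr_const card_ord -mulr_natr.
rewrite [leRHS](_ : _ = 1 / 4); first by lra.
by field; rewrite pnatr_eq0 -lt0n.
Qed.

(** The scales are nested: boxes of half-width [n^-8] determine the part on the support up to
    [n^-7], hence its squared norm up to [tau = n^-6]. So [norm2 x] is [s0] up to [2 tau], and the
    projection misses [w] on the support by at most [4 tau <= n^-4 <= r]. The margin in
    [n + 2 <= s0 ^+ 2] ensures [n <= dot x x], so dividing by [norm2 x] keeps the small coordinates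
    below [K / sqrt n]. *)
Lemma lower_geometry {R : realType} n (w x : 'rV[R]_n) (K al s0 gam z tau r : R) :
  let q := Num.sqrt n%:R in let T := dot (restrict_suppC w x) (restrict_suppC w x) in
  (1024 <= n)%N -> 0 <= K -> al = 1 - norm2 w ^+ 2 -> norm2 w <= 1 ->
  z = n%:R ^- 8 -> tau = n%:R ^- 6 -> 0 <= gam <= 1 -> n%:R ^- 4 <= r ->
  0 <= s0 -> n%:R + 2 <= s0 ^+ 2 <= n%:R * (1 + gam) ->
  al * s0 ^+ 2 <= T <= al * s0 ^+ 2 + tau ->
  (forall i, w ord0 i != 0 -> `|x ord0 i - s0 * w ord0 i| <= z) ->
  (forall j, w ord0 j = 0 -> `|x ord0 j| <= K) ->
  [/\ n%:R <= dot x x <= 4 * n%:R, U_set w r K (sphere_proj x),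
     `|norm2 (q^-1 *: x) - 1| <= gam + 1 / n%:R &
     norm2 (restrict_supp w (q^-1 *: x) - w) <= gam + 1 / n%:R].
Proof.
move=> q T n1024 K0 alE w1 zE tauE /andP[gam0 gam1] nr s00 /andP[s1 s2] /andP[T1 T2] xS xC.
pose N : R := n%:R.
have N1024 : 1024 <= N by rewrite /N ler_nat.
have q32 : 32 <= q.
  by rewrite -[32](@ger0_norm R)// -sqrtr_sqr -natrX ler_wsqrtr// ler_nat.
have q2 : q ^+ 2 = N by rewrite sqr_sqrtr.
have q0 : 0 < q by move: q32; clear; lra.
have N0 : 0 < N by move: N1024; clear; lra.
have w0 := norm2_ge0 w.
pose e := restrict_supp w x - s0 *: w.
have tau0 : 0 < tau by rewrite tauE invr_gt0 exprn_gt0.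
have tauN : N * tau <= 1.
  rewrite tauE -/N exprS invfM mulrA mulfV ?gt_eqF// mul1r invf_le1 ?exprn_gt0//.
  by rewrite exprn_ege1//; move: N1024; clear; lra.
have tau4 : 4 * tau <= N ^- 4.
  rewrite tauE -/N -[6%N]/(2 + 4)%N exprD invfM mulrA -[leRHS]mul1r ler_wpM2r ?invr_ge0 ?exprn_ge0 ?(ltW N0)//.
  by rewrite ler_pdivrMr ?exprn_gt0// mul1r; move: N1024; clear; nra.
have eN : norm2 e <= N * z.
  have z0 : 0 <= z by rewrite zE invr_ge0 exprn_ge0// ler0n.
  rewrite norm2E -[leRHS]ger0_norm ?mulr_ge0 ?(ltW N0)// -sqrtr_sqr ler_wsqrtr//.
  apply: (@le_trans _ _ (\sum_(i < n) z ^+ 2)).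
    apply: ler_sum => i _; rewrite -expr2 !mxE; case: (boolP (w ord0 i == 0)) => /= wi.
      by rewrite (eqP wi) mulr0 subr0 expr0n/= sqr_ge0.
    by rewrite -[leLHS]ger0_norm ?sqr_ge0// normrX ler_pXn2r// ?nnegrE//; exact: xS.
  rewrite sumr_const card_ord -mulr_natl exprMn ler_wpM2r ?sqr_ge0//.
  by rewrite -/N; move: N1024; clear; nra.
(* In [xs2] below, a difference of squares is at most [N * z] times a sum of norms, which
   [4 * q + 1] bounds. *)
have Nz : N * z * (4 * q + 1) <= tau.
  have zt : z = N^-1 * (N^-1 * tau) by rewrite zE tauE -/N -!invfM -!exprS.
  have -> : N * z = N^-1 * tau by rewrite zt mulVKf// gt_eqF.
  rewrite mulrAC ler_piMl ?(ltW tau0)// mulrC ler_pdivrMr// mul1r -q2.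
  by move: q32; clear; nra.
have Nz0 : 0 <= N * z by apply: le_trans eN; exact: norm2_ge0.
have Nztau : N * z <= tau.
  by apply: le_trans Nz; rewrite ler_peMr//; move: q0; clear; lra.
have s02q : s0 <= 2 * q.
  rewrite -(@ler_pXn2r _ 2)// ?nnegrE ?mulr_ge0 ?(ltW q0)// exprMn q2.
  by move: s2 gam1 N0; rewrite -/N; clear; nra.
pose xs := restrict_supp w x.
have xsw : `|norm2 xs - s0 * norm2 w| <= N * z.
  rewrite -{1}(ger0_norm s00) -norm2Z; apply: le_trans (norm2B_ge _ _) eN.
have xs2 : `|norm2 xs ^+ 2 - s0 ^+ 2 * norm2 w ^+ 2| <= tau.
  rewrite -exprMn subr_sqr normrM; apply: le_trans Nz.
  apply: ler_pM => //.
  have sw : 0 <= s0 * norm2 w <= 2 * q.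
    by rewrite mulr_ge0//=; apply: le_trans s02q; rewrite ler_piMr.
  have Nz1 : N * z <= 1.
    apply: le_trans Nztau _; apply: le_trans tauN; rewrite ler_peMl ?(ltW tau0)//.
    by move: N1024; clear; lra.
  rewrite ger0_norm ?addr_ge0 ?norm2_ge0//; last by case/andP: sw.
  move: xsw; rewrite ler_norml => /andP[_ xsw]; case/andP: sw.
  by move: (norm2 xs) (s0 * _) xsw Nz1; clear; move=> *; lra.
have xE : dot x x = norm2 xs ^+ 2 + T by rewrite norm2_sqr (dot_restrict_suppD w x).
have dx : - tau <= dot x x - s0 ^+ 2 <= 2 * tau.
  move: xs2 T1 T2; rewrite xE alE ler_norml mulrBl mul1r (mulrC (_ ^+ 2) (s0 ^+ 2)).
  by move: (s0 ^+ 2 * _); clear; move=> v /andP[? ?] *; apply/andP; split; lra.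
have tau1 : tau <= 1.
  by apply: le_trans tauN; rewrite ler_peMl ?(ltW tau0)//; move: N1024; clear; lra.
have xlow : N <= dot x x by move: s1 dx tau1; rewrite -/N; clear => ? /andP[? ?] ?; lra.
have xup : dot x x <= 4 * N.
  by move: s2 gam1 dx tau1 N1024; rewrite -/N; clear => ? ? /andP[? ?] ? ?; nra.
pose y : R := norm2 x.
have y2 : y ^+ 2 = dot x x by exact: norm2_sqr.
have yq : q <= y.
  by rewrite -(@ler_pXn2r _ 2)// ?nnegrE ?(ltW q0) ?norm2_ge0// q2 y2.
have y0 : 0 < y by exact: lt_le_trans yq.
have ys : `|s0 - y| <= 2 * tau.
  have : `|s0 - y| * (s0 + y) <= 2 * tau.
    have sy : 0 <= s0 + y by rewrite addr_ge0// ltW.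
    rewrite -{1}(ger0_norm sy) -normrM -subr_sqr y2 ler_norml.
    by move: dx tau0; clear => /andP[? ?] ?; apply/andP; split; lra.
  apply: le_trans; rewrite ler_peMr//.
  by move: s00 yq q32; clear; lra.
have x0 : 0 < dot x x by exact: lt_le_trans xlow.
pose u := sphere_proj x.
have uE : u = y^-1 *: x by rewrite /u /sphere_proj -norm2E.
have scaled (c : R) : restrict_supp w (c *: x) - w = c *: e + (c * s0 - 1) *: w.
  rewrite restrict_suppZ /e; move: (restrict_supp w x) => v.
  by apply/rowP => j; rewrite !mxE; ring.
have scaled_le (c d : R) : 0 < c <= 1 -> `|c * s0 - 1| <= d ->
    norm2 (restrict_supp w (c *: x) - w) <= c * tau + d.
  move=> /andP[c0 c1] cd; rewrite scaled; apply: le_trans (norm2D _ _) _; rewrite !norm2Z.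
  apply: lerD; last by apply: le_trans cd; rewrite ler_piMr.
  by rewrite gtr0_norm// ler_wpM2l ?(ltW c0)// (le_trans eN).
have tauV : 2 * tau <= N^-1 * N^-1.
  have := tau4; move/le_trans => /(_ (N ^- 2)); rewrite -[N^-1 * _]expr2 exprVn => h.
  apply: (@le_trans _ _ (4 * tau)); first by move: tau0; clear; lra.
  apply: h; rewrite lef_pV2 ?posrE ?exprn_gt0// ler_weXn2l//.
  by move: N1024; clear; lra.
have NV : N^-1 <= 1 by rewrite invf_le1//; move: N1024; clear; lra.
have NV0 : 0 < N^-1 by rewrite invr_gt0.
have tauV1 : 2 * tau <= N^-1 by apply: le_trans tauV _; rewrite ler_piMl// ltW.
have qV : 0 < q^-1 <= 1 by rewrite invr_gt0 q0 invf_le1//=; move: q32; clear; lra.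
have yV : 0 < y^-1 <= 1 by rewrite invr_gt0 y0 invf_le1//=; move: q32 yq; clear; lra.
split.
- by apply/andP; split.
- split; first exact: sphere_proj_sphere.
    rewrite -/u uE; have yd : `|y^-1 * s0 - 1| <= 2 * tau.
      have -> : y^-1 * s0 - 1 = y^-1 * (s0 - y) by rewrite mulrBr mulVf// gt_eqF.
      rewrite normrM (gtr0_norm (_ : 0 < y^-1)) ?invr_gt0//; apply: le_trans ys.
      by rewrite ler_piMl//; case/andP: yV.
    apply: (le_trans (scaled_le _ _ yV yd)); apply: le_trans nr; apply: le_trans tau4.
    have : y^-1 * tau <= tau by rewrite ler_piMl ?(ltW tau0)//; case/andP: yV.
    by move: tau0; clear; lra.
  apply/norm_rV_le => [|j]; first by rewrite divr_ge0// ltW.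
  rewrite mxE; case: eqP => [wj|_]; last by rewrite normr0 divr_ge0// ltW.
  rewrite -/u uE mxE normrM gtr0_norm ?invr_gt0// mulrC; apply: ler_pM => //.
  - by rewrite ltW//; case/andP: yV.
  - exact: xC.
  - by rewrite lef_pV2// posrE.
- rewrite norm2Z (gtr0_norm (_ : 0 < q^-1)) ?invr_gt0// -/y mulrC.
  have yq1 : 1 <= y / q by rewrite ler_pdivlMr// mul1r.
  have : (y / q) ^+ 2 <= 1 + gam + 1 / N.
    rewrite exprMn y2 exprVn q2 ler_pdivrMr// !mulrDl mul1r mulVf ?gt_eqF// mul1r.
    move: dx s2 tauV1 NV; rewrite -/N mulrDr mulr1 (mulrC N); clear => /andP[? ?] ? ? ?; lra.
  rewrite -/N; move: (y / q) yq1; clear => v v1 v2; rewrite ger0_norm; first by nra.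
  by lra.
have sq1 : q <= s0.
  by rewrite -(@ler_pXn2r _ 2)// ?nnegrE ?(ltW q0)// q2; move: s1; rewrite -/N; clear; lra.
have sd : `|q^-1 * s0 - 1| <= gam.
  have sq : 1 <= q^-1 * s0 by rewrite mulrC ler_pdivlMr// mul1r.
  have : (q^-1 * s0) ^+ 2 <= 1 + gam.
    by rewrite exprMn exprVn q2 mulrC ler_pdivrMr// mulrC.
  move: (q^-1 * s0) sq; clear => v v1 v2; rewrite ger0_norm; first by nra.
  by lra.
apply: (le_trans (scaled_le _ _ qV sd)); rewrite addrC lerD2l.
have : q^-1 * tau <= tau by rewrite ler_piMl ?(ltW tau0)//; case/andP: qV.
by move: tauV1 tau0; rewrite -/N mul1r; clear; lra.
Qed.

(** Interval length times the least density. The width [2 n^-8] is the source of [8 ln n] per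
    support coordinate; the 2 absorbs the factor [2 / 3] and the growth of the exponent across the
    interval. *)
Lemma box_mass_ge {R : realType} n (s0 y : R) : (1024 <= n)%N -> 0 <= s0 <= 2 * Num.sqrt n%:R ->
  `|y| <= 1 ->
  ((expR (- (8 * ln n%:R + 2) - s0 ^+ 2 * y ^+ 2 / 2))%:E <=
   gaussian `[(s0 * y - n%:R ^- 8)%R, (s0 * y + n%:R ^- 8)%R]%classic)%E.
Proof.
move=> n1024 /andP[s00 s0q] y1; set z := n%:R ^- 8; pose q : R := Num.sqrt n%:R.
pose N : R := n%:R; have N1024 : 1024 <= N by rewrite /N ler_nat.
have N0 : 0 < N by move: N1024; clear; lra.
have q2 : q ^+ 2 = N by rewrite sqr_sqrtr.
have q0 : 0 < q by rewrite sqrtr_gt0.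
have z0 : 0 < z by rewrite invr_gt0 exprn_gt0.
have zN : z <= N^-1 * (1 / 8).
  rewrite /z -/N exprS invfM ler_wpM2l ?invr_ge0 ?(ltW N0)// div1r lef_pV2 ?posrE ?exprn_gt0//.
  apply: (@le_trans _ _ N); first by move: N1024; clear; lra.
  by rewrite ler_eXnr//; move: N1024; clear; lra.
have qz : q * z <= 1 / 8.
  have qN : q <= N by rewrite -q2 expr2 ler_peMl ?(ltW q0)// -(@ler_pXn2r _ 2)// ?nnegrE ?(ltW q0)// expr1n q2; move: N1024; clear; lra.
  apply: (@le_trans _ _ (N * (N^-1 * (1 / 8)))); first by apply: ler_pM => //; exact: ltW.
  by rewrite mulVKf// gt_eqF.
pose M : R := s0 * `|y| + z.
have M2 : M ^+ 2 <= s0 ^+ 2 * y ^+ 2 + 1.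
  have -> : y ^+ 2 = `|y| ^+ 2 by rewrite -normrX ger0_norm ?sqr_ge0.
  rewrite -exprMn /M; have sy : s0 * `|y| <= 2 * q.
    by apply: le_trans s0q; rewrite ler_piMr.
  have z1 : z <= 1 / 8.
    by apply: le_trans zN _; rewrite ler_piMl// invf_le1//; move: N1024; clear; lra.
  have h : s0 * `|y| * z <= 1 / 4.
    apply: (@le_trans _ _ (2 * q * z)); first by rewrite ler_wpM2r// ltW.
    by move: qz; clear; lra.
  by move: (s0 * `|y|) h z1 z0; clear => v *; nra.
have ab : s0 * y - z <= s0 * y + z by move: z0; clear; lra.
have hM (s : R) : s \in `[s0 * y - z, s0 * y + z] -> `|s| <= M.
  rewrite in_itv/= => /andP[a b]; rewrite /M -{1}(ger0_norm s00) -normrM.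
  have -> : s = s0 * y + (s - s0 * y) by rewrite addrC subrK.
  apply: le_trans (ler_normD _ _) _; rewrite lerD2l ler_norml.
  by move: a b; clear => a b; apply/andP; split; lra.
apply: le_trans (gaussian_itv_lb ab hM); rewrite lee_fin.
have -> : s0 * y + z - (s0 * y - z) = 2 * z by ring.
have -> : z = expR (- (8 * ln N)).
  by rewrite expRN /z -/N expRM_natl lnK ?posrE.
have -> : - (8 * ln n%:R + 2) - s0 ^+ 2 * y ^+ 2 / 2 =
  - (8 * ln N) + (- (3 / 2)) + (- (1 + s0 ^+ 2 * y ^+ 2) / 2) by rewrite -/N; lra.
rewrite 2!expRD.
have e1 : expR (- (3 / 2)) <= 2 / 3 :> R.
  rewrite expRN -[leRHS]invrK lef_pV2 ?posrE ?expR_gt0//.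
  by apply: le_trans (expR_ge1Dx _); lra.
have e2 : expR (- (1 + s0 ^+ 2 * y ^+ 2) / 2) <= expR (- (M ^+ 2 / 2)).
  by rewrite ler_expR; move: M2; clear; lra.
rewrite [leRHS](_ : _ = expR (- (8 * ln N)) * (2 / 3) * expR (- (M ^+ 2 / 2))); last by field.
by apply: ler_pM => //; rewrite ?mulr_ge0 ?expR_ge0// ler_wpM2l ?expR_ge0.
Qed.

(** [gaussian_polar] asks only for positivity; in the lower bound the mass of the shell is then
    estimated by 1. *)
Lemma gaussian_rV_shell_gt0 {R : realType} n :
  (0 < gaussian_rV n [set x : 'rV[R]_n | (n%:R <= dot x x <= 4 * n%:R)%R])%E.
Proof.
pose B : set (borel_rV R n) := product_box (fun _ => `[1%R, 2%R]%classic).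
have mB : measurable B by apply: measurable_product_box => i; exact: measurable_itv.
have B0 : (0 < gaussian_rV n B)%E.
  have cc : (((2 - 1) * (expR (- (2 ^+ 2 / 2)) / 3))%:E <= gaussian `[1%R, 2%R]%classic :> \bar R)%E.
    apply: gaussian_itv_lb => [|s]; first by lra.
    by move=> /andP[s1 s2]; rewrite ger0_norm; lra.
  rewrite /B product_prob_box; last by move=> i; exact: measurable_itv.
  apply: lt_le_trans (le_prode (F := fun _ => ((2 - 1) * (expR (- (2 ^+ 2 / 2)) / 3))%:E) _).
    rewrite prodEFin lte_fin; apply: prodr_gt0 => i _.
    by rewrite mulr_gt0 ?divr_gt0 ?expR_gt0//; lra.
  by move=> i; rewrite cc andbT lee_fin mulr_ge0 ?divr_ge0 ?expR_ge0//; lra.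
apply: lt_le_trans B0 _; apply: le_measure; rewrite ?inE//.
  rewrite -[X in measurable X]setTI.
  have md : measurable_fun [set: borel_rV R n] (fun x : borel_rV R n => dot x x).
    exact: measurable_dot.
  have -> : [set x : 'rV[R]_n | n%:R <= dot x x <= 4 * n%:R] =
     (fun x : borel_rV R n => dot x x) @^-1` `[n%:R, 4 * n%:R].
    by apply/seteqP; split=> x /=; rewrite in_itv.
  by apply: md => //; exact: measurable_itv.
move=> x xB; have hx (i : 'I_n) : 1 <= x ord0 i * x ord0 i <= 4.
  have := xB i; rewrite /= in_itv/= => /andP[a1 a2]; apply/andP; split; nra.
rewrite /= /dot; apply/andP; split.
  rewrite (_ : n%:R = \sum_(i < n) (1 : R)); last by rewrite sumr_const card_ord.
  by apply: ler_sum => i _; case/andP: (hx i).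
rewrite (_ : 4 * n%:R = \sum_(i < n) (4 : R)); last by rewrite sumr_const card_ord mulr_natr.
by apply: ler_sum => i _; case/andP: (hx i).
Qed.

Lemma four_le_expR2 {R : realType} : 4 <= expR 2 :> R.
Proof.
have e1 : 2 <= expR 1 :> R by apply: le_trans (expR_ge1Dx _); lra.
by rewrite (_ : 2 = 1 + 1)// expRD; nra.
Qed.

(* Shells do not determine the radius [sqrt (dot x x)] up to [n^-4], as membership
   in [U_set] requires for small [r]. Pigeonholing the squared norm of the
   coordinates outside the support of [w] into windows of width [tau] fixes it,
   and the box in the remaining coordinates is centred at [s0 *: w] accordingly.
   The tilt has second moment [al + beta] rather than [al], so that [dot x x >= n]
   and the bound [K] on the coordinates of [x] transfers to its projection. *)
Lemma sphere_integral_lower {R : realType} (mu : probability (measurableTypeR R) R)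
  (mu_sub_gaussian : sub_gaussian mu)
  (mu_mean : ('E_mu[id] = 0)%E) (mu_var : ('V_mu[id] = 1)%E) (T rho : R) :
  1 <= T -> 0 < rho < 2^-1 -> exists C : R, 0 <= C /\
  forall n (P : probability (borel_rV R n) R) (w : 'rV[R]_n) (theta K r phi : R),
  (1024 <= n)%N -> uniform_on_sphere P -> norm2 w <= 1 - rho -> 0 <= theta <= T ->
  3 <= K <= Num.sqrt n%:R -> 1 <= ln (n%:R : R) <= K ->
  4 * ((norm0 w)%:R + 8 * K * Num.sqrt n%:R + 2) <= rho * n%:R ->
  n%:R ^- 4 <= r ->
  Phi mu K (theta *: w) (1 - norm2 w ^+ 2) = phi%:E ->
  ((expR (energy (pair_energy mu) (theta * Num.sqrt n%:R) w +
      n%:R * (theta ^+ 2 * (1 - norm2 w ^+ 2) ^+ 2) + n%:R * phi - n%:R * (2^-1 * norm2 w ^+ 2) -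
      C * (K ^+ 2 * Num.sqrt n%:R + (norm0 w)%:R * ln n%:R)))%:E <=
   \int[P]_(u in U_set w r K) (expR (energy (pair_energy mu) (theta * Num.sqrt n%:R) u))%:E)%E.
Proof.
move=> T1 /andP[rho0 rho2].
have [C1 [C10 hC1]] := energy_sphere_proj mu_sub_gaussian mu_mean mu_var T1.
have rho01 : 0 < rho <= 1 by rewrite rho0/=; move: rho2; clear; lra.
have [A [A0 hA]] := exists_column_tilt mu_sub_gaussian mu_mean T rho01.
have [C0 [C00 hC0]] := column_energy_bounds mu_sub_gaussian mu_mean T.
have rhoV : 0 <= rho^-1 by rewrite invr_ge0 ltW.
exists (C1 * (56 * rho^-1 + 3) + 28 * A + 14 * rho^-1 + 21); split; first by ge0.
move=> n P w theta K r phi n1024 unifP wr th /andP[K3 Kq] /andP[ln1 lnleK] small nr phiE.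
have w0 := norm2_ge0 w.
have w1 : norm2 w <= 1 by move: wr rho0; clear; lra.
have K0 : 0 <= K by move: K3; clear; lra.
pose al : R := 1 - norm2 w ^+ 2.
have al12 : rho <= al <= 1.
  by rewrite /al; move: (norm2 w) w0 wr rho0 rho2; clear => v *; apply/andP; split; nra.
have al0 : 0 < al by case/andP: al12 => + _; exact: lt_le_trans.
pose N : R := n%:R; pose k : R := (norm0 w)%:R; pose q : R := Num.sqrt n%:R.
have q32 : 32 <= q.
  by rewrite -[32](@ger0_norm R)// -sqrtr_sqr -natrX ler_wsqrtr// ler_nat.
have q2 : q ^+ 2 = N by rewrite sqr_sqrtr.
have q0 : 0 < q by move: q32; clear; lra.
have N1024 : 1024 <= N by rewrite /N ler_nat.
have N0 : 0 < N by move: N1024; clear; lra.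
have k0 : 0 <= k by rewrite /k.
pose D : R := 8 * K * q.
have D0 : 0 <= D by rewrite /D; ge0.
rewrite -/k -/q -/D -/N in small.
(* Since [N - k >= N / 2], this makes [(N - k) * beta >= k + D + 2]: the shift makes up for the [k]
   coordinates of the support, the deviation [D] and the margin 2. *)
pose beta : R := 2 * (k + D + 2) / N.
have betaN : N * beta = 2 * (k + D + 2) by rewrite /beta mulrC divfK// gt_eqF.
have beta0 : 0 <= beta by rewrite /beta; ge0; move: k0 D0; clear; lra.
have beta2 : beta <= rho / 2.
  by rewrite -(ler_pM2l N0) betaN; move: small; clear; lra.
have al'12 : rho <= al + beta <= 2.
  by move: al12 beta0 beta2 rho2; clear => /andP[? ?] *; apply/andP; split; lra.
have [lam [Psi /= [lamA PsiA h1 h2]]] := hA n w theta (al + beta) K w1 th al'12 K3.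
have phi_le : phi <= lam * al + Psi.
  rewrite -lee_fin -phiE -/al.
  apply: (Phi_le (column_energyE mu_sub_gaussian mu_mean (theta *: w))) h1.
    exact: measurable_column_energy.
  by move=> s; exact: (hC0 n w theta s w1 th).
pose L s : R := column_energy mu (theta *: w) s.
have mL : measurable_fun setT L by exact: measurable_column_energy.
pose ht (s : R) : R := \1_`[- K, K] s * expR (L s - lam * s ^+ 2 - Psi).
have mht : measurable_fun setT ht.
  apply: measurable_funM; first exact: measurable_indic.
  apply: measurableT_comp => //; apply: measurable_funB => //; apply: measurable_funB => //.
  by apply: measurable_funM => //; exact: measurable_sqr.
have ht0 s : 0 <= ht s by rewrite mulr_ge0 ?expR_ge0.
pose J := [pred j | w ord0 j == 0].
pose h (i : 'I_n) (s : R) : R := if w ord0 i == 0 then ht s else 1.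
have mh i : measurable_fun setT (h i).
  by rewrite /h; case: (w ord0 i == 0).
have h0 i s : 0 <= h i s by rewrite /h; case: ifP.
have int1 : (\int[gaussian]_(s in [set: measurableTypeR R]) (1 : R)%:E = 1)%E.
  by rewrite integral_cst// mul1e; exact: probability_setT.
have hint i : (\int[gaussian]_s (h i s)%:E = 1)%E.
  by rewrite /h; case: (w ord0 i == 0).
have window : ((1 / 2)%:E <= \int[gaussian_rV n]_x
    (\1_(energy_window J (al + beta) D) x * \prod_(i < n) h i (x ord0 i))%:E)%E.
  (* With [D = 8 K q], the exponent in [chernoff] is [2 - 4]; [K <= q] gives the smallness that
     [tilt_mgf_le] requires. *)
  pose t : R := 1 / (2 * K * q).
  have Kq0 : 0 < 2 * K * q by rewrite !mulr_gt0//; move: K3; clear; lra.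
  have t0 : 0 <= t by rewrite divr_ge0// ltW.
  have tK : t * K ^+ 2 <= 1 / 2.
    by rewrite /t mulrAC ler_pdivrMr// mul1r expr2; move: Kq K0; rewrite -/q; clear; nra.
  have htK s : ~~ (- K <= s <= K) -> ht s = 0.
    by move=> sK; rewrite /ht indicE memNset ?mul0r//= in_itv/=; exact/negP.
  have al'02 : 0 <= al + beta <= 2.
    by case/andP: al'12 => a b; rewrite b andbT; apply: le_trans a; exact: ltW.
  have K2 : 2 <= K by move: K3; clear; lra.
  apply: (@chernoff R n J h (al + beta) t (8 * t ^+ 2 * K ^+ 2) D) => //.
  - by ge0.
  - move=> i iJ; rewrite /h; move: iJ; rewrite inE => ->.
    by apply: tilt_mgf_le => //; rewrite ger0_norm.
  - move=> i iJ; rewrite /h; move: iJ; rewrite inE => ->.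
    by rewrite -sqrrN; apply: tilt_mgf_le => //; rewrite normrN ger0_norm.
  - have -> : n%:R * (8 * t ^+ 2 * K ^+ 2) - t * D = - 2.
      rewrite -/N -q2 /t /D; field; rewrite !gt_eqF//; move: K3; clear; lra.
    rewrite expRN mul1r lef_pV2 ?posrE ?expR_gt0//.
    exact: four_le_expR2.
pose tau : R := n%:R ^- 6; pose z : R := n%:R ^- 8.
have tau0 : 0 < tau by rewrite invr_gt0 exprn_gt0.
have M0 : (0 < n ^ 9)%N by rewrite expn_gt0 (leq_trans _ n1024).
(* The number of windows need only be polynomial in [n], as it enters through its logarithm; [n ^ 9]
   windows of width [n^-6] cover a length [n^3]. *)
have DM : 2 * D < (n ^ 9)%:R * tau.
  have -> : (n ^ 9)%:R * tau = N ^+ 3.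
    by rewrite natrX /tau -/N -[9%N]/(3 + 6)%N exprD mulfK// expf_neq0// gt_eqF.
  apply: (@le_lt_trans _ _ (16 * N)).
    by rewrite /D -q2 expr2; move: Kq q0; rewrite -/q; clear; nra.
  by rewrite !exprS expr0 mulr1; move: N1024; clear; nra.
have /= := pigeonhole_window mh h0 tau0 M0 DM window.
set c := (al + beta) * _ => -[m hm].
pose W := sqnorm_window c D (c - D + m%:R * tau) tau : set (borel_rV R n).
pose t0 : R := c - D + m%:R * tau.
have nk : #|[pred j | w ord0 j == 0]|%:R + k = N.
  rewrite /k /norm0 /N -natrD; congr (_%:R).
  by rewrite -[RHS]card_ord -(cardC [pred j | w ord0 j == 0]).
have cE : c = (al + beta) * (N - k) by rewrite /c -nk addrK.
have MM0 : 0 < 1 / (4 * (n ^ 9)%:R) :> R by rewrite divr_gt0// mulr_gt0// ltr0n.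
(* The index [m] comes without a bound; a point of the window, which exists because its mass is
   positive, gives [t0 <= c + D]. *)
have [x0 Wx0] : exists x, W (restrict_suppC w x).
  apply: contrapT => none; move: hm; apply/negP; rewrite -ltNge.
  rewrite (eq_integral (fun=> 0%E)); first by rewrite integral0 lte_fin.
  move=> x _; rewrite indicE memNset ?mul0r// => Wx; apply: none; by exists x.
have [t0c tn] : t0 <= c + D /\ N * al + 2 <= t0.
  split; first by case: Wx0 => + /andP[+ _]; rewrite ler_norml => /andP[_ +] +; rewrite -/t0; clear; lra.
  have m0 : 0 <= m%:R * tau by rewrite mulr_ge0 ?(ltW tau0).
  have kN : 2 * k <= N.
    by move: small rho2 D0 k0 N0 rho0; clear; nra.
  have nb : k + D + 2 <= (N - k) * beta.
    have : N * beta <= 2 * ((N - k) * beta) by move: kN beta0; clear; nra.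
    by rewrite betaN; clear; lra.
  have al1 : al <= 1 by case/andP: al12.
  rewrite /t0 cE; move: nb m0 k0 al1 al0; clear; move: (m%:R * tau) => mt.
  have -> : (al + beta) * (N - k) = N * al - al * k + (N - k) * beta by ring.
  by move: ((N - k) * beta) => b *; nra.
(* With the support part near [s0 *: w] and squared norm near [t0 = al * s0 ^+ 2] elsewhere, the
   total is near [s0 ^+ 2 * (norm2 w ^+ 2 + al) = s0 ^+ 2], so [x / s0] is nearly a unit vector. *)
pose s0 : R := Num.sqrt (t0 / al).
have t00 : 0 <= t0 / al.
  by rewrite divr_ge0 ?(ltW al0)// (le_trans _ tn)//; move: N0 al0; clear; nra.
have s02 : s0 ^+ 2 = t0 / al by rewrite sqr_sqrtr.
have s0al : al * s0 ^+ 2 = t0 by rewrite s02 mulrC divfK// gt_eqF.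
have s00 : 0 <= s0 by exact: sqrtr_ge0.
(* Bounds [s0 ^+ 2 - N]: indeed [t0 - N * al <= N * beta + D = 2 k + 3 D + 4], and [al >= rho]. *)
pose Gm : R := (2 * k + 3 * D + 4) * rho^-1.
have Gm0 : 0 <= Gm by rewrite /Gm; ge0; move: k0 D0; clear; lra.
pose gam : R := Gm / N.
have Ngam : N * gam = Gm by rewrite /gam mulrC divfK// gt_eqF.
have gam01 : 0 <= gam <= 1.
  rewrite divr_ge0 ?(ltW N0)//= ler_pdivrMr// mul1r /Gm ler_pdivrMr//.
  by move: small k0 D0; clear; rewrite (mulrC rho); lra.
have s0up : s0 ^+ 2 <= N * (1 + gam).
  rewrite mulrDr mulr1 Ngam s02 ler_pdivrMr// mulrDl.
  have hG : (2 * k + 3 * D + 4) <= Gm * al.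
    have -> : Gm * al = (2 * k + 3 * D + 4) * (al / rho) by rewrite /Gm; ring.
    rewrite ler_peMr//; first by move: k0 D0; clear; lra.
    by rewrite ler_pdivlMr// mul1r; case/andP: al12.
  have cb : c <= N * al + N * beta.
    by rewrite cE -mulrDr mulrC ler_wpM2r//; [move: al0 beta0|move: k0]; clear; lra.
  by move: t0c cb hG; rewrite betaN; clear; lra.
have s0low : N + 2 <= s0 ^+ 2.
  rewrite s02 ler_pdivlMr//; apply: le_trans tn; rewrite mulrDl lerD2l.
  by case/andP: al12 => _; clear; lra.
have s0q : 0 <= s0 <= 2 * q.
  rewrite s00/= -(@ler_pXn2r _ 2)// ?nnegrE ?mulr_ge0 ?(ltW q0)// exprMn q2.
  apply: le_trans s0up _; case/andP: gam01 => _; move: N0; clear; nra.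
pose Bx (i : 'I_n) : set R := `[s0 * w ord0 i - z, s0 * w ord0 i + z]%classic.
pose p (i : 'I_n) (s : R) : R := if w ord0 i == 0 then ht s else \1_(Bx i) s.
have mp i : measurable_fun setT (p i).
  rewrite /p; case: (w ord0 i == 0) => //; apply: measurable_indic.
  exact: measurable_itv.
have p0 i s : 0 <= p i s by rewrite /p; case: ifP.
pose cm (i : 'I_n) : R := if w ord0 i == 0 then 1 else fine (gaussian (Bx i)).
have pcm i : (\int[gaussian]_s (p i s)%:E = (cm i)%:E)%E.
  rewrite /p /cm; case: (w ord0 i == 0) => //.
  rewrite integral_indic//; last exact: measurable_itv.
  by rewrite setIT fineK// fin_num_measure//; exact: measurable_itv.
have mW : measurable W by exact: measurable_sqnorm_window.
have fact := @integral_factor R n w p cm mp p0 pcm W mW.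
have wi1 i : `|w ord0 i| <= 1.
  apply: le_trans w1; rewrite norm2E -sqrtr_sqr ler_wsqrtr// /dot (bigD1 i)//= expr2.
  by rewrite lerDl sumr_ge0// => j _; rewrite -expr2 sqr_ge0.
(* The logarithm of the lower bound for the mass of the box; its last term yields
   [- N * norm2 w ^+ 2 / 2] up to [Gm / 2]. *)
pose Bd : R := - (k * (8 * ln N + 2)) - s0 ^+ 2 * norm2 w ^+ 2 / 2.
have cmge : expR Bd <= \prod_(i | w ord0 i != 0) cm i.
  have -> : Bd = \sum_(i | w ord0 i != 0) (- (8 * ln N + 2) - s0 ^+ 2 * w ord0 i ^+ 2 / 2).
    rewrite sumrB sum_supp_cst -/k mulNr (mulrC _ k); congr (_ - _).
    rewrite -mulr_suml -mulr_sumr norm2_sqr; congr (_ * _ / _).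
    rewrite [RHS]big_mkcond; apply: eq_bigr => i _.
    by case: eqP => [->|_]; rewrite ?mulr0// expr2.
  rewrite expR_sum; apply: ler_prod => i wi; rewrite expR_ge0/= /cm (negbTE wi).
  rewrite -lee_fin fineK ?fin_num_measure//; last exact: measurable_itv.
  exact: box_mass_ge.
set En := energy (pair_energy mu) (theta * Num.sqrt n%:R).
set U := U_set w r K.
have mU : measurable (U : set (borel_rV R n)) by exact: measurable_U_set.
pose g (u : borel_rV R n) : R := \1_U u * expR (En u).
have mEn : measurable_fun [set: borel_rV R n] En by exact: energy_measurable.
have mg : measurable_fun [set: borel_rV R n] g.
  by apply: measurable_funM; [exact: measurable_indic|exact: measurableT_comp].
have g0 u : 0 <= g u by rewrite mulr_ge0 ?expR_ge0.
pose I : set R := `[n%:R, 4 * n%:R]%classic.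
pose S : set (borel_rV R n) := [set x | I (dot x x)].
have SE : S = [set x : 'rV[R]_n | (n%:R <= dot x x <= 4 * n%:R)%R].
  by apply/seteqP; split=> x; rewrite /S/= /I/= in_itv.
have I0 t : I t -> 0 < t.
  by rewrite /I/= in_itv/= => /andP[t1 _]; apply: lt_le_trans t1.
have S0 : (0 < gaussian_rV n S)%E by rewrite SE; exact: gaussian_rV_shell_gt0.
have mSset : measurable S.
  rewrite -[S]setTI; have md : measurable_fun [set: borel_rV R n] (fun x : borel_rV R n => dot x x).
    exact: measurable_dot.
  by apply: md => //; exact: measurable_itv.
have polar := gaussian_polar unifP (measurable_itv _) I0 mg g0 S0.
have -> : (\int[P]_(u in U) (expR (En u))%:E = \int[P]_u (g u)%:E)%E.
  rewrite integral_mkcond; apply: eq_integral => u _; rewrite patchE /g indicE.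
  by case: ifP => _; rewrite ?mul1r ?mul0r.
pose err : R := C1 * N * (gam + 1 / N + (gam + 1 / N) + K ^+ 2 / q).
pose E2 : R := En w + N * (theta ^+ 2 * al ^+ 2) - err + lam * c + (N - k) * Psi - A * D.
have pointwise (x : borel_rV R n) :
    expR E2 * (\1_W (restrict_suppC w x) * \prod_(i < n) p i (x ord0 i)) <=
    \1_S x * g (sphere_proj x).
  have R0 : 0 <= \1_S x * g (sphere_proj x) by rewrite mulr_ge0.
  rewrite [\1_W _]indicE; have [|_] := boolP (_ \in W); last by rewrite mul0r mulr0.
  rewrite inE mul1r => Wx.
  (* If the product does not vanish, all its indicators equal 1, and these are the coordinate bounds
     of [lower_geometry]. *)
  have [->|pn0] := eqVneq (\prod_(i < n) p i (x ord0 i)) 0; first by rewrite mulr0.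
  have pi0 i : p i (x ord0 i) != 0 by move/prodf_neq0: pn0 => /(_ i); exact.
  have xS i : w ord0 i != 0 -> `|x ord0 i - s0 * w ord0 i| <= z.
    move=> wi; have := pi0 i; rewrite /p (negbTE wi) indicE.
    case: (boolP (_ \in _)); rewrite ?eqxx// inE /Bx/= in_itv/= => + _.
    by clear => /andP[? ?]; rewrite ler_norml; apply/andP; split; lra.
  have xC j : w ord0 j = 0 -> `|x ord0 j| <= K.
    move=> wj; have := pi0 j; rewrite /p wj eqxx /ht indicE.
    case: (boolP (_ \in _)); rewrite ?mul0r ?eqxx// inE/= in_itv/= => + _.
    by rewrite ler_norml.
  case: Wx => Wx1; rewrite -/t0 -s0al => Wx2.
  have [xN xU d1 d2] := lower_geometry n1024 K0 (erefl al) w1 (erefl z) (erefl tau) gam01 nr s00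
    (introT andP (conj s0low s0up)) Wx2 xS xC.
  rewrite indicE mem_set ?SE// mul1r /g indicE mem_set// mul1r.
  set SX := dot (restrict_suppC w x) (restrict_suppC w x) in Wx1 Wx2.
  have -> : \prod_(i < n) p i (x ord0 i) =
     expR (\sum_(j | w ord0 j == 0) L (x ord0 j) - lam * SX - (N - k) * Psi).
    have -> : (N - k) * Psi = \sum_(j | w ord0 j == 0) Psi.
      by rewrite sumr_const -[LHS]mulrC -nk addrK mulr_natr.
    rewrite /SX dot_restrict_suppC mulr_sumr -!sumrB expR_sum [RHS]big_mkcond/=.
    apply: eq_bigr => i _; rewrite /p; case: (boolP (w ord0 i == 0)) => wi.
      by rewrite /ht indicE mem_set ?mul1r//= in_itv/= -ler_norml; exact/xC/eqP.
    rewrite indicE mem_set//= /Bx/= in_itv/=.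
    by move: (xS i wi); clear; rewrite ler_norml => /andP[? ?]; apply/andP; split; lra.
  rewrite -expRD ler_expR.
  have dx0 : 0 < dot x x by case/andP: xN => + _; apply: lt_le_trans.
  have nx : norm2 x <= 2 * q.
    rewrite -(@ler_pXn2r _ 2)// ?nnegrE ?norm2_ge0 ?mulr_ge0 ?(ltW q0)// exprMn q2 norm2_sqr.
    by case/andP: xN => _ /le_trans; apply; rewrite /N; clear; lra.
  have xK2 j : w ord0 j = 0 -> `|x ord0 j| <= 2 * K.
    by move=> wj; apply: le_trans (xC j wj) _; move: K0; clear; lra.
  have n0 : (0 < n)%N by exact: leq_trans n1024.
  have := hC1 n w x theta K n0 w1 th dx0 nx K0 xK2.
  rewrite -/q -/al -/(En _) -/(En _) -/N => hx.
  have hn : `|norm2 (q^-1 *: x) - 1| + norm2 (restrict_supp w (q^-1 *: x) - w) + K ^+ 2 / q <=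
     gam + 1 / N + (gam + 1 / N) + K ^+ 2 / q by rewrite lerD2r lerD.
  have Cn0 : 0 <= C1 * N by apply: mulr_ge0 => //; exact: ltW.
  have {hx hn} := le_trans hx (ler_wpM2l Cn0 hn); rewrite -/err.
  have -> : \sum_(j | w ord0 j == 0) column_energy mu (theta *: w) (x ord0 j) =
    \sum_(j | w ord0 j == 0) L (x ord0 j) by [].
  have h5 : lam * c - lam * SX <= A * D.
    rewrite -mulrBr; apply: le_trans (ler_norm _) _; rewrite normrM distrC.
    by apply: ler_pM.
  move: h5; rewrite ler_norml /E2 => h5 /andP[h6 _]; move: h5 h6.
  move: (En w) (En _) (\sum_(j | _) _) (lam * SX) (lam * c) (A * D) => e1 e2 e3 e4 e5 e6.
  move: (err) (N * (theta ^+ 2 * _)) ((N - k) * Psi); clear; move=> *; lra.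
have IP0 : (0 <= \int[P]_u (g u)%:E)%E by apply: integral_ge0 => u _; rewrite lee_fin.
have ZS : (\int[P]_u (g u)%:E * gaussian_rV n S <= \int[P]_u (g u)%:E)%E.
  by rewrite -[leRHS]mule1 lee_wpmul2l// probability_le1.
apply: le_trans ZS; rewrite polar.
have mpp : measurable_fun setT (fun x : borel_rV R n => \prod_(i < n) p i (x ord0 i)).
  exact: measurable_prod_coordT.
have mWp : measurable_fun setT (fun x : borel_rV R n =>
    \1_W (restrict_suppC w x) * \prod_(i < n) p i (x ord0 i)).
  apply: measurable_funM => //; apply: (measurableT_comp _ (measurable_restrict_suppC w)).
  exact: measurable_indic.
have lower : ((expR E2)%:E * \int[gaussian_rV n]_x
    (\1_W (restrict_suppC w x) * \prod_(i < n) p i (x ord0 i))%:E <=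
    \int[gaussian_rV n]_(x in S) (g (sphere_proj x))%:E)%E.
  rewrite -ge0_integralZl//; last 2 first.
  - exact/measurable_EFinP.
  - by move=> x _; rewrite lee_fin mulr_ge0// prodr_ge0.
  rewrite [leRHS]integral_mkcond; apply: ge0_le_integral => //.
  - by move=> x _; rewrite -EFinM lee_fin mulr_ge0 ?expR_ge0// mulr_ge0// prodr_ge0.
  - by apply: emeasurable_funM => //; exact/measurable_EFinP.
  - apply: (measurable_restrictT _ mSset).1 _; apply: measurable_funTS.
    apply/measurable_EFinP.
    exact: (measurableT_comp mg (@measurable_sphere_proj R n)).
  - move=> x _; rewrite -EFinM patchE; have := pointwise x; rewrite [\1_S _]indicE.
    by case: ifP => _; rewrite ?mul1r ?mul0r lee_fin.
apply: le_trans lower; rewrite fact.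
have -> : (\int[gaussian_rV n]_x (\1_W (restrict_suppC w x) *
      \prod_(i < n) (if w ord0 i == 0 then p i (x ord0 i) else 1))%:E =
   \int[gaussian_rV n]_x (\1_W (restrict_suppC w x) * \prod_(i < n) h i (x ord0 i))%:E)%E.
  apply: eq_integral => x _; congr (_ * _)%:E; apply: eq_bigr => i _.
  by rewrite /p /h; case: (w ord0 i == 0).
have e49 : expR (- (2 + 9 * ln N)) <= 1 / (4 * (n ^ 9)%:R).
  rewrite opprD expRD natrX -/N div1r invfM ler_pM ?expR_ge0//.
    rewrite expRN lef_pV2 ?posrE ?expR_gt0//.
    exact: four_le_expR2.
  by rewrite expRN expRM_natl lnK ?posrE.
apply: (@le_trans _ _ ((expR E2)%:E * ((expR Bd)%:E * (expR (- (2 + 9 * ln N)))%:E))%E); last first.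
  apply: lee_wpmul2l; first by rewrite lee_fin expR_ge0.
  apply: lee_pmul; rewrite ?lee_fin ?expR_ge0//.
  by apply: le_trans hm; rewrite lee_fin.
rewrite -!EFinM -!expRD lee_fin ler_expR.
rewrite -/N -/q -/k -/al.
pose l : R := ln N; pose Y : R := K ^+ 2 * q.
have l1 : 1 <= l by exact: ln1.
have Kq1 : 32 <= K * q by move: K3 q32; clear; nra.
have Y3 : 3 * (K * q) <= Y.
  by rewrite /Y expr2 -mulrA ler_wpM2r//; move: Kq1; clear; lra.
have lY : l <= Y.
  apply: (le_trans lnleK); apply: le_trans Y3; move: q32 K0; clear; nra.
have kW : k <= k * l by rewrite ler_peMr.
have DY : D <= 3 * Y by rewrite /D -mulrA; move: Y3 Kq1; clear; lra.
have Y1 : 1 <= Y by move: Y3 Kq1; clear; lra.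
have GY : Gm <= 13 * (rho^-1 * (Y + k * l)).
  have -> : 13 * (rho^-1 * (Y + k * l)) = 13 * (Y + k * l) * rho^-1 by ring.
  by rewrite /Gm ler_wpM2r//; move: DY kW Y1 k0; clear; lra.
have F1 : N * phi <= N * (lam * al + Psi) by rewrite ler_wpM2l// ltW.
have lamA' := lamA; have PsiA' := PsiA.
rewrite ler_norml in lamA'; rewrite ler_norml in PsiA'.
(* Replaces [c = (al + beta) * (N - k)] by [N * al]: the shift costs [A * N * beta], and the missing
   [k] coordinates cost [2 A k] through [lam] and [A k] through [Psi]. *)
have F2 : N * (lam * al + Psi) - A * (2 * (k + D + 2)) - 3 * (A * k) <= lam * c + (N - k) * Psi.
  have h1' : - (A * (N * beta)) <= lam * (N * beta).
    by rewrite -mulNr ler_wpM2r//; [rewrite mulr_ge0// ltW|case/andP: lamA'].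
  have h2' : lam * (al + beta) * k <= 2 * (A * k).
    rewrite mulrA ler_wpM2r//; apply: le_trans (ler_norm _) _.
    case/andP: al'12 => b1 b2; have b0 : 0 <= al + beta by apply: le_trans b1; exact: ltW.
    by rewrite normrM mulrC (ger0_norm b0); apply: ler_pM.
  have h3' : Psi * k <= A * k by rewrite ler_wpM2r//; case/andP: PsiA'.
  rewrite -betaN; have -> : lam * c + (N - k) * Psi = N * (lam * al + Psi) + lam * (N * beta)
      - lam * (al + beta) * k - Psi * k by rewrite cE; ring.
  by move: h1' h2' h3'; clear; lra.
have F3 : s0 ^+ 2 * norm2 w ^+ 2 / 2 <= N * (2^-1 * norm2 w ^+ 2) + Gm / 2.
  have w2 : norm2 w ^+ 2 <= 1 by rewrite expr_le1.
  have w20 : 0 <= norm2 w ^+ 2 by exact: sqr_ge0.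
  have : s0 ^+ 2 * norm2 w ^+ 2 <= (N + Gm) * norm2 w ^+ 2.
    by rewrite ler_wpM2r//; move: s0up; rewrite mulrDr mulr1 Ngam.
  by move: w2 w20 Gm0; clear; nra.
have F4 : err = C1 * (2 * Gm + 2 + Y).
  rewrite /err /Y -Ngam -q2; field; rewrite gt_eqF//.
have C1G : C1 * (2 * Gm + 2 + Y) <= C1 * (26 * (rho^-1 * (Y + k * l)) + 3 * (Y + k * l)).
  have W0 : 0 <= k * l by apply: le_trans kW.
  by rewrite ler_wpM2l//; move: GY Y1 W0; clear; lra.
have AG : A * (2 * (k + D + 2)) + 3 * (A * k) + A * D <= A * (28 * (Y + k * l)).
  have -> : A * (2 * (k + D + 2)) + 3 * (A * k) + A * D = A * (5 * k + 3 * D + 4) by ring.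
  by rewrite ler_wpM2l//; move: DY kW Y1 k0; clear; lra.
have C1R : 0 <= C1 * (rho^-1 * (Y + k * l)).
  by rewrite !mulr_ge0// addr_ge0 ?(le_trans _ Y1)// (le_trans _ kW).
have RY : 0 <= rho^-1 * (Y + k * l).
  by rewrite mulr_ge0// addr_ge0 ?(le_trans _ Y1)// (le_trans _ kW).
rewrite /E2 /Bd F4 -/l.
have -> : (C1 * (56 * rho^-1 + 3) + 28 * A + 14 * rho^-1 + 21) * (Y + k * l) =
  30 * (C1 * (rho^-1 * (Y + k * l))) + C1 * (26 * (rho^-1 * (Y + k * l)) + 3 * (Y + k * l)) +
  A * (28 * (Y + k * l)) + 14 * (rho^-1 * (Y + k * l)) + 21 * (Y + k * l) by ring.
have -> : k * (8 * l + 2) = 8 * (k * l) + 2 * k by ring.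
move: F1 F2 F3 C1G AG C1R RY GY kW lY Y1 l1 k0.
move: (C1 * (rho^-1 * (Y + k * l))) => c1.
move: (C1 * (26 * _ + _)) (C1 * (2 * _ + _ + _)) (A * (28 * _)) => c2 c3 c4.
move: (rho^-1 * _) (A * (2 * _)) (A * k) (A * D) => c5 c6 c7 c8.
move: (lam * c) ((N - k) * Psi) (N * (lam * al + Psi)) (N * phi) => c9 c10 c11 c12.
move: (s0 ^+ 2 * _ / 2) (N * (2^-1 * _)) (N * (theta ^+ 2 * _)) (En w) => c13 c14 c15 c16.
move: (k * l) (Gm) => c17 c18; move: (k) (l) (Y).
clear; move=> *; lra.
Qed.

(** * Integrating out the matrix *)

Lemma measurable_RV {d : measure_display} {Omega : measurableType d} {R : realType}
  (Pr : probability Omega R) (X : {RV Pr >-> measurableTypeR R}) :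
  measurable_fun setT (fun omega => X omega : R).
Proof. by move=> _ Y mY; have := @measurable_funPT _ _ _ _ X; exact. Qed.

Section independent_integral.
Context {d : measure_display} {Omega : measurableType d} {R : realType}.
Variables (Pr : probability Omega R) (mu : probability (measurableTypeR R) R).
Variables (I : finType) (D : {set I}) (X : I -> {RV Pr >-> measurableTypeR R}).
Hypothesis iidX : iid mu D X.

Definition sample_row (omega : Omega) : borel_rV R #|D| := \row_i X (enum_val i) omega.

Lemma measurable_sample_row : measurable_fun setT sample_row.
Proof.
apply: measurable_rV => i; under eq_fun do rewrite mxE.
exact: measurable_RV.
Qed.

Lemma sample_row_law (E : set (borel_rV R #|D|)) : measurable E ->
  Pr (sample_row @^-1` E) = product_prob mu #|D| E.
Proof.
pose m' : {measure set (borel_rV R #|D|) -> \bar R} :=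
  pushforward Pr sample_row.
pose m := m' measurable_sample_row.
move=> mE; suff : m E = product_prob mu #|D| E by [].
apply: measure_eq_box => // [|A mA].
  change (Pr (sample_row @^-1` setT) < +oo)%E.
  by rewrite preimage_setT probability_setT ltry.
(* [iid] takes a family of sets indexed by all of [I]; off [D] it is filled with [setT]. *)
pose A' (p : I) : set R := if [pick i | enum_val i == p] is Some i then A i else setT.
have A'E (i : 'I_#|D|) : A' (enum_val i) = A i.
  rewrite /A'; case: pickP => [j /eqP/enum_val_inj -> //|/(_ i)].
  by rewrite eqxx.
have mA' p : measurable (A' p).
  by rewrite /A'; case: pickP => // _; exact: measurableT.
transitivity (\prod_(i < #|D|) mu (A i))%E; last by symmetry; exact: product_prob_box.
transitivity (Pr (\bigcap_(p in [set` D]) (X p @^-1` A' p))).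
  congr (Pr _); apply/seteqP; split=> omega /= h.
    move=> p pD; rewrite /= -(enum_rankK_in pD pD) A'E.
    by have := h (enum_rank_in pD p); rewrite mxE.
  move=> i; rewrite mxE -A'E; exact: (h (enum_val i) (enum_valP i)).
rewrite (iidX.1 D A' (subxx _) mA') big_enum_val/=.
apply: eq_bigr => i _; rewrite A'E.
exact: (iidX.2 _ (enum_valP i) _ (mA i)).
Qed.

Lemma integral_iid_prod (h : I -> R -> R) :
  (forall p, measurable_fun setT (h p)) -> (forall p s, 0 <= h p s) ->
  (\int[Pr]_omega (\prod_(p in D) h p (X p omega))%:E =
   \prod_(p in D) \int[mu]_s (h p s)%:E)%E.
Proof.
move=> mh h0.
pose F (y : borel_rV R #|D|) : R := \prod_(i < #|D|) h (enum_val i) (y ord0 i).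
have mF : measurable_fun setT F.
  by apply: (@measurable_prod_coordT _ _ (fun i => h (enum_val i))) => i.
have F0 y : (0 <= (F y)%:E)%E by rewrite lee_fin prodr_ge0.
transitivity (\int[product_prob mu #|D|]_y (F y)%:E)%E; last first.
  rewrite (integral_product_prob mu (h := fun i => h (enum_val i)))//.
  by rewrite [RHS]big_enum_val.
pose m' : {measure set (borel_rV R #|D|) -> \bar R} :=
  pushforward Pr sample_row.
pose m := m' measurable_sample_row.
transitivity (\int[m]_y (F y)%:E)%E; last first.
  by apply: eq_measure_integral => A mA _; exact: sample_row_law.
transitivity (\int[Pr]_(omega in sample_row @^-1` setT) ((EFin \o F) \o sample_row) omega)%E.
  rewrite preimage_setT; apply: eq_integral => omega _ /=; congr EFin.
  by rewrite /F big_enum_val; apply: eq_bigr => i _; rewrite mxE.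
symmetry; apply: (ge0_integral_pushforward measurable_sample_row) => //.
exact/measurable_EFinP.
Qed.
End independent_integral.

(** The coefficient is [sqrt 2] on the diagonal, from the variance of the entries, and 2 off it,
    from the two orders of a pair. *)
Lemma quad_form_sum {R : realType} n (X : 'I_n * 'I_n -> R) (u : 'rV[R]_n) (theta : R) : (0 < n)%N ->
  n%:R * theta * quad_form (wigner_matrix X) u =
  \sum_(p in upper_triangle n) 2 `^ (2^-1 * (1 + (p.1 != p.2)%:R)) * theta * Num.sqrt n%:R *
     u ord0 p.1 * u ord0 p.2 * X p.
Proof.
move=> n0; pose q : R := Num.sqrt n%:R.
have q0 : 0 < q by rewrite sqrtr_gt0 ltr0n.
have q2 : q ^+ 2 = n%:R by rewrite sqr_sqrtr.
pose F (i j : 'I_n) : R := n%:R * theta * (u ord0 i * wigner_matrix X i j * u ord0 j).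
transitivity (\sum_i \sum_j F i j).
  rewrite /quad_form mxE mulr_sumr exchange_big/=; apply: eq_bigr => j _.
  rewrite !mxE mulr_suml mulr_sumr; apply: eq_bigr => i _.
  by [].
rewrite -sum_upper; last first.
  move=> i j; rewrite /F !mxE eq_sym.
  have -> : (if (i <= j)%N then (i, j) else (j, i)) = (if (j <= i)%N then (j, i) else (i, j)).
    by case: (ltngtP i j) => // ij; rewrite (val_inj ij).
  ring.
rewrite pair_big_dep/=; apply: eq_big => [[i j]|[i j] /= ij]; first by rewrite inE.
rewrite powR_half_indicator /F mxE ij -/q.
have qn : n%:R * q^-1 = q by rewrite -q2 expr2 mulfK// gt_eqF.
have [<-|_] := eqVneq i j.
  rewrite expr1 sqrtrM// sqrtrV// -/q.
  by rewrite -[in LHS]mulrA; rewrite -{2}qn; ring.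
by rewrite expr0 div1r sqrtrV// -/q -{2}qn; ring.
Qed.

Lemma integral_wigner {R : realType} (mu : probability (measurableTypeR R) R)
  (mu_sub_gaussian : sub_gaussian mu) (mu_mean : ('E_mu[id] = 0)%E)
  n (d : measure_display) (Omega : measurableType d) (Pr : probability Omega R)
  (X : 'I_n * 'I_n -> {RV Pr >-> measurableTypeR R})
  (P : probability (borel_rV R n) R) (U : set (borel_rV R n)) (theta : R) :
  (0 < n)%N -> iid mu (upper_triangle n) X -> measurable U ->
  (\int[Pr]_omega \int[P]_(u in U)
     (expR (n%:R * theta * quad_form (wigner_matrix (fun p => X p omega)) u))%:E =
   \int[P]_(u in U) (expR (energy (pair_energy mu) (theta * Num.sqrt n%:R) u))%:E)%E.
Proof.
move=> n0 iidX mU.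
pose c (u : 'rV[R]_n) (p : 'I_n * 'I_n) : R :=
  2 `^ (2^-1 * (1 + (p.1 != p.2)%:R)) * theta * Num.sqrt n%:R * u ord0 p.1 * u ord0 p.2.
pose f (y : Omega * borel_rV R n) : \bar R :=
  (\1_U y.2 * expR (\sum_(p in upper_triangle n) c y.2 p * X p y.1))%:E.
have mc p : measurable_fun setT (fun u : borel_rV R n => c u p).
  by apply: measurable_funM; [apply: measurable_funM => //|]; exact: measurable_coord.
have mf : measurable_fun setT f.
  apply/measurable_EFinP; apply: measurable_funM.
    apply: (measurableT_comp _ measurable_snd); exact: measurable_indic.
  apply: measurableT_comp => //.
  under eq_fun do rewrite big_mkcond/=.
  apply: measurable_sum => p; case: (p \in upper_triangle n); last exact: measurable_cst.
  apply: measurable_funM.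
    exact: (measurableT_comp (mc p) measurable_snd).
  exact: (measurableT_comp (measurable_RV (X p)) measurable_fst).
have f0 y : (0 <= f y)%E by rewrite lee_fin mulr_ge0 ?expR_ge0.
transitivity (\int[Pr]_omega \int[P]_u f (omega, u))%E.
  apply: eq_integral => omega _; rewrite integral_mkcond; apply: eq_integral => u _.
  rewrite patchE /f/= indicE quad_form_sum//.
  by case: ifP => _; rewrite ?mul1r ?mul0r.
rewrite (fubini_tonelli _ mf f0).
rewrite [RHS]integral_mkcond; apply: eq_integral => u _; rewrite patchE /f/= indicE.
case: ifP => _; last by under eq_integral do rewrite mul0r; rewrite integral0.
under eq_integral do rewrite mul1r expR_sum.
rewrite (integral_iid_prod iidX (h := fun p s => expR (c u p * s))); last 2 first.
- by move=> p; apply: measurableT_comp => //; exact: measurable_funM.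
- by move=> p s; exact: expR_ge0.
rewrite -pair_sum_energy pair_big_dep/= expR_sum -prodEFin.
apply: eq_big => [[i j]|[i j] _]; first by rewrite inE.
have := mgfE mu_sub_gaussian (c u (i, j)).
rewrite mmt_gen_funE Lam_def lnK ?posrE; last exact: mgf_gt0.
by move=> <-.
Qed.

(** * Asymptotics of the free energy *)

Theorem proposition2p18 (R : realType)
    (mu : probability (measurableTypeR R) R)
    (mu_mean : ('E_mu[id] = 0)%E) (mu_var : ('V_mu[id] = 1)%E)
    (mu_sub_gaussian : sub_gaussian mu)
    (T rho : R) (T_ge1 : 1 <= T) (rho_bounds : 0 < rho < 2^-1) :
  exists C : R, forall eta : R, 0 < eta < 4^-1 ->
  exists N0 : nat, forall N : nat, (N0 <= N)%N ->
  forall (d : measure_display) (Omega : measurableType d)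
    (Pr : probability Omega R)
    (X : 'I_N * 'I_N -> {RV Pr >-> measurableTypeR R})
    (P : probability (borel_rV R N) R),
  iid mu (upper_triangle N) X ->
  uniform_on_sphere P ->
  forall (w : 'rV[R]_N) (theta K r : R),
  norm2 w <= 1 - rho ->
  (norm0 w)%:R <= N%:R `^ (1 - 2 * eta) ->
  0 <= theta <= T ->
  ln N%:R <= K <= N%:R `^ (4^-1) ->
  N%:R ^- 4 <= r <= rho / 10 ->
  (`| F_N X P theta (U_set w r K) - varphi mu K theta w | <=
   (C * (r + K ^+ 2 * N%:R `^ (- 2^-1) + N%:R `^ (- (2 * eta)) * ln N%:R))%:E)%E.
Proof.
have [Cu [Cu0 upper]] := sphere_integral_upper mu_sub_gaussian mu_mean mu_var T_ge1 rho_bounds.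
have [Cl [Cl0 lower]] := sphere_integral_lower mu_sub_gaussian mu_mean mu_var T_ge1 rho_bounds.
have [rho0 rho2] := andP rho_bounds.
exists (Cu + Cl) => eta /andP[eta0 eta4].
(* A threshold for [ln N]. Its terms give [3 <= ln N <= K], [12 * N^(- 2 eta) <= rho] and
   [96 / rho <= N^(1/4)]. Here [eta] enters the threshold, while the constant [Cu + Cl] is already
   fixed. *)
pose B : R := 3 + 6 / (rho * eta) + 384 / rho.
exists (maxn 1024 (Num.truncn (expR B)).+1) => N; rewrite geq_max => /andP[N1024 NB].
move=> d Omega Pr X P iidX unifP w theta K r wr kN th /andP[Kln Kb] /andP[rN _].
pose n : R := N%:R; pose l : R := ln n; pose q : R := Num.sqrt n; pose b : R := n `^ 4^-1.
pose k : R := (norm0 w)%:R.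
have n1024 : 1024 <= n by rewrite /n ler_nat.
have n0 : 0 < n by move: n1024; clear; lra.
have pE (e : R) : n `^ e = expR (e * l) by rewrite /powR gt_eqF.
have Bl : B <= l.
  rewrite -ler_expR /l lnK ?posrE//; apply: ltW; apply: lt_le_trans (truncnS_gt _) _.
  by rewrite /n ler_nat.
have rV0 : 0 < rho^-1 by rewrite invr_gt0.
have eV0 : 0 < (rho * eta)^-1 by rewrite invr_gt0 mulr_gt0.
have l3 : 3 <= l by move: Bl rV0 eV0; rewrite /B; clear; lra.
have l384 : 384 / rho <= l by move: Bl rV0 eV0; rewrite /B; clear; lra.
have l6 : 6 / (rho * eta) <= l by move: Bl rV0 eV0; rewrite /B; clear; lra.
have q2 : q ^+ 2 = n by rewrite sqr_sqrtr// ltW.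
have q0 : 0 < q by rewrite sqrtr_gt0.
have qp : n `^ 2^-1 = q := powR12_sqrt (ltW n0).
have bq : b ^+ 2 = q.
  rewrite -qp /b (pE 4^-1) (pE 2^-1) -expRM_natl; congr expR.
  by clear; lra.
have bl : 1 + 4^-1 * l <= b by rewrite /b pE; exact: expR_ge1Dx.
have b96 : 96 / rho <= b by move: bl l384; clear; lra.
have b1 : 1 <= b by move: bl l3; clear; lra.
have b0 : 0 < b by move: b1; clear; lra.
have bq1 : b <= q by rewrite -bq expr2 ler_peMl// ltW.
have K3 : 3 <= K by exact: le_trans Kln.
have K0 : 0 <= K by move: K3; clear; lra.
have Kq : K <= q by exact: le_trans bq1.
have k0 : 0 <= k by rewrite /k.
pose t : R := n `^ (- (2 * eta)).
have t0 : 0 < t by rewrite powR_gt0.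
have kt : k <= n * t.
  have nE : expR l = n by rewrite lnK ?posrE.
  apply: le_trans kN _; rewrite -/n /t !pE -[X in _ <= X * _]nE -expRD ler_expR.
  by clear; lra.
have t12 : 12 * t <= rho.
  rewrite /t pE mulNr expRN ler_pdivrMr ?expR_gt0//.
  apply: (@le_trans _ _ (rho * (2 * eta * l))); last first.
    by rewrite ler_wpM2l ?(ltW rho0)//; apply: le_trans (expR_ge1Dx _); rewrite lerDr.
  move: l6; rewrite ler_pdivrMr ?mulr_gt0//; clear; lra.
(* Each summand takes a third of [rho * n]: the first by sparsity, the second by [K <= b] and
   [b ^+ 2 = q], the last by [ln n <= n]. *)
have small : 4 * (k + 8 * K * q + 2) <= rho * n.
  have h1 : 4 * k <= rho * n / 3.
    apply: (@le_trans _ _ (4 * (n * t))); first by rewrite ler_wpM2l.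
    by move: (ler_wpM2l (ltW n0) t12); clear; lra.
  have h2 : 32 * (K * q) <= rho * n / 3.
    have hb : 96 * b <= rho * q.
      rewrite -bq expr2 mulrA ler_wpM2r ?(ltW b0)//.
      by move: b96; rewrite ler_pdivrMr// mulrC.
    have hK : 96 * K <= rho * q by apply: le_trans hb; rewrite ler_wpM2l.
    have := ler_wpM2r (ltW q0) hK.
    have -> : rho * q * q = rho * n by rewrite -q2; ring.
    by clear; lra.
  have h3 : 24 <= rho * n.
    have ln_le : l <= n by exact: ltW (ln_sublinear n0).
    have : 384 / rho <= n by apply: le_trans ln_le.
    rewrite ler_pdivrMr// mulrC; clear; lra.
  by move: h1 h2 h3; clear; lra.
have r0 : 0 <= r by apply: le_trans rN; rewrite invr_ge0 exprn_ge0// ler0n.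
have [phi [phiE up]] := upper N P w theta K r N1024 unifP wr th K3 r0.
have low := lower N P w theta K r phi N1024 unifP wr th _ _ small rN phiE.
have {}low := low (introT andP (conj K3 Kq)) (introT andP (conj (le_trans (ler1n _ 3) l3) Kln)).
have mU : measurable (U_set w r K : set (borel_rV R N)) by exact: measurable_U_set.
have N0 : (0 < N)%N by exact: leq_trans N1024.
rewrite /F_N (@integral_wigner R mu mu_sub_gaussian mu_mean N d Omega Pr X P _ theta N0 iidX mU) /varphi f_N_energy// phiE -/n.
move: up low; set Z := (\int[P]_(u in _) _)%E.
set En := energy _ _ w; set aa := N%:R * (theta ^+ 2 * _); set ww := N%:R * (2^-1 * _).

case: Z => [z| |].
- rewrite !lee_fin => zup zlow.
  have z0 : 0 < z by apply: lt_le_trans zlow; exact: expR_gt0.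
  rewrite -(ler_ln) ?posrE ?expR_gt0// expRK in zup.
  rewrite -(ler_ln) ?posrE ?expR_gt0// expRK in zlow.
  rewrite lne_EFin//.
  change (`|n^-1 * ln z - (n^-1 * En + theta ^+ 2 * (1 - norm2 w ^+ 2) ^+ 2 + phi -
      2^-1 * norm2 w ^+ 2)| <=
    (Cu + Cl) * (r + K ^+ 2 * n `^ (- 2^-1) + n `^ (- (2 * eta)) * ln n)).
  have nV0 : 0 < n^-1 by rewrite invr_gt0.
  have qV : n `^ (- 2^-1) = n^-1 * q by rewrite powRN qp -q2 expr2 invfM mulfVK// gt_eqF.
  have kn : n^-1 * k <= t * l.
    apply: (@le_trans _ _ t); first by rewrite mulrC ler_pdivrMr// mulrC.
    by rewrite ler_peMr ?(ltW t0)//; move: l3; clear; lra.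
  have kln : n^-1 * (k * l) <= t * l.
    rewrite mulrA ler_wpM2r//; first by move: l3; clear; lra.
    by rewrite mulrC ler_pdivrMr// mulrC.
  rewrite -/n -/l -/t qV.
  have Y0 : 0 <= K ^+ 2 * (n^-1 * q) by rewrite !mulr_ge0 ?sqr_ge0 ?(ltW nV0) ?(ltW q0).
  have tl0 : 0 <= t * l by apply: le_trans kn; rewrite mulr_ge0// ltW.
  have nVn : n^-1 * n = 1 by rewrite mulVf// gt_eqF.
  have E1 : n^-1 * (En + aa + n * phi - ww) =
      n^-1 * En + theta ^+ 2 * (1 - norm2 w ^+ 2) ^+ 2 + phi - 2^-1 * norm2 w ^+ 2.
    by rewrite /aa /ww -/n; field; rewrite gt_eqF.
  have up' : n^-1 * ln z <= n^-1 * (En + aa + n * phi - ww) +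
      (Cu * (r + K ^+ 2 * (n^-1 * q) + n^-1 * k)).
    have := ler_wpM2l (ltW nV0) zup; rewrite -/n -/q -/k => /le_trans; apply.
    rewrite mulrDr lerD2l le_eqVlt; apply/orP; left; apply/eqP.
    by field; rewrite gt_eqF.
  have low' : n^-1 * (En + aa + n * phi - ww) - Cl * (K ^+ 2 * (n^-1 * q) + n^-1 * (k * l)) <=
      n^-1 * ln z.
    have := ler_wpM2l (ltW nV0) zlow; rewrite -/n -/q -/k -/l; apply: le_trans.
    rewrite [leRHS]mulrBr lerD2l lerN2 le_eqVlt; apply/orP; left; apply/eqP.
    by field; rewrite gt_eqF.
  rewrite E1 in up' low'.
  have U2 : Cu * (r + K ^+ 2 * (n^-1 * q) + n^-1 * k) <= Cu * (r + K ^+ 2 * (n^-1 * q) + t * l).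
    by rewrite ler_wpM2l// lerD2l.
  have L2 : Cl * (K ^+ 2 * (n^-1 * q) + n^-1 * (k * l)) <= Cl * (r + K ^+ 2 * (n^-1 * q) + t * l).
    by rewrite ler_wpM2l//; move: r0 kln; clear; lra.
  have S0 : 0 <= r + K ^+ 2 * (n^-1 * q) + t * l by rewrite !addr_ge0.
  have CuS := mulr_ge0 Cu0 S0; have ClS := mulr_ge0 Cl0 S0.
  rewrite (mulrDl Cu Cl) ler_norml; move: up' low' U2 L2 CuS ClS.
  move: (Cu * (_ + t * l)) (Cl * (_ + t * l)) => c1 c2.
  move: (Cu * _) (Cl * _) => c3 c4.
  move: (n^-1 * ln z) (n^-1 * En) (theta ^+ 2 * _) (2^-1 * _) => c5 c6 c7 c8.
  by clear => *; apply/andP; split; lra.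
(* Infinite values of the integral contradict the upper or the lower bound. *)
- by rewrite leye_eq.
- by move=> _; rewrite leeNy_eq.
Qed.
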